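(* Let $f_1,f_2\in A_\mathbb{R}(\mathbb{D})$ with $\|f_1\|_\infty\le 1$, $\|f_2\|_\infty\le 1$, suppose $f_1$ is POZ of $f_2$, and suppose $$\inf_{z\in\overline{\mathbb{D}}}\big(|f_1(z)|+|f_2(z)|\big)=\delta>0.$$ Then there exist $g_1,g_2\in A_\mathbb{R}(\mathbb{D})$ such that $g_1^{-1}\in A_\mathbb{R}(\mathbb{D})$ (i.e. $g_1$ has no zeros on $\overline{\mathbb{D}}$) and $$f_1(z)g_1(z)+f_2(z)g_2(z)=1\quad\text{for all } z\in\overline{\mathbb{D}}.$$
   Context: $\mathbb{D}$ is the open unit disc in $\mathbb{C}$. $A(\mathbb{D})$ (the disc algebra) is the set of functions continuous on $\overline{\mathbb{D}}$ and holomorphic on $\mathbb{D}$. $A_\mathbb{R}(\mathbb{D})$ is the set of $f\in A(\mathbb{D})$ with real Fourier (Taylor) coefficients, equivalently satisfying the real-symmetry condition $f(z)=\overline{f(\overline{z})}$ for all $z\in\overline{\mathbb{D}}$; in particular such $f$ are real-valued on $[-1,1]$. $\|f\|_\infty=\sup_{\overline{\mathbb{D}}}|f|$. For $f_1,f_2\in A_\mathbb{R}(\mathbb{D})$ we say ''$f_1$ is POZ of $f_2$'' (positive on real zeros) if $f_1$ takes values of the same sign at all real zeros of $f_2$, i.e. at all points $\lambda\in[-1,1]$ with $f_2(\lambda)=0$. *)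

(* Defs.v *)
From Stdlib Require Import Reals.
From Coquelicot Require Import Coquelicot.
Open Scope R_scope.

Definition in_D (z : C) : Prop := Cmod z < 1.
Definition in_cD (z : C) : Prop := Cmod z <= 1.

Definition C_differentiable (f : C -> C) (z : C) : Prop :=
  @ex_derive C_AbsRing C_NormedModule f z.

Definition disc_algebra (f : C -> C) : Prop :=
  (forall z, in_cD z -> filterlim f (within in_cD (locally z)) (locally (f z))) /\
  (forall z, in_D z -> C_differentiable f z).

Definition real_disc_algebra (f : C -> C) : Prop :=
  disc_algebra f /\ (forall z, in_cD z -> f z = Cconj (f (Cconj z))).

Definition sup_norm_le1 (f : C -> C) : Prop :=
  forall z, in_cD z -> Cmod (f z) <= 1.

Definition real_zero (f2 : C -> C) (l : R) : Prop :=
  -1 <= l <= 1 /\ f2 (RtoC l) = 0%C.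

(* f1 is POZ of f2: f1 takes values of the same (strict) sign at all real zeros
   of f2 (f1 is real-valued on [-1,1], so we look at its real part) *)
Definition POZ (f1 f2 : C -> C) : Prop :=
  (forall l, real_zero f2 l -> 0 < Re (f1 (RtoC l))) \/
  (forall l, real_zero f2 l -> Re (f1 (RtoC l)) < 0).

(* Main.v *)
Require Import Defs.
From Stdlib Require Import Reals Lra Lia Classical ClassicalEpsilon List.
From Coquelicot Require Import Coquelicot.
Import ListNotations.
Open Scope R_scope.

(* It suffices to write [f1 = u + h f2] with [u] invertible, i.e. to lift [f1] to a unit modulo
   [f2]; liftable elements are closed under products.

   Two functions [x], [f2] without common zeros satisfy a Bezout identity [a x + b f2 = 1]
   (Gelfand's theory: since polynomials are dense, [z - lam] is invertible modulo the ideal for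
   every [lam], hence the class of [z] would have empty spectrum in a nonzero quotient). It follows
   that [y] near [x] equals [x (1 + (y - x) a) + (y - x) b f2], so liftability is locally constant
   in [x]. In particular [f1] may be replaced by a nearby real polynomial, which has no zero in
   common with [f2] and has constant sign on the real zeros of [f2].

   Such a polynomial is treated by removing its roots in the closed disc. For a pair of conjugate
   roots, [(z - v)(z - conj v)] lifts when [|v| > 1], and the exceptional set of [v] is open with
   boundary inside the zero set of [f2], hence empty by the maximum principle. A real root with no
   zero of [f2] on one side is pushed out of the disc along the real axis. A real root between two
   consecutive real zeros of [f2] is accompanied, by the constancy of sign, by a second one in the
   same gap; merging the two gives a conjugate pair. *)

(** * Complex differentiability and the disc algebra *)

(** A unit [u] of the real algebra is real and without zeros on [[-1,1]], so it has constant sign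
    there, and [f1 = u + h f2] makes it agree with [f1] at the zeros of [f2]. Hence the sign
    condition is necessary, and a single factor [z - a] with real zeros of [f2] on both sides of [a]
    cannot lift by itself: such roots have to be taken in pairs. Constancy of sign at the real zeros
    of [f2] is therefore the invariant to preserve whenever a factor is divided out.

    At a boundary point [lam] a function of the algebra cannot in general be divided by [z - lam]
    inside the algebra, whereas a polynomial can; this is what density is for. Emptiness of the
    spectrum is obtained without Liouville's theorem: averages of resolvents over [rho] times the
    [n]-th roots of unity equal [(1 - z^n / rho^n)^-1] modulo the ideal, and estimates uniform in
    [n] let [rho] descend from 2 to nearly 0 in finitely many equal steps. Roots of unity also
    replace integrals in the maximum principle, which is applied to a polynomial close to [f2]. *)

Definition continuous_in (S : C -> Prop) (f : C -> C) (z : C) : Prop :=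
  forall eps, 0 < eps -> exists d, 0 < d /\
    forall w, S w -> Cmod (w - z) < d -> Cmod (f w - f z) < eps.

(** Balls of the uniform structure on [C] are squares, so comparing them with [Cmod] costs a factor
    [sqrt 2]; the halved radii absorb it through [sqrt 2 <= 2]. *)
Lemma filterlim_within_locally_C (S : C -> Prop) (f : C -> C) (z : C) :
  filterlim f (within S (locally z)) (locally (f z)) <-> continuous_in S f z.
Proof.
  split.
  - intros H eps He.
    destruct (proj1 (filterlim_locally _ _) H
       (mkposreal (eps / 2) (ltac:(lra)))) as [d Hd].
    exists d; split; [apply cond_pos|]. intros w Sw Hw.
    specialize (Hd w (C_NormedModule_mixin_compat1 z w d Hw) Sw).
    apply C_NormedModule_mixin_compat2 in Hd. simpl in Hd.
    eapply Rlt_le_trans; [exact Hd|].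
    assert (sqrt 2 <= 2). { 
      rewrite <- (sqrt_square 2) at 2 by lra. apply sqrt_le_1_alt. lra. }
    nra.
  - intros H. apply filterlim_locally. intros eps.
    destruct (H eps (cond_pos eps)) as [d [Hd H']].
    assert (Hd2 : 0 < d / 2) by lra.
    exists (mkposreal _ Hd2). intros w Hw Sw.
    apply C_NormedModule_mixin_compat1. apply H'; auto.
    apply C_NormedModule_mixin_compat2 in Hw. simpl in Hw.
    eapply Rlt_le_trans; [exact Hw|].
    assert (sqrt 2 <= 2). { rewrite <- (sqrt_square 2) at 2 by lra. apply sqrt_le_1_alt. lra. }
    nra.
Qed.

Lemma C_differentiable_iff (f : C -> C) (z : C) :
  C_differentiable f z <->
  exists l : C, forall eps, 0 < eps -> exists d, 0 < d /\
    forall w, Cmod (w - z) < d -> Cmod (f w - f z - l * (w - z)) <= eps * Cmod (w - z).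
Proof.
  split.
  - intros [l [_ Hl]]. exists l. intros eps He.
    specialize (Hl z (fun P HP => HP) (mkposreal _ He)).
    destruct Hl as [d Hd]. exists d; split; [apply cond_pos|].
    intros w Hw. specialize (Hd w Hw). simpl in Hd.
    unfold minus, plus, opp, scal, norm in Hd; simpl in Hd.
    unfold mult in Hd; simpl in Hd.
    replace (f w - f z - l * (w - z))%C with (f w + - f z + - ((w + - z) * l))%C by ring.
    exact Hd.
  - intros [l Hl]. exists l. split. apply is_linear_scal_l.
    intros x Hx eps.
    (* The derivative is required at every limit of the filter [locally z], and [z] is the only
       one. *)
    apply (is_filter_lim_locally_unique (K := C_AbsRing) (V := AbsRing_NormedModule C_AbsRing)) in Hx.
    subst x.
    destruct (Hl eps (cond_pos eps)) as [d [Hd H]].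
    exists (mkposreal _ Hd). intros w Hw. specialize (H w Hw).
    unfold minus, plus, opp, scal, norm; simpl. unfold mult; simpl.
    replace (f w + - f z + - ((w + - z) * l))%C with (f w - f z - l * (w - z))%C by ring.
    exact H.
Qed.

Lemma Cmod_sub_le (a b : C) : Cmod a <= Cmod b + Cmod (a - b).
Proof. replace a with (b + (a - b))%C at 1 by ring. apply Cmod_triangle. Qed.

Lemma Cmod_sub_sym (a b : C) : Cmod (a - b) = Cmod (b - a).
Proof. rewrite <- Cmod_opp. f_equal. ring. Qed.

Lemma Cmod_sub_diag (a : C) : Cmod (a - a) = 0.
Proof. replace (a - a)%C with (RtoC 0) by ring. apply Cmod_0. Qed.

Lemma continuous_in_const S c z : continuous_in S (fun _ => c) z.
Proof.
  intros e He; exists 1; split; [lra|]; intros. rewrite Cmod_sub_diag; lra.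
Qed.

Lemma continuous_in_id S z : continuous_in S (fun w => w) z.
Proof. intros e He; exists e; auto. Qed.

Lemma continuous_in_plus S f g z :
  continuous_in S f z -> continuous_in S g z ->
  continuous_in S (fun w => f w + g w)%C z.
Proof.
  intros Hf Hg e He.
  destruct (Hf (e / 2) ltac:(lra)) as [d1 [Hd1 H1]].
  destruct (Hg (e / 2) ltac:(lra)) as [d2 [Hd2 H2]].
  exists (Rmin d1 d2); split; [apply Rmin_pos; auto|].
  intros w Sw Hw.
  specialize (H1 w Sw (Rlt_le_trans _ _ _ Hw (Rmin_l _ _))).
  specialize (H2 w Sw (Rlt_le_trans _ _ _ Hw (Rmin_r _ _))).
  replace (f w + g w - (f z + g z))%C with ((f w - f z) + (g w - g z))%C by ring.
  eapply Rle_lt_trans; [apply Cmod_triangle|]. lra.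
Qed.

Lemma continuous_in_mult S f g z :
  continuous_in S f z -> continuous_in S g z ->
  continuous_in S (fun w => f w * g w)%C z.
Proof.
  intros Hf Hg e He.
  pose proof (Cmod_ge_0 (f z)) as Pf. pose proof (Cmod_ge_0 (g z)) as Pg.
  set (K := Cmod (f z) + Cmod (g z) + 1).
  assert (HK : 0 < K) by (unfold K; lra).
  assert (He' : 0 < Rmin 1 (e / (2 * K))).
  { apply Rmin_pos; [lra|]. apply Rdiv_lt_0_compat; lra. }
  destruct (Hf _ He') as [d1 [Hd1 H1]].
  destruct (Hg _ He') as [d2 [Hd2 H2]].
  exists (Rmin d1 d2); split; [apply Rmin_pos; auto|].
  intros w Sw Hw.
  specialize (H1 w Sw (Rlt_le_trans _ _ _ Hw (Rmin_l _ _))).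
  specialize (H2 w Sw (Rlt_le_trans _ _ _ Hw (Rmin_r _ _))).
  replace (f w * g w - f z * g z)%C
    with ((f w - f z) * (g w - g z) + (f w - f z) * g z + f z * (g w - g z))%C by ring.
  eapply Rle_lt_trans; [apply Cmod_triangle|].
  eapply Rle_lt_trans; [apply Rplus_le_compat_r, Cmod_triangle|].
  rewrite !Cmod_mult.
  pose proof (Rmin_l 1 (e / (2 * K))). pose proof (Rmin_r 1 (e / (2 * K))).
  assert (HE : e / (2 * K) * K = e / 2) by (field; lra).
  set (m := Rmin 1 (e / (2 * K))) in *.
  pose proof (Cmod_ge_0 (f w - f z)). pose proof (Cmod_ge_0 (g w - g z)).
  assert (m * K <= e / 2) by nra.
  unfold K in *. nra.
Qed.

Lemma continuous_in_inv S f z :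
  continuous_in S f z -> f z <> 0%C ->
  continuous_in (fun w => S w /\ f w <> 0%C) (fun w => / f w)%C z.
Proof.
  intros Hf Hz e He.
  pose proof (proj1 (Cmod_gt_0 _) Hz) as P.
  set (m := Cmod (f z)) in *.
  (* The first bound keeps [Cmod (f w)] above [m / 2]; the second then makes the difference of
     inverses less than [e / 2]. *)
  assert (He' : 0 < Rmin (m / 2) (e * m * m / 4)).
  { apply Rmin_pos; [lra|]. apply Rdiv_lt_0_compat; [|lra].
    apply Rmult_lt_0_compat; [apply Rmult_lt_0_compat|]; lra. }
  destruct (Hf _ He') as [d [Hd H]].
  exists d; split; auto. intros w [Sw Nw] Hw. specialize (H w Sw Hw).
  replace (/ f w - / f z)%C with ((f z - f w) / (f w * f z))%C by (field; auto).
  rewrite Cmod_div by (apply Cmult_neq_0; auto).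
  rewrite Cmod_mult. fold m. rewrite Cmod_sub_sym.
  pose proof (Rmin_l (m / 2) (e * m * m / 4)). pose proof (Rmin_r (m / 2) (e * m * m / 4)).
  pose proof (Cmod_sub_le (f z) (f w)) as T. rewrite Cmod_sub_sym in T. fold m in T.
  assert (m / 2 < Cmod (f w)) by lra.
  assert (0 < Cmod (f w) * m) by nra.
  apply Rmult_lt_reg_r with (Cmod (f w) * m); auto.
  unfold Rdiv. rewrite Rmult_assoc, Rinv_l, Rmult_1_r by lra.
  assert (m / 2 * (m * e) < Cmod (f w) * (m * e)).
  { apply Rmult_lt_compat_r; nra. }
  nra.
Qed.

(** Caratheodory's form of the derivative: the slope extends continuously to [z]. The rules of
    differentiation become algebraic identities between slopes together with continuity. *)
Lemma C_differentiable_slope (f : C -> C) (z : C) :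
  C_differentiable f z <->
  exists phi : C -> C, continuous_in (fun _ => True) phi z /\
    exists d, 0 < d /\
    forall w, Cmod (w - z) < d -> (f w - f z = phi w * (w - z))%C.
Proof.
  rewrite C_differentiable_iff. split.
  - intros [l H].
    exists (fun w => match Req_EM_T (Cmod (w - z)) 0 with
              | left _ => l | right _ => ((f w - f z) / (w - z))%C end).
    split.
    + intros e He. destruct (H (e / 2) ltac:(lra)) as [d [Hd H']].
      exists d; split; auto. intros w _ Hw.
      destruct (Req_EM_T (Cmod (z - z)) 0) as [_|N]; [|destruct N; apply Cmod_sub_diag].
      destruct (Req_EM_T (Cmod (w - z)) 0) as [E|N].
      * rewrite Cmod_sub_diag. lra.
      * assert (Hn : (w - z <> 0)%C) by (intro X; apply N; rewrite X; apply Cmod_0).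
        replace ((f w - f z) / (w - z) - l)%C with ((f w - f z - l * (w - z)) / (w - z))%C
          by (field; auto).
        rewrite Cmod_div by auto.
        specialize (H' w Hw). pose proof (proj1 (Cmod_gt_0 _) Hn).
        apply Rle_lt_trans with (e / 2); [|lra].
        apply Rmult_le_reg_r with (Cmod (w - z)); auto.
        unfold Rdiv at 1. rewrite Rmult_assoc, Rinv_l, Rmult_1_r; lra.
    + exists 1; split; [lra|]. intros w _.
      destruct (Req_EM_T (Cmod (w - z)) 0) as [E|N].
      * apply Cmod_eq_0 in E. rewrite E.
        replace w with z; [ring|]. replace z with (w - (w - z))%C by ring.
        rewrite E. ring.
      * field. intro X; apply N; rewrite X; apply Cmod_0.
  - intros [phi [Hphi [d0 [Hd0 E]]]]. exists (phi z). intros e He.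
    destruct (Hphi e He) as [d [Hd H]].
    exists (Rmin d d0); split; [apply Rmin_pos; auto|]. intros w Hw.
    rewrite E by (eapply Rlt_le_trans; [exact Hw|apply Rmin_r]).
    replace (phi w * (w - z) - phi z * (w - z))%C with ((phi w - phi z) * (w - z))%C by ring.
    rewrite Cmod_mult. apply Rmult_le_compat_r; [apply Cmod_ge_0|].
    left; apply H; auto. eapply Rlt_le_trans; [exact Hw|apply Rmin_l].
Qed.

Lemma C_differentiable_continuous_in f z :
  C_differentiable f z -> continuous_in (fun _ => True) f z.
Proof.
  rewrite C_differentiable_slope. intros [phi [Hphi [d0 [Hd0 E]]]].
  assert (K : continuous_in (fun _ => True) (fun w => phi w * (w + - z) + f z)%C z).
  { apply continuous_in_plus; [|apply continuous_in_const].
    apply continuous_in_mult; auto.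
    apply continuous_in_plus; [apply continuous_in_id | apply continuous_in_const]. }
  intros e He. destruct (K e He) as [d [Hd H]].
  exists (Rmin d d0); split; [apply Rmin_pos; auto|]. intros w _ Hw.
  assert (W1 := Rlt_le_trans _ _ _ Hw (Rmin_l _ _)).
  assert (W2 := Rlt_le_trans _ _ _ Hw (Rmin_r _ _)).
  specialize (H w I W1). specialize (E w W2).
  replace (f w - f z)%C with (phi w * (w + - z) + f z - (phi z * (z + - z) + f z))%C; auto.
  rewrite E. ring.
Qed.

Lemma C_differentiable_const c z : C_differentiable (fun _ => c) z.
Proof.
  apply C_differentiable_slope. exists (fun _ => RtoC 0). split; [apply continuous_in_const|].
  exists 1; split; [lra|]. intros; ring.
Qed.

Lemma C_differentiable_id z : C_differentiable (fun w => w) z.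
Proof.
  apply C_differentiable_slope. exists (fun _ => RtoC 1). split; [apply continuous_in_const|].
  exists 1; split; [lra|]. intros; ring.
Qed.

Lemma C_differentiable_plus f g z :
  C_differentiable f z -> C_differentiable g z ->
  C_differentiable (fun w => f w + g w)%C z.
Proof.
  rewrite !C_differentiable_slope.
  intros [p [Hp [d1 [Hd1 E1]]]] [q [Hq [d2 [Hd2 E2]]]].
  exists (fun w => p w + q w)%C. split; [apply continuous_in_plus; auto|].
  exists (Rmin d1 d2); split; [apply Rmin_pos; auto|]. intros w Hw.
  specialize (E1 w (Rlt_le_trans _ _ _ Hw (Rmin_l _ _))).
  specialize (E2 w (Rlt_le_trans _ _ _ Hw (Rmin_r _ _))).
  replace (f w + g w - (f z + g z))%C with ((f w - f z) + (g w - g z))%C by ring.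
  rewrite E1, E2. ring.
Qed.

Lemma C_differentiable_mult f g z :
  C_differentiable f z -> C_differentiable g z ->
  C_differentiable (fun w => f w * g w)%C z.
Proof.
  intros Df Dg. pose proof (C_differentiable_continuous_in _ _ Dg) as Cg. revert Df Dg.
  rewrite !C_differentiable_slope.
  intros [p [Hp [d1 [Hd1 E1]]]] [q [Hq [d2 [Hd2 E2]]]].
  exists (fun w => p w * g w + f z * q w)%C. split.
  { apply continuous_in_plus; apply continuous_in_mult; auto; apply continuous_in_const. }
  exists (Rmin d1 d2); split; [apply Rmin_pos; auto|]. intros w Hw.
  specialize (E1 w (Rlt_le_trans _ _ _ Hw (Rmin_l _ _))).
  specialize (E2 w (Rlt_le_trans _ _ _ Hw (Rmin_r _ _))).
  replace (f w * g w - f z * g z)%C with ((f w - f z) * g w + f z * (g w - g z))%C by ring.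
  rewrite E1, E2. ring.
Qed.

Lemma continuous_in_neq_0 f z :
  continuous_in (fun _ => True) f z -> f z <> 0%C ->
  exists d, 0 < d /\ forall w, Cmod (w - z) < d -> f w <> 0%C.
Proof.
  intros Hf Hz. destruct (Hf (Cmod (f z)) (proj1 (Cmod_gt_0 _) Hz)) as [d [Hd H]].
  exists d; split; auto. intros w Hw E. specialize (H w I Hw). rewrite E in H.
  rewrite Cmod_sub_sym in H. replace (f z - 0)%C with (f z) in H by ring. lra.
Qed.

Lemma C_differentiable_inv f z :
  C_differentiable f z -> f z <> 0%C ->
  C_differentiable (fun w => / f w)%C z.
Proof.
  intros Df Hz. pose proof (C_differentiable_continuous_in _ _ Df) as Cf. revert Df.
  destruct (continuous_in_neq_0 _ _ Cf Hz) as [d0 [Hd0 N]].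
  rewrite !C_differentiable_slope.
  intros [p [Hp [d1 [Hd1 E1]]]].
  exists (fun w => - / f z * (p w * / f w))%C. split.
  - apply continuous_in_mult; [apply continuous_in_const|].
    apply continuous_in_mult; auto.
    intros e He. destruct (continuous_in_inv _ _ _ Cf Hz e He) as [d [Hd H]].
    exists (Rmin d d0); split; [apply Rmin_pos; auto|]. intros w _ Hw.
    apply H; [split; auto; apply N|];
      eapply Rlt_le_trans; try exact Hw; [apply Rmin_r|apply Rmin_l].
  - exists (Rmin d0 d1); split; [apply Rmin_pos; auto|]. intros w Hw.
    specialize (E1 w (Rlt_le_trans _ _ _ Hw (Rmin_r _ _))).
    specialize (N w (Rlt_le_trans _ _ _ Hw (Rmin_l _ _))).
    replace (/ f w - / f z)%C with (- / f z * ((f w - f z) * / f w))%C by (field; auto).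
    rewrite E1. ring.
Qed.

Lemma disc_algebra_iff f : disc_algebra f <->
  (forall z, in_cD z -> continuous_in in_cD f z) /\
  (forall z, in_D z -> C_differentiable f z).
Proof.
  unfold disc_algebra. split; intros [H1 H2]; split; auto; intros z Hz;
    apply filterlim_within_locally_C; auto.
Qed.

Lemma disc_algebra_const c : disc_algebra (fun _ => c).
Proof.
  apply disc_algebra_iff; split; intros; [apply continuous_in_const|apply C_differentiable_const].
Qed.

Lemma disc_algebra_id : disc_algebra (fun z => z).
Proof.
  apply disc_algebra_iff; split; intros; [apply continuous_in_id|apply C_differentiable_id].
Qed.

Lemma disc_algebra_plus f g :
  disc_algebra f -> disc_algebra g -> disc_algebra (fun z => f z + g z)%C.
Proof.
  rewrite !disc_algebra_iff. intros [F1 F2] [G1 G2]. split; intros.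
  apply continuous_in_plus; auto. apply C_differentiable_plus; auto.
Qed.

Lemma disc_algebra_mult f g :
  disc_algebra f -> disc_algebra g -> disc_algebra (fun z => f z * g z)%C.
Proof.
  rewrite !disc_algebra_iff. intros [F1 F2] [G1 G2]. split; intros.
  apply continuous_in_mult; auto. apply C_differentiable_mult; auto.
Qed.

Lemma in_D_cD z : in_D z -> in_cD z.
Proof. unfold in_D, in_cD; lra. Qed.

Lemma disc_algebra_inv f :
  disc_algebra f -> (forall z, in_cD z -> f z <> 0%C) -> disc_algebra (fun z => / f z)%C.
Proof.
  rewrite !disc_algebra_iff. intros [F1 F2] N. split; intros z Hz.
  - intros e He. destruct (continuous_in_inv _ _ _ (F1 z Hz) (N z Hz) e He) as [d [Hd H]].
    exists d; split; auto.
  - apply C_differentiable_inv; auto. apply N, in_D_cD; auto.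
Qed.

Lemma disc_algebra_ext f g :
  (forall z, f z = g z) -> disc_algebra f -> disc_algebra g.
Proof.
  intros E. rewrite !disc_algebra_iff. intros [F1 F2]. split; intros z Hz.
  - intros e He. destruct (F1 z Hz e He) as [d [Hd H]]. exists d; split; auto.
    intros; rewrite <- !E; auto.
  - specialize (F2 z Hz). rewrite C_differentiable_iff in *. destruct F2 as [l H].
    exists l. intros e He. destruct (H e He) as [d [Hd H']]. exists d; split; auto.
    intros; rewrite <- !E; auto.
Qed.

Lemma disc_algebra_opp f : disc_algebra f -> disc_algebra (fun z => - f z)%C.
Proof.
  intro H. apply disc_algebra_ext with (fun z => (RtoC (-1)) * f z)%C.
  intro z. replace (RtoC (-1)) with (- RtoC 1)%C by (rewrite <- RtoC_opp; f_equal; ring). ring.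
  apply disc_algebra_mult; auto. apply disc_algebra_const.
Qed.

Lemma disc_algebra_minus f g :
  disc_algebra f -> disc_algebra g -> disc_algebra (fun z => f z - g z)%C.
Proof. intros Hf Hg. apply disc_algebra_plus; auto. apply disc_algebra_opp; auto. Qed.

Lemma Cmod_Cconj_sub a b : Cmod (Cconj a - Cconj b) = Cmod (a - b).
Proof.
  rewrite <- (Cmod_conj (a - b)). f_equal.
  unfold Cconj, Cminus, Cplus, Copp; simpl. f_equal; ring.
Qed.

Lemma Cconj_plus a b : Cconj (a + b) = (Cconj a + Cconj b)%C.
Proof. unfold Cconj, Cplus; simpl; f_equal; ring. Qed.

Lemma Cconj_mult a b : Cconj (a * b) = (Cconj a * Cconj b)%C.
Proof. unfold Cconj, Cmult; simpl; f_equal; ring. Qed.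

Lemma Cconj_opp a : Cconj (- a) = (- Cconj a)%C.
Proof. unfold Cconj, Copp; simpl; f_equal; ring. Qed.

Lemma Cconj_minus a b : Cconj (a - b) = (Cconj a - Cconj b)%C.
Proof. unfold Cminus. rewrite Cconj_plus, Cconj_opp. reflexivity. Qed.

Lemma Cconj_RtoC r : Cconj (RtoC r) = RtoC r.
Proof. unfold Cconj, RtoC; simpl; f_equal; ring. Qed.

Lemma in_cD_conj z : in_cD z -> in_cD (Cconj z).
Proof. unfold in_cD. rewrite Cmod_conj. auto. Qed.

Lemma disc_algebra_conj f :
  disc_algebra f -> disc_algebra (fun z => Cconj (f (Cconj z))).
Proof.
  rewrite !disc_algebra_iff. intros [F1 F2]. split; intros z Hz.
  - intros e He. destruct (F1 _ (in_cD_conj _ Hz) e He) as [d [Hd H]].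
    exists d; split; auto. intros w Sw Hw. rewrite Cmod_Cconj_sub.
    apply H. apply in_cD_conj; auto. rewrite Cmod_Cconj_sub; auto.
  - assert (Hz' : in_D (Cconj z)) by (unfold in_D; rewrite Cmod_conj; auto).
    specialize (F2 _ Hz'). rewrite C_differentiable_iff in *. destruct F2 as [l H].
    exists (Cconj l). intros e He. destruct (H e He) as [d [Hd H']].
    exists d; split; auto. intros w Hw.
    specialize (H' (Cconj w)). rewrite Cmod_Cconj_sub in H'. specialize (H' Hw).
    replace (Cconj (f (Cconj w)) - Cconj (f (Cconj z)) - Cconj l * (w - z))%C
      with (Cconj (f (Cconj w) - f (Cconj z) - l * (Cconj w - Cconj z))).
    + rewrite Cmod_conj. exact H'.
    + rewrite !Cconj_minus, Cconj_mult, Cconj_minus, !Cconj_conj. reflexivity.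
Qed.

(** * Compactness of the closed disc *)

Lemma Cmod_le_Rabs (z : C) : Cmod z <= Rabs (Re z) + Rabs (Im z).
Proof.
  replace z with (RtoC (Re z) + Ci * RtoC (Im z))%C at 1.
  - eapply Rle_trans; [apply Cmod_triangle|].
    rewrite Cmod_mult, !Cmod_R, Cmod_Ci. lra.
  - destruct z; unfold Cplus, Cmult, RtoC, Ci; simpl; f_equal; ring.
Qed.

Lemma im_le_Cmod (z : C) : Rabs (Im z) <= Cmod z.
Proof. eapply Rle_trans; [apply Rmax_r | apply Rmax_Cmod]. Qed.

(** Compactness in the form of a uniform positive constant. Later [d] is a modulus of uniform
    continuity, the inverse of a bound, or a gap below a supremum; a smaller [d] always weakens
    [P]. *)
Lemma compact_disc (M : R) (P : C -> R -> Prop) :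
  (forall z d d', 0 < d' <= d -> P z d -> P z d') ->
  (forall u, exists d, 0 < d /\ forall z, Cmod (z - u) < d -> P z d) ->
  exists d, 0 < d /\ forall z, Cmod z <= M -> P z d.
Proof.
  intros Mono Loc.
  assert (Loc' : forall u, {d : posreal | forall z, Cmod (z - u) < d -> P z d}).
  { intro u. apply constructive_indefinite_description.
    destruct (Loc u) as [d [Hd H]]. exists (mkposreal d Hd). exact H. }
  (* Two coordinates, each within half the radius, give a point within the radius, since [Cmod] is
     at most the sum of the absolute values of the coordinates. *)
  set (g := fun x y : R => pos_div_2 (proj1_sig (Loc' (x, y)))).
  destruct (compactness_value_2d (- M) M (- M) M g) as [d Hd].
  exists d; split; [apply cond_pos|]. intros z Hz.
  apply NNPP. intro N.
  apply (Hd (Re z) (Im z)).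
  - pose proof (re_le_Cmod z). apply Rabs_le_between. lra.
  - pose proof (im_le_Cmod z). apply Rabs_le_between. lra.
  - intros [u [v [_ [_ [H1 [H2 H3]]]]]]. apply N.
    unfold g in *. destruct (Loc' (u, v)) as [e He]. simpl in *.
    pose proof (cond_pos d).
    apply Mono with e; [lra|]. apply He.
    eapply Rle_lt_trans; [apply Cmod_le_Rabs|].
    destruct z as [x y]; unfold Re, Im, Cminus, Cplus, Copp in *; simpl in *.
    unfold Rminus in *; lra.
Qed.

Lemma outside_cD u : ~ in_cD u -> exists d, 0 < d /\ forall z, Cmod (z - u) < d -> ~ in_cD z.
Proof.
  unfold in_cD. intro H. exists (Cmod u - 1). split; [lra|]. intros z Hz.
  pose proof (Cmod_sub_le u z). rewrite Cmod_sub_sym in H0. lra.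
Qed.

Lemma disc_algebra_bounded f :
  disc_algebra f -> exists M, 0 < M /\ forall z, in_cD z -> Cmod (f z) <= M.
Proof.
  rewrite disc_algebra_iff. intros [F _].
  destruct (compact_disc 1 (fun z d => in_cD z -> Cmod (f z) <= / d)) as [d [Hd H]].
  - intros z d d' [H1 H2] H Hz. eapply Rle_trans; [apply H; auto|].
    apply Rinv_le_contravar; auto.
  - intro u. destruct (classic (in_cD u)) as [Hu|Hu].
    + destruct (F u Hu 1 ltac:(lra)) as [d [Hd H]].
      pose proof (Cmod_ge_0 (f u)).
      assert (0 < / (Cmod (f u) + 1)) by (apply Rinv_0_lt_compat; lra).
      exists (Rmin d (/ (Cmod (f u) + 1))). split; [apply Rmin_pos; auto|].
      intros z Hz Sz.
      specialize (H z Sz (Rlt_le_trans _ _ _ Hz (Rmin_l _ _))).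
      pose proof (Cmod_sub_le (f z) (f u)).
      apply Rle_trans with (Cmod (f u) + 1); [lra|].
      rewrite <- (Rinv_inv (Cmod (f u) + 1)) at 1.
      apply Rinv_le_contravar; [apply Rmin_pos; auto|apply Rmin_r].
    + destruct (outside_cD u Hu) as [d [Hd H]]. exists d; split; auto.
      intros z Hz Sz. exfalso; apply (H z Hz Sz).
  - exists (/ d). split; [apply Rinv_0_lt_compat; auto|]. intros z Hz; apply H; auto.
Qed.

Lemma disc_algebra_uniform f eps : disc_algebra f -> 0 < eps ->
  exists d, 0 < d /\ forall z w, in_cD z -> in_cD w -> Cmod (w - z) < d ->
    Cmod (f w - f z) < eps.
Proof.
  rewrite disc_algebra_iff. intros [F _] He.
  destruct (compact_disc 1 (fun z d => in_cD z -> forall w, in_cD w -> Cmod (w - z) < d ->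
    Cmod (f w - f z) < eps)) as [d [Hd H]].
  - intros z d d' [H1 H2] H Hz w Hw Hd. apply H; auto. lra.
  - intro u. destruct (classic (in_cD u)) as [Hu|Hu].
    + destruct (F u Hu (eps / 2) ltac:(lra)) as [d [Hd H]].
      exists (d / 2); split; [lra|]. intros z Hz Sz w Sw Hw.
      assert (A := H z Sz ltac:(lra)).
      assert (B := Cmod_triangle (w - z) (z - u)).
      replace (w - z + (z - u))%C with (w - u)%C in B by ring.
      assert (D := H w Sw ltac:(lra)).
      assert (B' := Cmod_triangle (f w - f u) (f u - f z)).
      replace (f w - f u + (f u - f z))%C with (f w - f z)%C in B' by ring.
      rewrite (Cmod_sub_sym (f u)) in B'. lra.
    + destruct (outside_cD u Hu) as [d [Hd H]]. exists d; split; auto.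
      intros z Hz Sz. exfalso; apply (H z Hz Sz).
  - exists d. split; auto.
Qed.

Lemma disc_algebra_pow f n : disc_algebra f -> disc_algebra (fun z => f z ^ n)%C.
Proof.
  intro H. induction n; simpl. apply disc_algebra_const. apply disc_algebra_mult; auto.
Qed.

(** * Operations on the real disc algebra *)

Lemma real_disc_algebra_const (r : R) : real_disc_algebra (fun _ => RtoC r).
Proof. split; [apply disc_algebra_const|]. intros; rewrite Cconj_RtoC; auto. Qed.

Lemma real_disc_algebra_id : real_disc_algebra (fun z => z).
Proof. split; [apply disc_algebra_id|]. intros; rewrite Cconj_conj; auto. Qed.

Lemma real_disc_algebra_plus f g :
  real_disc_algebra f -> real_disc_algebra g -> real_disc_algebra (fun z => f z + g z)%C.
Proof.
  intros [F1 F2] [G1 G2]. split; [apply disc_algebra_plus; auto|].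
  intros z Hz. rewrite Cconj_plus, <- F2, <- G2; auto.
Qed.

Lemma real_disc_algebra_mult f g :
  real_disc_algebra f -> real_disc_algebra g -> real_disc_algebra (fun z => f z * g z)%C.
Proof.
  intros [F1 F2] [G1 G2]. split; [apply disc_algebra_mult; auto|].
  intros z Hz. rewrite Cconj_mult, <- F2, <- G2; auto.
Qed.

Lemma real_disc_algebra_opp f :
  real_disc_algebra f -> real_disc_algebra (fun z => - f z)%C.
Proof.
  intros [F1 F2]. split; [apply disc_algebra_opp; auto|].
  intros z Hz. rewrite Cconj_opp, <- F2; auto.
Qed.

Lemma real_disc_algebra_minus f g :
  real_disc_algebra f -> real_disc_algebra g -> real_disc_algebra (fun z => f z - g z)%C.
Proof.
  intros F G. apply real_disc_algebra_plus; auto. apply real_disc_algebra_opp; auto.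
Qed.

Lemma real_disc_algebra_inv f :
  real_disc_algebra f -> (forall z, in_cD z -> f z <> 0%C) ->
  real_disc_algebra (fun z => / f z)%C.
Proof.
  intros [F1 F2] N. split; [apply disc_algebra_inv; auto|].
  intros z Hz. rewrite Cinv_conj by (apply N, in_cD_conj; auto).
  rewrite <- F2; auto.
Qed.

(** This projection onto the real algebra is linear over the real-symmetric functions, so that
    identities with real-symmetric coefficients descend from the complex algebra. *)
Lemma real_disc_algebra_sym f :
  disc_algebra f -> real_disc_algebra (fun z => RtoC (/ 2) * (f z + Cconj (f (Cconj z))))%C.
Proof.
  intro F. split.
  - apply disc_algebra_mult; [apply disc_algebra_const|]. apply disc_algebra_plus; auto.
    apply disc_algebra_conj; auto.
  - intros z Hz. rewrite Cconj_mult, Cconj_plus, !Cconj_conj, Cconj_RtoC. ring.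
Qed.

(** * Goursat's theorem *)

Lemma continuity_2d_pt_section_l (f : R -> R -> R) x y :
  continuity_2d_pt f x y -> continuous (fun u => f u y) x.
Proof.
  intros H. apply filterlim_locally. intros eps. destruct (H eps) as [d Hd].
  exists d. intros u Hu. apply Hd. exact Hu. rewrite Rminus_diag. rewrite Rabs_R0. apply cond_pos.
Qed.

Lemma continuity_2d_pt_section_r (f : R -> R -> R) x y :
  continuity_2d_pt f x y -> continuous (fun v => f x v) y.
Proof.
  intros H. apply filterlim_locally. intros eps. destruct (H eps) as [d Hd].
  exists d. intros u Hu. apply Hd; [|exact Hu]. rewrite Rminus_diag. rewrite Rabs_R0. apply cond_pos.
Qed.

(** The integral of the form [P dx + Q dy] along the boundary, taken counterclockwise. *)
Definition rect_integral (P Q : R -> R -> R) (a b c d : R) : R :=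
  RInt (fun x => P x c) a b - RInt (fun x => P x d) a b
  + RInt (fun y => Q b y) c d - RInt (fun y => Q a y) c d.

Definition continuous_on_rect (P : R -> R -> R) (a b c d : R) : Prop :=
  forall x y, a <= x <= b -> c <= y <= d -> continuity_2d_pt P x y.

Lemma ex_RInt_section_l P a b c d x0 x1 y :
  continuous_on_rect P a b c d -> a <= x0 <= x1 -> x1 <= b -> c <= y <= d ->
  ex_RInt (fun x => P x y) x0 x1.
Proof.
  intros H H1 H2 H3. apply (@ex_RInt_continuous R_CompleteNormedModule).
  rewrite Rmin_left, Rmax_right by lra.
  intros x Hx. apply continuity_2d_pt_section_l, H; lra.
Qed.

Lemma ex_RInt_section_r P a b c d y0 y1 x :
  continuous_on_rect P a b c d -> c <= y0 <= y1 -> y1 <= d -> a <= x <= b ->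
  ex_RInt (fun y => P x y) y0 y1.
Proof.
  intros H H1 H2 H3. apply (@ex_RInt_continuous R_CompleteNormedModule).
  rewrite Rmin_left, Rmax_right by lra.
  intros y Hy. apply continuity_2d_pt_section_r, H; lra.
Qed.

Lemma RInt_Chasles_R (f : R -> R) a b c :
  ex_RInt f a b -> ex_RInt f b c -> RInt f a c = RInt f a b + RInt f b c.
Proof. intros. symmetry. apply (RInt_Chasles (V := R_CompleteNormedModule) f a b c); auto. Qed.

Lemma rect_integral_quarters P Q a b c d x y :
  continuous_on_rect P a b c d -> continuous_on_rect Q a b c d ->
  a <= x <= b -> c <= y <= d ->
  rect_integral P Q a b c d =
    rect_integral P Q a x c y + rect_integral P Q x b c y +
    rect_integral P Q a x y d + rect_integral P Q x b y d.
Proof.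
  intros HP HQ Hx Hy. unfold rect_integral.
  rewrite (RInt_Chasles_R (fun t => P t c) a x b)
    by (eapply ex_RInt_section_l; eauto; lra).
  rewrite (RInt_Chasles_R (fun t => P t d) a x b)
    by (eapply ex_RInt_section_l; eauto; lra).
  rewrite (RInt_Chasles_R (fun t => Q b t) c y d)
    by (eapply ex_RInt_section_r; eauto; lra).
  rewrite (RInt_Chasles_R (fun t => Q a t) c y d)
    by (eapply ex_RInt_section_r; eauto; lra).
  ring.
Qed.

Lemma RInt_near_const (f g : R -> R) a b k e :
  a <= b -> ex_RInt f a b -> ex_RInt g a b ->
  (forall t, a <= t <= b -> Rabs (f t - g t - k) <= e) ->
  Rabs (RInt f a b - RInt g a b - (b - a) * k) <= (b - a) * e.
Proof.
  intros Hab Hf Hg H.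
  assert (Hm : ex_RInt (fun t => minus (f t) (g t)) a b)
    by (apply (@ex_RInt_minus R_NormedModule); auto).
  assert (Hc : ex_RInt (fun _ => k) a b) by apply (@ex_RInt_const R_NormedModule).
  assert (E : RInt (fun t => minus (minus (f t) (g t)) k) a b
     = RInt f a b - RInt g a b - (b - a) * k).
  { rewrite (RInt_minus (V := R_CompleteNormedModule)) by auto.
    rewrite (RInt_minus (V := R_CompleteNormedModule)) by auto.
    rewrite RInt_const. reflexivity. }
  rewrite <- E. apply abs_RInt_le_const; auto.
  apply (@ex_RInt_minus R_NormedModule); auto.
Qed.

(** Opposite sides are compared pointwise. The linear parts contribute [(b - a) be (c - d)] and
    [(d - c) be (b - a)], which cancel because the two cross derivatives are the same [be]. Only the
    error terms remain, quadratic in the size of the rectangle. *)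
Lemma rect_integral_small P Q a b c d x y al be ka r eps :
  continuous_on_rect P a b c d -> continuous_on_rect Q a b c d ->
  a <= x <= b -> c <= y <= d -> b - a + (d - c) < r ->
  (forall u v, Rabs (u - x) < r -> Rabs (v - y) < r ->
     Rabs (P u v - P x y - (al * (u - x) + be * (v - y)))
       <= eps * Rmax (Rabs (u - x)) (Rabs (v - y))) ->
  (forall u v, Rabs (u - x) < r -> Rabs (v - y) < r ->
     Rabs (Q u v - Q x y - (be * (u - x) + ka * (v - y)))
       <= eps * Rmax (Rabs (u - x)) (Rabs (v - y))) ->
  0 < eps ->
  Rabs (rect_integral P Q a b c d) <= 2 * eps * (b - a + (d - c)) ^ 2.
Proof.
  intros CP CQ Hx Hy Hr DP DQ He.
  set (l := b - a + (d - c)) in *.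
  assert (Bd : forall u v, a <= u <= b -> c <= v <= d ->
    Rabs (u - x) < r /\ Rabs (v - y) < r /\
    eps * Rmax (Rabs (u - x)) (Rabs (v - y)) <= eps * l).
  { intros u v Hu Hv.
    assert (Rabs (u - x) <= b - a) by (apply Rabs_le; lra).
    assert (Rabs (v - y) <= d - c) by (apply Rabs_le; lra).
    unfold l in *. repeat split; try lra.
    apply Rmult_le_compat_l; [lra|]. apply Rmax_lub; lra. }
  assert (H1 : Rabs (RInt (fun t => P t c) a b - RInt (fun t => P t d) a b
     - (b - a) * (be * (c - d))) <= (b - a) * (2 * (eps * l))).
  { apply RInt_near_const; [lra| | |].
    eapply ex_RInt_section_l; eauto; lra. eapply ex_RInt_section_l; eauto; lra.
    intros t Ht.
    destruct (Bd t c) as [B1 [B2 B3]]; try lra.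
    destruct (Bd t d) as [B4 [B5 B6]]; try lra.
    specialize (DP t c B1 B2) as D1. specialize (DP t d B4 B5) as D2.
    apply Rabs_le. apply Rabs_le_between in D1. apply Rabs_le_between in D2. lra. }
  assert (H2 : Rabs (RInt (fun t => Q b t) c d - RInt (fun t => Q a t) c d
     - (d - c) * (be * (b - a))) <= (d - c) * (2 * (eps * l))).
  { apply RInt_near_const; [lra| | |].
    eapply ex_RInt_section_r; eauto; lra. eapply ex_RInt_section_r; eauto; lra.
    intros t Ht.
    destruct (Bd b t) as [B1 [B2 B3]]; try lra.
    destruct (Bd a t) as [B4 [B5 B6]]; try lra.
    specialize (DQ b t B1 B2) as D1. specialize (DQ a t B4 B5) as D2.
    apply Rabs_le. apply Rabs_le_between in D1. apply Rabs_le_between in D2. lra. }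
  unfold rect_integral.
  apply Rabs_le. apply Rabs_le_between in H1. apply Rabs_le_between in H2.
  assert (E : 2 * eps * l ^ 2 = (b - a) * (2 * (eps * l)) + (d - c) * (2 * (eps * l)))
    by (unfold l; ring).
  rewrite E. nra.
Qed.

Section Bisection.
Variables (F : R -> R -> R -> R -> R) (a0 c0 w h theta : R).

(** Passes to a quarter on which [F] keeps at least a quarter of its size. The fourth quarter is the
    default, taken without a test. *)
Let corner_step (n : nat) (p : R * R) : R * R :=
  let w' := w / 2 ^ S n in let h' := h / 2 ^ S n in
  let ok a c := Rle_dec (theta / 4 ^ S n) (Rabs (F a (a + w') c (c + h'))) in
  let (a, c) := p in
  if ok a c then (a, c) else if ok (a + w') c then (a + w', c)
  else if ok a (c + h') then (a, c + h') else (a + w', c + h').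

Fixpoint corner (n : nat) : R * R :=
  match n with O => (a0, c0) | S m => corner_step m (corner m) end.

Hypothesis w_pos : 0 <= w.
Hypothesis h_pos : 0 <= h.

Hypothesis F_split : forall a c w' h', 0 <= w' -> 0 <= h' ->
  a0 <= a -> a + 2 * w' <= a0 + w -> c0 <= c -> c + 2 * h' <= c0 + h ->
  F a (a + 2 * w') c (c + 2 * h') =
    F a (a + w') c (c + h') + F (a + w') (a + w' + w') c (c + h') +
    F a (a + w') (c + h') (c + h' + h') + F (a + w') (a + w' + w') (c + h') (c + h' + h').

Hypothesis F_start : theta <= Rabs (F a0 (a0 + w) c0 (c0 + h)).

Lemma half_pow (t : R) n : t / 2 ^ n = 2 * (t / 2 ^ S n).
Proof. simpl. field. apply pow_nonzero; lra. Qed.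

Lemma corner_inv n :
  let a := fst (corner n) in let c := snd (corner n) in
  a0 <= a /\ a + w / 2 ^ n <= a0 + w /\ c0 <= c /\ c + h / 2 ^ n <= c0 + h /\
  theta / 4 ^ n <= Rabs (F a (a + w / 2 ^ n) c (c + h / 2 ^ n)).
Proof.
  induction n.
  - simpl. unfold Rdiv. rewrite Rinv_1, !Rmult_1_r. repeat split; try lra; auto.
  - simpl corner. destruct (corner n) as [a c]. simpl in IHn.
    destruct IHn as [A1 [A2 [C1 [C2 T]]]].
    rewrite (half_pow w n), (half_pow h n) in *.
    assert (P2 : 0 < 2 ^ S n) by (apply pow_lt; lra).
    assert (W' : 0 <= w / 2 ^ S n) by (apply Rdiv_le_0_compat; auto).
    assert (H' : 0 <= h / 2 ^ S n) by (apply Rdiv_le_0_compat; auto).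
    assert (T4 : theta / 4 ^ n = 4 * (theta / 4 ^ S n))
      by (simpl; field; apply pow_nonzero; lra).
    rewrite T4 in T. clear T4.
    rewrite F_split in T by lra.
    unfold corner_step.
    set (w' := w / 2 ^ S n) in *. set (h' := h / 2 ^ S n) in *.
    set (t := theta / 4 ^ S n) in *.
    destruct (Rle_dec t (Rabs (F a (a + w') c (c + h')))) as [|N1];
      [simpl; repeat split; lra|].
    destruct (Rle_dec t (Rabs (F (a + w') (a + w' + w') c (c + h')))) as [|N2];
      [simpl; repeat split; lra|].
    destruct (Rle_dec t (Rabs (F a (a + w') (c + h') (c + h' + h')))) as [|N3];
      [simpl; repeat split; lra|].
    simpl; repeat split; try lra.
    (* The default quarter: the four values add up to at least [4 t] in absolute value and three of
       them are below [t], so the last is at least [t]. *)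
    apply Rnot_le_lt in N1, N2, N3.
    pose proof (Rabs_triang (F a (a + w') c (c + h') + F (a + w') (a + w' + w') c (c + h')
      + F a (a + w') (c + h') (c + h' + h')) (F (a + w') (a + w' + w') (c + h') (c + h' + h'))).
    pose proof (Rabs_triang (F a (a + w') c (c + h') + F (a + w') (a + w' + w') c (c + h'))
      (F a (a + w') (c + h') (c + h' + h'))).
    pose proof (Rabs_triang (F a (a + w') c (c + h')) (F (a + w') (a + w' + w') c (c + h'))).
    lra.
Qed.

Lemma corner_nested n :
  fst (corner n) <= fst (corner (S n)) /\
  fst (corner (S n)) + w / 2 ^ S n <= fst (corner n) + w / 2 ^ n /\
  snd (corner n) <= snd (corner (S n)) /\
  snd (corner (S n)) + h / 2 ^ S n <= snd (corner n) + h / 2 ^ n.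
Proof.
  rewrite (half_pow w n), (half_pow h n).
  assert (P2 : 0 < 2 ^ S n) by (apply pow_lt; lra).
  assert (W' : 0 <= w / 2 ^ S n) by (apply Rdiv_le_0_compat; auto).
  assert (H' : 0 <= h / 2 ^ S n) by (apply Rdiv_le_0_compat; auto).
  change (corner (S n)) with (corner_step n (corner n)).
  unfold corner_step. destruct (corner n) as [a c].
  set (w' := w / 2 ^ S n) in *. set (h' := h / 2 ^ S n) in *.
  repeat destruct Rle_dec; unfold fst, snd; lra.
Qed.
End Bisection.

Lemma nested_intervals (a l : nat -> R) :
  (forall n, 0 <= l n) -> (forall n, a n <= a (S n)) ->
  (forall n, a (S n) + l (S n) <= a n + l n) ->
  exists x, forall n, a n <= x <= a n + l n.
Proof.
  intros L A B.
  assert (A' : forall n k, a n <= a (n + k)%nat).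
  { intros n k. induction k; [rewrite Nat.add_0_r; lra|].
    rewrite Nat.add_succ_r. specialize (A (n + k)%nat). lra. }
  assert (B' : forall n k, a (n + k)%nat + l (n + k)%nat <= a n + l n).
  { intros n k. induction k; [rewrite Nat.add_0_r; lra|].
    rewrite Nat.add_succ_r. specialize (B (n + k)%nat). lra. }
  assert (AB : forall m n, a m <= a n + l n).
  { intros m n. destruct (Nat.le_ge_cases m n).
    - replace n with (m + (n - m))%nat by lia. specialize (A' m (n - m)%nat).
      specialize (L (m + (n - m))%nat). lra.
    - replace m with (n + (m - n))%nat by lia. specialize (B' n (m - n)%nat).
      specialize (L (n + (m - n))%nat). lra. }
  destruct (completeness (fun y => exists n, y = a n)) as [x [Hx1 Hx2]].
  - exists (a 0%nat + l 0%nat). intros y [n ->]. auto.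
  - exists (a 0%nat), 0%nat. auto.
  - exists x. intro n. split.
    + apply Hx1. exists n. auto.
    + apply Hx2. intros y [m ->]. auto.
Qed.

(* Goursat's argument for the closed 1-form [P dx + Q dy]: no continuity of the derivatives. *)
Lemma rect_integral_closed_form P Q a b c d :
  a <= b -> c <= d ->
  (forall x y, a <= x <= b -> c <= y <= d -> exists al be ka,
     differentiable_pt_lim P x y al be /\ differentiable_pt_lim Q x y be ka) ->
  rect_integral P Q a b c d = 0.
Proof.
  intros Hab Hcd D.
  assert (CP : continuous_on_rect P a b c d).
  { intros x y Hx Hy. destruct (D x y Hx Hy) as [al [be [ka [D1 D2]]]].
    apply (differentiable_continuity_pt P x y).
    exists al, be. exact D1. }
  assert (CQ : continuous_on_rect Q a b c d).
  { intros x y Hx Hy. destruct (D x y Hx Hy) as [al [be [ka [D1 D2]]]].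
    apply (differentiable_continuity_pt Q x y).
    exists be, ka. exact D2. }
  apply NNPP. intro N.
  set (F := rect_integral P Q).
  set (theta := Rabs (F a b c d)).
  assert (Ht : 0 < theta) by (apply Rabs_pos_lt; exact N).
  set (w := b - a). set (h := d - c).
  assert (Hw : 0 <= w) by (unfold w; lra). assert (Hh : 0 <= h) by (unfold h; lra).
  assert (Fs : forall x y w' h', 0 <= w' -> 0 <= h' ->
    a <= x -> x + 2 * w' <= a + w -> c <= y -> y + 2 * h' <= c + h ->
    F x (x + 2 * w') y (y + 2 * h') =
    F x (x + w') y (y + h') + F (x + w') (x + w' + w') y (y + h') +
    F x (x + w') (y + h') (y + h' + h') + F (x + w') (x + w' + w') (y + h') (y + h' + h')).
  { intros x y w' h' H1 H2 H3 H4 H5 H6. unfold F, w, h in *.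
    rewrite (rect_integral_quarters _ _ _ _ _ _ (x + w') (y + h')); try lra.
    - replace (x + 2 * w') with (x + w' + w') by ring.
      replace (y + 2 * h') with (y + h' + h') by ring. reflexivity.
    - intros u v Hu Hv. apply CP; lra.
    - intros u v Hu Hv. apply CQ; lra. }
  assert (F0 : theta <= Rabs (F a (a + w) c (c + h))).
  { unfold theta, w, h. right. repeat f_equal; ring. }
  pose proof (corner_inv F a c w h theta Hw Hh Fs F0) as Inv.
  pose proof (corner_nested F a c w h theta Hw Hh) as Nest.
  set (cr := corner F a c w h theta) in *.
  assert (Pw : forall t n, 0 <= t -> 0 <= t / 2 ^ n).
  { intros t n ?. apply Rdiv_le_0_compat; auto. apply pow_lt; lra. }
  destruct (nested_intervals (fun n => fst (cr n)) (fun n => w / 2 ^ n)) as [x Hx];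
    try (intro n; try apply Pw; auto; apply Nest).
  destruct (nested_intervals (fun n => snd (cr n)) (fun n => h / 2 ^ n)) as [y Hy];
    try (intro n; try apply Pw; auto; apply Nest).
  assert (Hxy : a <= x <= b /\ c <= y <= d).
  { specialize (Hx 0%nat). specialize (Hy 0%nat). simpl in Hx, Hy.
    unfold w, h, Rdiv in *. rewrite Rinv_1, !Rmult_1_r in *. lra. }
  destruct (D x y (proj1 Hxy) (proj2 Hxy)) as [al [be [ka [D1 D2]]]].
  set (s := w + h).
  assert (Hs : 0 <= s) by (unfold s; lra).
  (* Chosen so that [2 eps s^2 < theta]; the [+ 1] covers [s = 0]. The lower bound for [F] and the
     error bound both scale like [4^-n], hence the contradiction at a single late [n]. *)
  set (eps := theta / (4 * (s ^ 2 + 1))).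
  assert (Hs2 : 0 < 4 * (s ^ 2 + 1)) by nra.
  assert (He : 0 < eps) by (apply Rdiv_lt_0_compat; auto).
  destruct (D1 (mkposreal _ He)) as [r1 Hr1]. destruct (D2 (mkposreal _ He)) as [r2 Hr2].
  simpl in Hr1, Hr2.
  set (r := Rmin r1 r2).
  assert (Hr : 0 < r) by (apply Rmin_pos; apply cond_pos).
  assert (Lim : exists n, s / 2 ^ n < r).
  { destruct (pow_lt_1_zero (/ 2) ltac:(rewrite Rabs_pos_eq; lra) (r / (s + 1))) as [n Hn].
    apply Rdiv_lt_0_compat; lra.
    exists n. specialize (Hn n (Nat.le_refl _)).
    rewrite Rabs_pos_eq in Hn by (apply pow_le; lra). rewrite pow_inv in Hn.
    unfold Rdiv in *.
    assert (P2 : 0 < / 2 ^ n) by (apply Rinv_0_lt_compat, pow_lt; lra).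
    apply Rle_lt_trans with ((s + 1) * / 2 ^ n); [nra|].
    apply Rlt_le_trans with ((s + 1) * (r * / (s + 1))).
    apply Rmult_lt_compat_l; lra. right. field. lra. }
  destruct Lim as [n Hn].
  specialize (Inv n). simpl in Inv. destruct Inv as [A1 [A2 [C1 [C2 T]]]].
  specialize (Hx n). specialize (Hy n).
  set (w' := w / 2 ^ n) in *. set (h' := h / 2 ^ n) in *.
  assert (P2 : 0 < 2 ^ n) by (apply pow_lt; lra).
  assert (Es : w' + h' = s / 2 ^ n) by (unfold w', h', s; field; lra).
  assert (S' : Rabs (F (fst (cr n)) (fst (cr n) + w') (snd (cr n)) (snd (cr n) + h'))
     <= 2 * eps * (w' + h') ^ 2).
  { replace (w' + h') with (fst (cr n) + w' - fst (cr n) + (snd (cr n) + h' - snd (cr n))) by ring.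
    apply rect_integral_small with x y al be ka r; auto.
    - intros u v Hu Hv. apply CP; unfold w, h in *; lra.
    - intros u v Hu Hv. apply CQ; unfold w, h in *; lra.
    - lra.
    - intros u v Hu Hv. apply Hr1; eapply Rlt_le_trans; eauto; apply Rmin_l.
    - intros u v Hu Hv. apply Hr2; eapply Rlt_le_trans; eauto; apply Rmin_r. }
  rewrite Es in S'.
  assert (E4 : 4 ^ n = 2 ^ n * 2 ^ n) by (rewrite <- Rpow_mult_distr; f_equal; ring).
  rewrite E4 in T.
  assert (E5 : 2 * eps * (s / 2 ^ n) ^ 2 = (2 * eps * s ^ 2) / (2 ^ n * 2 ^ n)) by (field; lra).
  rewrite E5 in S'.
  assert (P4 : 0 < / (2 ^ n * 2 ^ n)) by (apply Rinv_0_lt_compat; nra).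
  assert (X : theta <= 2 * eps * s ^ 2).
  { apply Rmult_le_reg_r with (/ (2 ^ n * 2 ^ n)); auto. unfold Rdiv in *. lra. }
  assert (Y : eps * (4 * (s ^ 2 + 1)) = theta) by (unfold eps; field; lra).
  nra.
Qed.

(** * Cauchy's formula and density of polynomials *)

Lemma differentiable_pt_lim_plus_2d f g x y fx fy gx gy :
  differentiable_pt_lim f x y fx fy -> differentiable_pt_lim g x y gx gy ->
  differentiable_pt_lim (fun u v => f u v + g u v) x y (fx + gx) (fy + gy).
Proof.
  intros Hf Hg.
  replace (fx + gx) with (1 * fx + 1 * gx) by ring.
  replace (fy + gy) with (1 * fy + 1 * gy) by ring.
  apply (differentiable_pt_lim_comp (fun a b => a + b)); auto.
  intros eps. exists eps. intros u v _ _.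
  match goal with |- Rabs ?t <= _ => replace t with 0 by ring end.
  rewrite Rabs_R0. apply Rmult_le_pos; [left; apply cond_pos|].
  eapply Rle_trans; [apply Rabs_pos|apply Rmax_l].
Qed.

Lemma differentiable_pt_lim_mult_2d f g x y fx fy gx gy :
  differentiable_pt_lim f x y fx fy -> differentiable_pt_lim g x y gx gy ->
  differentiable_pt_lim (fun u v => f u v * g u v) x y
    (g x y * fx + f x y * gx) (g x y * fy + f x y * gy).
Proof.
  intros Hf Hg.
  apply (differentiable_pt_lim_comp (fun a b => a * b)); auto.
  intros eps. exists eps. intros u v Hu Hv.
  match goal with |- Rabs ?t <= _ => replace t with ((u - f x y) * (v - g x y)) by ring end.
  rewrite Rabs_mult. apply Rmult_le_compat; try apply Rabs_pos. left; auto. apply Rmax_r.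
Qed.

Lemma differentiable_pt_lim_swap f x y fx fy :
  differentiable_pt_lim f x y fx fy ->
  differentiable_pt_lim (fun u v => f v u) y x fy fx.
Proof.
  intros H eps. destruct (H eps) as [d Hd]. exists d. intros u v Hu Hv.
  rewrite Rmax_comm. rewrite (Rplus_comm (fy * _)). apply Hd; auto.
Qed.

Lemma differentiable_pt_lim_snd (h : R -> R) x y l :
  derivable_pt_lim h y l -> differentiable_pt_lim (fun _ v => h v) x y 0 l.
Proof.
  intros. apply (differentiable_pt_lim_swap (fun u _ => h u)).
  apply differentiable_pt_lim_proj1_0. auto.
Qed.

Lemma Cmod_pair_le_Rmax u v : Cmod (u, v) <= 2 * Rmax (Rabs u) (Rabs v).
Proof.
  eapply Rle_trans; [apply Cmod_le_Rabs|]. simpl.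
  pose proof (Rmax_l (Rabs u) (Rabs v)). pose proof (Rmax_r (Rabs u) (Rabs v)). lra.
Qed.

(** The Cauchy-Riemann equations, [A] and [B] being the real and imaginary parts of the complex
    derivative. *)
Lemma C_differentiable_Re_Im (f : C -> C) x y :
  C_differentiable f (x, y) -> exists A B,
  differentiable_pt_lim (fun u v => Re (f (u, v))) x y A (- B) /\
  differentiable_pt_lim (fun u v => Im (f (u, v))) x y B A.
Proof.
  rewrite C_differentiable_iff. intros [[A B] H]. exists A, B.
  assert (K : forall eps : posreal, locally_2d (fun u v =>
    Cmod (f (u, v) - f (x, y) - (A, B) * ((u, v) - (x, y))) <=
    eps * Rmax (Rabs (u - x)) (Rabs (v - y))) x y).
  { intro eps. destruct (H (eps / 2)) as [d [Hd H']].
    { pose proof (cond_pos eps); lra. }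
    exists (mkposreal (d / 2) ltac:(lra)). simpl. intros u v Hu Hv.
    pose proof (Cmod_pair_le_Rmax (u - x) (v - y)) as M.
    change (u - x, v - y) with ((u, v) - (x, y))%C in M.
    eapply Rle_trans; [apply H'|].
    - eapply Rle_lt_trans; [exact M|].
      pose proof (Rmax_lub_lt _ _ _ Hu Hv). lra.
    - pose proof (cond_pos eps). nra. }
  split; intro eps; destruct (K eps) as [d Hd]; exists d; intros u v Hu Hv;
    specialize (Hd u v Hu Hv); eapply Rle_trans; try exact Hd.
  - eapply Rle_trans; [|apply re_le_Cmod]. right. f_equal. unfold Re, Im, Cminus, Cplus, Copp, Cmult; simpl. ring.
  - eapply Rle_trans; [|apply im_le_Cmod]. right. f_equal. unfold Re, Im, Cminus, Cplus, Copp, Cmult; simpl. ring.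
Qed.

(** * Integrals over circles *)

Definition cis (t : R) : C := (cos t, sin t).

Lemma Cmod_cis t : Cmod (cis t) = 1.
Proof.
  unfold Cmod, cis; simpl. replace (_ + _) with (Rsqr (sin t) + Rsqr (cos t)).
  rewrite sin2_cos2. apply sqrt_1. unfold Rsqr; ring.
Qed.

Definition circ (r t : R) : C := (r * cos t, r * sin t).

Lemma circ_cis r t : circ r t = (RtoC r * cis t)%C.
Proof. unfold circ, cis, RtoC, Cmult; simpl. f_equal; ring. Qed.

Lemma Cmod_circ r t : 0 <= r -> Cmod (circ r t) = r.
Proof. intro H. rewrite circ_cis, Cmod_mult, Cmod_cis, Cmod_R, Rabs_pos_eq; lra. Qed.

(** Integration is with respect to the angle. Since [dz = i z dt], Cauchy's theorem for [g] is a
    statement about the integrand [g z * z]. *)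
Definition circle_int (p : C -> R) (r : R) : R := RInt (fun t => p (circ r t)) 0 (2 * PI).

Section Annulus.
Variable g : C -> C.
Let a u v := Re (g (u, v)).
Let b u v := Im (g (u, v)).

(** The last two equations are Cauchy-Riemann in polar coordinates, written without division by [r]
    so that they include [r = 0]. *)
Lemma annulus_derivatives (r t : R) :
  C_differentiable g (circ r t) ->
  exists ar at' br bt,
  differentiable_pt_lim (fun r t => a (r * cos t) (r * sin t)) r t ar at' /\
  differentiable_pt_lim (fun r t => b (r * cos t) (r * sin t)) r t br bt /\
  at' = - r * br /\ bt = r * ar.
Proof.
  intro D. destruct (C_differentiable_Re_Im g _ _ D) as [A [B [Da Db]]].
  assert (X : differentiable_pt_lim (fun r t => r * cos t) r t (cos t) (- r * sin t)).
  { assert (E1 : cos t = cos t * 1 + r * 0) by ring.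
    assert (E2 : - r * sin t = cos t * 0 + r * - sin t) by ring.
    rewrite E1, E2.
    apply (differentiable_pt_lim_mult_2d (fun r _ => r) (fun _ t => cos t)).
    apply (differentiable_pt_lim_proj1_0 (fun r => r)), derivable_pt_lim_id.
    apply differentiable_pt_lim_snd, derivable_pt_lim_cos. }
  assert (Y : differentiable_pt_lim (fun r t => r * sin t) r t (sin t) (r * cos t)).
  { assert (E1 : sin t = sin t * 1 + r * 0) by ring.
    assert (E2 : r * cos t = sin t * 0 + r * cos t) by ring.
    rewrite E1, E2.
    apply (differentiable_pt_lim_mult_2d (fun r _ => r) (fun _ t => sin t)).
    apply (differentiable_pt_lim_proj1_0 (fun r => r)), derivable_pt_lim_id.
    apply differentiable_pt_lim_snd, derivable_pt_lim_sin. }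
  do 4 eexists.
  split; [apply (differentiable_pt_lim_comp a _ _ _ _ _ _ _ _ _ _ Da X Y)|].
  split; [apply (differentiable_pt_lim_comp b _ _ _ _ _ _ _ _ _ _ Db X Y)|].
  split; ring.
Qed.

(* With [W = g(r e^(it)) e^(it)], the forms [Im W dr + r Re W dt] and [- Re W dr + r Im W dt]
   are closed, down to [r = 0] included. *)
Lemma circle_int_const (p : C -> R) (r1 r2 : R) :
  (p = (fun z => Re (g z * z)) \/ p = (fun z => Im (g z * z))) ->
  0 <= r1 <= r2 ->
  (forall z, r1 <= Cmod z <= r2 -> C_differentiable g z) ->
  circle_int p r1 = circle_int p r2.
Proof.
  intros Hp Hr D.
  set (P1 := fun r t => a (r * cos t) (r * sin t) * sin t + b (r * cos t) (r * sin t) * cos t).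
  set (P2 := fun r t => a (r * cos t) (r * sin t) * cos t + - b (r * cos t) (r * sin t) * sin t).
  pose proof PI_RGT_0.
  assert (DD : forall r t, r1 <= r <= r2 -> exists p1r p1t p2r p2t,
    differentiable_pt_lim P1 r t p1r p1t /\ differentiable_pt_lim P2 r t p2r p2t /\
    p1t = P2 r t + r * p2r /\ p2t = - (P1 r t + r * p1r)).
  { intros r t Hrt.
    destruct (annulus_derivatives r t) as [ar [at' [br [bt [Da [Db [E1 E2]]]]]]].
    { apply D. rewrite Cmod_circ; lra. }
    assert (Dc : differentiable_pt_lim (fun _ t => cos t) r t 0 (- sin t))
      by apply differentiable_pt_lim_snd, derivable_pt_lim_cos.
    assert (Ds : differentiable_pt_lim (fun _ t => sin t) r t 0 (cos t))
      by apply differentiable_pt_lim_snd, derivable_pt_lim_sin.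
    assert (Dm : differentiable_pt_lim (fun _ _ => - (1)) r t 0 0)
      by apply (differentiable_pt_lim_snd (fun _ => - (1))), derivable_pt_lim_const.
    pose proof (differentiable_pt_lim_plus_2d _ _ _ _ _ _ _ _
      (differentiable_pt_lim_mult_2d _ _ _ _ _ _ _ _ Da Ds)
      (differentiable_pt_lim_mult_2d _ _ _ _ _ _ _ _ Db Dc)) as D1.
    pose proof (differentiable_pt_lim_plus_2d _ _ _ _ _ _ _ _
      (differentiable_pt_lim_mult_2d _ _ _ _ _ _ _ _ Da Dc)
      (differentiable_pt_lim_mult_2d _ _ _ _ _ _ _ _
        (differentiable_pt_lim_mult_2d _ _ _ _ _ _ _ _ Dm Db) Ds)) as D2.
    do 4 eexists. split; [exact D1|]. split.
    { eapply differentiable_pt_lim_ext; [|exact D2]. apply locally_2d_forall.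
      intros; unfold P2; ring. }
    unfold P1, P2. subst at' bt. split; ring. }
  assert (Did : forall r t, differentiable_pt_lim (fun r _ => r) r t 1 0).
  { intros. apply (differentiable_pt_lim_proj1_0 (fun r => r)), derivable_pt_lim_id. }
  assert (Dm : forall r t, differentiable_pt_lim (fun _ _ => - (1)) r t 0 0).
  { intros. apply (differentiable_pt_lim_snd (fun _ => - (1))), derivable_pt_lim_const. }
  (* The sides [t = 0] and [t = 2 PI] of the rectangle cancel by periodicity, leaving the two
     circles. *)
  assert (per : forall P : R -> R -> R, (forall r, P r 0 = P r (2 * PI)) ->
    RInt (fun x => P x 0) r1 r2 = RInt (fun x => P x (2 * PI)) r1 r2).
  { intros P HP. apply RInt_ext. intros; apply HP. }
  destruct Hp as [-> | ->]; unfold circle_int.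
  - pose proof (rect_integral_closed_form P1 (fun r t => r * P2 r t) r1 r2 0 (2 * PI)) as G.
    unfold rect_integral in G. rewrite (per P1) in G.
    + rewrite (RInt_ext _ (fun t => r1 * P2 r1 t)).
      rewrite (RInt_ext (fun t => Re (g (circ r2 t) * circ r2 t)) (fun t => r2 * P2 r2 t)).
      apply Rminus_diag_uniq_sym. etransitivity; [|apply G; try lra]; [ring|].
      intros r t H1 H2. destruct (DD r t H1) as [p1r [p1t [p2r [p2t [D1 [D2 [E1 E2]]]]]]].
      exists p1r, p1t. eexists. split; auto.
      pose proof (differentiable_pt_lim_mult_2d _ _ _ _ _ _ _ _ (Did r t) D2) as D3.
      cbv beta in D3. replace (P2 r t * 1 + r * p2r) with p1t in D3 by lra. exact D3.
      * intros t _. unfold P2, a, b, circ, Re, Im, Cmult; simpl. ring.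
      * intros t _. unfold P2, a, b, circ, Re, Im, Cmult; simpl. ring.
    + intros r. unfold P1. rewrite cos_2PI, sin_2PI, cos_0, sin_0. reflexivity.
  - pose proof (rect_integral_closed_form (fun r t => - (1) * P2 r t) (fun r t => r * P1 r t) r1 r2 0 (2 * PI)) as G.
    unfold rect_integral in G. rewrite (per (fun r t => - (1) * P2 r t)) in G.
    + rewrite (RInt_ext _ (fun t => r1 * P1 r1 t)).
      rewrite (RInt_ext (fun t => Im (g (circ r2 t) * circ r2 t)) (fun t => r2 * P1 r2 t)).
      apply Rminus_diag_uniq_sym. etransitivity; [|apply G; try lra]; [ring|].
      intros r t H1 H2. destruct (DD r t H1) as [p1r [p1t [p2r [p2t [D1 [D2 [E1 E2]]]]]]].
      pose proof (differentiable_pt_lim_mult_2d _ _ _ _ _ _ _ _ (Did r t) D1) as D3.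
      pose proof (differentiable_pt_lim_mult_2d _ _ _ _ _ _ _ _ (Dm r t) D2) as D4.
      cbv beta in D3, D4.
      do 3 eexists. split; [exact D4|].
      replace (P1 r t * 1 + r * p1r) with (P2 r t * 0 + - (1) * p2t) in D3 by lra. exact D3.
      * intros t _. unfold P1, a, b, circ, Re, Im, Cmult; simpl. ring.
      * intros t _. unfold P1, a, b, circ, Re, Im, Cmult; simpl. ring.
    + intros r. unfold P2. rewrite cos_2PI, sin_2PI, cos_0, sin_0. reflexivity.
Qed.
End Annulus.

Lemma circ_near r t (d : R) : 0 < d ->
  locally_2d (fun u v => Cmod (circ u v - circ r t) < d) r t.
Proof.
  intro Hd.
  assert (Hd4 : 0 < d / 2) by lra.
  assert (cC : continuity_2d_pt (fun _ v => cos v) r t).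
  { apply continuity_1d_2d_pt_comp. apply continuity_pt_filterlim, continuous_cos.
    apply continuity_2d_pt_id2. }
  assert (cS : continuity_2d_pt (fun _ v => sin v) r t).
  { apply continuity_1d_2d_pt_comp. apply continuity_pt_filterlim, continuous_sin.
    apply continuity_2d_pt_id2. }
  pose proof (continuity_2d_pt_mult _ _ _ _ (continuity_2d_pt_id1 r t) cC (mkposreal _ Hd4)) as H1.
  pose proof (continuity_2d_pt_mult _ _ _ _ (continuity_2d_pt_id1 r t) cS (mkposreal _ Hd4)) as H2.
  destruct H1 as [d1 H1]. destruct H2 as [d2 H2]. simpl in H1, H2.
  exists (mkposreal (Rmin d1 d2) (Rmin_stable_in_posreal d1 d2)). simpl.
  intros u v Hu Hv.
  specialize (H1 u v (Rlt_le_trans _ _ _ Hu (Rmin_l _ _)) (Rlt_le_trans _ _ _ Hv (Rmin_l _ _))).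
  specialize (H2 u v (Rlt_le_trans _ _ _ Hu (Rmin_r _ _)) (Rlt_le_trans _ _ _ Hv (Rmin_r _ _))).
  eapply Rle_lt_trans; [apply Cmod_le_Rabs|].
  unfold circ, Re, Im, Cminus, Cplus, Copp; simpl. unfold Rminus in *. lra.
Qed.

(** Only real functions are integrated; quantifying over [e] treats both parts of a complex
    integrand at once. *)
Definition Re_or_Im (e : C -> R) : Prop := e = Re \/ e = Im.

Lemma Re_or_Im_minus e a b : Re_or_Im e -> e (a - b)%C = e a - e b.
Proof. intros [-> | ->]; unfold Re, Im; simpl; ring. Qed.

Lemma Re_or_Im_le e a : Re_or_Im e -> Rabs (e a) <= Cmod a.
Proof. intros [-> | ->]; [apply re_le_Cmod|apply im_le_Cmod]. Qed.

Lemma circ_comp_continuity e F r t :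
  Re_or_Im e -> continuous_in (fun _ => True) F (circ r t) ->
  continuity_2d_pt (fun r t => e (F (circ r t))) r t.
Proof.
  intros He HF eps. destruct (HF eps (cond_pos eps)) as [d [Hd H]].
  destruct (circ_near r t d Hd) as [d' H']. exists d'. intros u v Hu Hv.
  rewrite <- Re_or_Im_minus by auto.
  eapply Rle_lt_trans; [apply Re_or_Im_le; auto|]. apply H; auto.
Qed.

(* The circle [|z| = |lam|] is crossed by continuity of the circle integrals in the radius. *)
Lemma circle_int_vanish e g lam r :
  Re_or_Im e ->
  (forall z, in_D z -> continuous_in (fun _ => True) g z) ->
  (forall z, in_D z -> z <> lam -> C_differentiable g z) ->
  Cmod lam < r < 1 ->
  circle_int (fun z => e (g z * z)%C) r = 0.
Proof.
  intros He Cg Dg Hr.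
  set (p := fun z => e (g z * z)%C).
  pose proof (Cmod_ge_0 lam) as Hl. pose proof PI_RGT_0 as Hpi.
  assert (Ch : forall r' t, 0 <= r' <= r ->
    continuity_2d_pt (fun r t => p (circ r t)) r' t).
  { intros r' t H'. apply (circ_comp_continuity e (fun z => g z * z)%C); auto.
    apply continuous_in_mult; [apply Cg; unfold in_D; rewrite Cmod_circ; lra|apply continuous_in_id]. }
  assert (Cst : forall r1 r2, 0 <= r1 <= r2 -> r2 <= r ->
     (forall z, r1 <= Cmod z <= r2 -> z <> lam) -> circle_int p r1 = circle_int p r2).
  { intros r1 r2 H1 H2 N. apply (circle_int_const g); auto.
    - destruct He as [-> | ->]; auto.
    - intros z Hz. apply Dg; [unfold in_D; lra|]. apply N; auto. }
  assert (Z : circle_int p 0 = 0).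
  { unfold circle_int. rewrite (RInt_ext _ (fun _ => 0)).
    rewrite RInt_const. apply Rmult_0_r.
    intros t _. unfold p. replace (circ 0 t) with (RtoC 0)
      by (unfold circ, RtoC; f_equal; ring).
    rewrite Cmult_0_r. destruct He as [-> | ->]; reflexivity. }
  assert (Ex : forall r', 0 <= r' <= r -> ex_RInt (fun t => p (circ r' t)) 0 (2 * PI)).
  { intros r' H'. apply (@ex_RInt_continuous R_CompleteNormedModule). intros t _.
    apply (continuity_2d_pt_section_r (fun r t => p (circ r t))), Ch; auto. }
  apply Rabs_eq_0. apply Rle_antisym; [|apply Rabs_pos]. apply le_epsilon.
  intros eps Heps. rewrite Rplus_0_l.
  assert (He' : 0 < eps / (2 * PI)) by (apply Rdiv_lt_0_compat; lra).
  destruct (uniform_continuity_2d (fun r t => p (circ r t)) 0 r 0 (2 * PI)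
    (fun x y Hx _ => Ch x y Hx) (mkposreal _ He')) as [[d Hd] U]. simpl in U.
  (* Radii just inside and just outside the circle through [lam], less than [d] apart. The integral
     over the inner one is 0, by constancy from radius 0 or because [t1] is 0; the outer one carries
     the integral over radius [r]. *)
  set (t1 := Rmax 0 (Cmod lam - d / 4)). set (t2 := Rmin r (Cmod lam + d / 4)).
  assert (T1 : 0 <= t1 <= Cmod lam).
  { unfold t1. split; [apply Rmax_l|]. apply Rmax_lub; lra. }
  assert (T1' : Cmod lam - d / 4 <= t1) by apply Rmax_r.
  assert (T2 : Cmod lam < t2 <= r).
  { unfold t2. split; [apply Rmin_glb_lt; lra|]. apply Rmin_l. }
  assert (T2' : t2 <= Cmod lam + d / 4) by apply Rmin_r.
  assert (E1 : circle_int p t1 = 0).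
  { unfold t1, Rmax in *. destruct (Rle_dec 0 (Cmod lam - d / 4)); [|exact Z].
    rewrite <- Z. symmetry. apply Cst; try lra. intros z Hz ->. lra. }
  assert (E2 : circle_int p t2 = circle_int p r).
  { apply Cst; try lra. intros z Hz ->. lra. }
  rewrite <- E2.
  replace (circle_int p t2)
    with (circle_int p t2 - circle_int p t1 - (2 * PI - 0) * 0) by (rewrite E1; ring).
  replace eps with ((2 * PI - 0) * (eps / (2 * PI))) by (field; lra).
  apply RInt_near_const; [lra|apply Ex; lra|apply Ex; lra|].
  intros t Ht. rewrite Rminus_0_r. left. apply U; try lra.
  - rewrite Rabs_pos_eq; lra.
  - rewrite Rminus_diag, Rabs_R0. auto.
Qed.

Definition on_circle (r : R) (z : C) : Prop := Cmod z = r.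

Definition circle_continuous (r : R) (F : C -> C) : Prop :=
  forall z, on_circle r z -> continuous_in (on_circle r) F z.

Definition circle_mean (r : R) (F : C -> C) : C :=
  (/ (2 * PI) * circle_int (fun z => Re (F z)) r, / (2 * PI) * circle_int (fun z => Im (F z)) r).

Section CircleMean.
Variable r : R.
Hypothesis r_pos : 0 < r.

Lemma circle_continuous_ex_RInt e F :
  Re_or_Im e -> circle_continuous r F -> ex_RInt (fun t => e (F (circ r t))) 0 (2 * PI).
Proof.
  intros He HF. apply (@ex_RInt_continuous R_CompleteNormedModule). intros t _.
  apply filterlim_locally. intros eps.
  assert (On : forall t, on_circle r (circ r t)) by (intro; apply Cmod_circ; lra).
  destruct (HF _ (On t) eps (cond_pos eps)) as [d [Hd H]].
  destruct (circ_near r t d Hd) as [d' H']. exists d'. intros v Hv.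
  change (Rabs (e (F (circ r v)) - e (F (circ r t))) < eps).
  rewrite <- Re_or_Im_minus by auto.
  eapply Rle_lt_trans; [apply Re_or_Im_le; auto|]. apply H; auto. apply H'; auto.
  rewrite Rminus_diag, Rabs_R0. apply cond_pos.
Qed.

Lemma circle_mean_ext F G :
  (forall z, on_circle r z -> F z = G z) -> circle_mean r F = circle_mean r G.
Proof.
  intro H. unfold circle_mean, circle_int.
  f_equal; f_equal; apply RInt_ext; intros t _; rewrite H; auto; apply Cmod_circ; lra.
Qed.

Lemma RInt_lin (f g : R -> R) a b x y :
  ex_RInt f a b -> ex_RInt g a b ->
  RInt (fun t => x * f t + y * g t) a b = x * RInt f a b + y * RInt g a b.
Proof.
  intros Hf Hg.
  assert (Ef : RInt (fun t => x * f t) a b = x * RInt f a b)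
    by (apply (RInt_scal (V := R_CompleteNormedModule)); auto).
  assert (Eg : RInt (fun t => y * g t) a b = y * RInt g a b)
    by (apply (RInt_scal (V := R_CompleteNormedModule)); auto).
  rewrite <- Ef, <- Eg.
  apply (RInt_plus (V := R_CompleteNormedModule) (fun t => x * f t) (fun t => y * g t));
    apply (@ex_RInt_scal R_NormedModule); auto.
Qed.

Ltac ring_R := match goal with |- @eq _ ?x ?y => change (@eq R x y) end; ring.

Lemma RInt_ext_R (f g : R -> R) a b : (forall t, f t = g t) -> RInt f a b = RInt g a b.
Proof. intro H. apply (RInt_ext (V := R_CompleteNormedModule)). intros; apply H. Qed.

Lemma circle_mean_plus F G :
  circle_continuous r F -> circle_continuous r G ->
  circle_mean r (fun z => F z + G z)%C = (circle_mean r F + circle_mean r G)%C.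
Proof.
  intros HF HG. unfold circle_mean, circle_int, Cplus; simpl.
  rewrite <- !Rmult_plus_distr_l. f_equal; f_equal.
  - rewrite (RInt_ext_R _ (fun t => 1 * Re (F (circ r t)) + 1 * Re (G (circ r t)))).
    rewrite RInt_lin; [ring_R|apply circle_continuous_ex_RInt; auto; left; auto..].
    intros; unfold Re; simpl; ring.
  - rewrite (RInt_ext_R _ (fun t => 1 * Im (F (circ r t)) + 1 * Im (G (circ r t)))).
    rewrite RInt_lin; [ring_R|apply circle_continuous_ex_RInt; auto; right; auto..].
    intros; unfold Im; simpl; ring.
Qed.

Lemma circle_mean_scal c F :
  circle_continuous r F ->
  circle_mean r (fun z => c * F z)%C = (c * circle_mean r F)%C.
Proof.
  intros HF. destruct c as [x y]. unfold circle_mean, circle_int, Cmult; simpl.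
  assert (H1 : ex_RInt (fun t => Re (F (circ r t))) 0 (2 * PI))
    by (apply circle_continuous_ex_RInt; auto; left; auto).
  assert (H2 : ex_RInt (fun t => Im (F (circ r t))) 0 (2 * PI))
    by (apply circle_continuous_ex_RInt; auto; right; auto).
  f_equal.
  - rewrite (RInt_ext_R _ (fun t => x * Re (F (circ r t)) + - y * Im (F (circ r t)))).
    rewrite RInt_lin; auto. ring_R. intros; unfold Re, Im; simpl; ring.
  - rewrite (RInt_ext_R _ (fun t => y * Re (F (circ r t)) + x * Im (F (circ r t)))).
    rewrite RInt_lin; auto. ring_R. intros; unfold Re, Im; simpl; ring.
Qed.

(** The factor 2 comes from bounding the real and imaginary parts separately. *)
Lemma circle_mean_bound F M :
  circle_continuous r F -> (forall z, on_circle r z -> Cmod (F z) <= M) ->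
  Cmod (circle_mean r F) <= 2 * M.
Proof.
  intros HF HM. pose proof PI_RGT_0 as Hpi.
  assert (B : forall e, Re_or_Im e -> Rabs (/ (2 * PI) * circle_int (fun z => e (F z)) r) <= M).
  { intros e He. rewrite Rabs_mult, Rabs_pos_eq by (left; apply Rinv_0_lt_compat; lra).
    apply Rmult_le_reg_l with (2 * PI); [lra|]. rewrite <- Rmult_assoc, Rinv_r, Rmult_1_l by lra.
    replace (2 * PI * M) with ((2 * PI - 0) * M) by ring.
    apply abs_RInt_le_const; [lra| |]. apply circle_continuous_ex_RInt; auto.
    intros t _. eapply Rle_trans; [apply Re_or_Im_le; auto|]. apply HM. apply Cmod_circ; lra. }
  eapply Rle_trans; [apply Cmod_le_Rabs|]. simpl.
  pose proof (B Re (or_introl eq_refl)). pose proof (B Im (or_intror eq_refl)). lra.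
Qed.

Lemma cis_plus s t : (cis s * cis t = cis (s + t))%C.
Proof. unfold cis, Cmult; simpl. rewrite cos_plus, sin_plus. f_equal; ring. Qed.

Lemma cis_pow t n : (cis t ^ n)%C = cis (INR n * t).
Proof.
  induction n.
  - simpl. rewrite Rmult_0_l. unfold cis. rewrite cos_0, sin_0. reflexivity.
  - rewrite Cpow_S, IHn, cis_plus, S_INR. f_equal. ring.
Qed.

Lemma cis_neq_0 t : cis t <> 0%C.
Proof. intro E. pose proof (Cmod_cis t) as H. rewrite E, Cmod_0 in H. lra. Qed.

Lemma circle_mean_1 : circle_mean r (fun _ => RtoC 1) = RtoC 1.
Proof.
  pose proof PI_RGT_0. unfold circle_mean, circle_int, RtoC; simpl. rewrite !RInt_const.
  unfold scal; simpl; unfold mult; simpl. f_equal; field; lra.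
Qed.

Lemma circle_mean_inv_pow n : circle_mean r (fun z => / z ^ S n)%C = RtoC 0.
Proof.
  set (k := INR (S n)). assert (Hk : 0 < k) by (apply lt_0_INR; lia).
  set (c := / r ^ S n).
  assert (E : forall t, (/ circ r t ^ S n)%C = (c * cos (k * t), - c * sin (k * t))).
  { intro t. rewrite circ_cis, Cpow_mult_l, cis_pow, <- RtoC_pow. fold k.
    assert (Hr : r ^ S n <> 0) by (apply pow_nonzero; lra).
    assert (Hr' : RtoC (r ^ S n) <> 0%C) by (intro X; apply RtoC_inj in X; auto).
    replace (c * cos (k * t), - c * sin (k * t)) with (/ RtoC (r ^ S n) * cis (- (k * t)))%C.
    - rewrite <- (Cmult_1_r (/ (RtoC (r ^ S n) * cis (k * t)))).
      replace (RtoC 1) with (cis (k * t) * cis (- (k * t)))%C.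
      field. split; auto. apply cis_neq_0.
      rewrite cis_plus, Rplus_opp_r. unfold cis. rewrite cos_0, sin_0. reflexivity.
    - rewrite <- RtoC_inv by auto. fold c. unfold cis, RtoC, Cmult; simpl.
      rewrite cos_neg, sin_neg. f_equal; ring. }
  assert (K2 : k * (2 * PI) = 0 + 2 * INR (S n) * PI) by (fold k; ring).
  unfold circle_mean, circle_int, RtoC. f_equal.
  - rewrite (RInt_ext_R _ (fun t => c * cos (k * t))) by (intros; rewrite E; reflexivity).
    erewrite (is_RInt_unique (V := R_CompleteNormedModule)).
    2: { apply (is_RInt_derive (fun t => c / k * sin (k * t))).
         - intros t _. auto_derive; auto. field. lra.
         - intros t _. apply (ex_derive_continuous (V := R_NormedModule)). auto_derive. auto. }
    unfold minus, plus, opp; simpl. rewrite K2, sin_period, Rmult_0_r, sin_0. ring.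
  - rewrite (RInt_ext_R _ (fun t => - c * sin (k * t))) by (intros; rewrite E; reflexivity).
    erewrite (is_RInt_unique (V := R_CompleteNormedModule)).
    2: { apply (is_RInt_derive (fun t => c / k * cos (k * t))).
         - intros t _. auto_derive; auto. field. lra.
         - intros t _. apply (ex_derive_continuous (V := R_NormedModule)). auto_derive. auto. }
    unfold minus, plus, opp; simpl. rewrite K2, cos_period, Rmult_0_r. ring.
Qed.
End CircleMean.

Ltac ring_C := match goal with |- @eq _ ?x ?y => change (@eq C x y) end; ring.

Lemma C_differentiable_ext_loc f g z d :
  0 < d -> (forall w, Cmod (w - z) < d -> f w = g w) ->
  C_differentiable f z -> C_differentiable g z.
Proof.
  intros Hd E. rewrite !C_differentiable_iff. intros [l H]. exists l.
  intros e He. destruct (H e He) as [d' [Hd' H']].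
  exists (Rmin d d'). split; [apply Rmin_pos; auto|]. intros w Hw.
  rewrite <- !E. apply H'. eapply Rlt_le_trans; [exact Hw|apply Rmin_r].
  rewrite Cmod_sub_diag; auto. eapply Rlt_le_trans; [exact Hw|apply Rmin_l].
Qed.

(** At [lam] the difference quotient is only known to be continuous; its differentiability there
    would already be a consequence of Cauchy's theory. This is why [circle_int_vanish] allows one
    exceptional point. *)
Lemma C_slope_function f lam :
  (forall z, in_D z -> C_differentiable f z) -> in_D lam ->
  exists g, (forall w, (f w - f lam = g w * (w - lam))%C) /\
    (forall z, in_D z -> continuous_in (fun _ => True) g z) /\
    (forall z, in_D z -> z <> lam -> C_differentiable g z).
Proof.
  intros Df Hlam.
  destruct (proj1 (C_differentiable_slope f lam) (Df _ Hlam)) as [phi [Cphi [d [Hd E]]]].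
  (* The continuous slope [phi] is a slope only within distance [d] of [lam]; farther away the
     difference quotient takes over. *)
  set (g := fun w => match Rlt_dec (Cmod (w - lam)) d with
     | left _ => phi w | right _ => ((f w - f lam) / (w - lam))%C end).
  assert (Hn : forall w, w <> lam -> (w - lam)%C <> 0%C).
  { intros w Hw X. apply Hw. replace w with (w - lam + lam)%C by ring. rewrite X. ring. }
  assert (Eg : forall w, (f w - f lam = g w * (w - lam))%C).
  { intro w. unfold g. destruct (Rlt_dec (Cmod (w - lam)) d); auto.
    field. apply Hn. intro X. apply n. rewrite X, Cmod_sub_diag. auto. }
  assert (Dg : forall z, in_D z -> z <> lam -> C_differentiable g z).
  { intros z Hz Nz. pose proof (proj1 (Cmod_gt_0 _) (Hn z Nz)) as P.
    apply (C_differentiable_ext_loc (fun w => (f w + - f lam) * / (w + - lam))%C g z _ P).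
    - intros w Hw. assert (Nw : w <> lam).
      { intro X. rewrite X, Cmod_sub_sym in Hw. lra. }
      apply Hn in Nw. replace (f w + - f lam)%C with (g w * (w - lam))%C.
      field. exact Nw. rewrite <- Eg. ring.
    - apply C_differentiable_mult.
      + apply C_differentiable_plus; [apply Df; auto|apply C_differentiable_const].
      + apply C_differentiable_inv; [|apply (Hn z Nz)].
        apply C_differentiable_plus; [apply C_differentiable_id|apply C_differentiable_const]. }
  exists g. split; [exact Eg|]. split; [|exact Dg].
  intros z Hz. destruct (classic (z = lam)) as [-> | Nz].
  - intros e He. destruct (Cphi e He) as [d' [Hd' H']].
    exists (Rmin d d'). split; [apply Rmin_pos; auto|]. intros w _ Hw.
    assert (W1 := Rlt_le_trans _ _ _ Hw (Rmin_l _ _)).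
    assert (W2 := Rlt_le_trans _ _ _ Hw (Rmin_r _ _)).
    unfold g. destruct (Rlt_dec (Cmod (w - lam)) d); [|lra].
    destruct (Rlt_dec (Cmod (lam - lam)) d) as [_|N].
    apply H'; auto. rewrite Cmod_sub_diag in N. lra.
  - apply C_differentiable_continuous_in, Dg; auto.
Qed.

(** * Cauchy's formula with a geometric remainder *)

Section CauchyExpansion.
Variables (r : R) (lam : C).
Hypothesis r_bounds : Cmod lam < r < 1.

Let r_pos : 0 < r.
Proof. pose proof (Cmod_ge_0 lam). lra. Qed.

Lemma on_circle_neq_0 z : on_circle r z -> z <> 0%C.
Proof. unfold on_circle. intros H ->. rewrite Cmod_0 in H. lra. Qed.

Lemma on_circle_sub_neq_0 z : on_circle r z -> (z - lam)%C <> 0%C.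
Proof.
  unfold on_circle. intros H X. replace z with (z - lam + lam)%C in H by ring.
  rewrite X, Cplus_0_l in H. lra.
Qed.

(** For [n = 0] this is the Cauchy integral of [F] at [lam]; in general it is what is left of it
    after [n] terms of the expansion in powers of [lam]. *)
Definition cauchy_remainder (F : C -> C) (n : nat) : C :=
  circle_mean r (fun z => (lam ^ n * / z ^ n) * (F z * (z * / (z - lam))))%C.

Lemma circle_continuous_mult F G :
  circle_continuous r F -> circle_continuous r G -> circle_continuous r (fun z => F z * G z)%C.
Proof. intros HF HG z Hz. apply continuous_in_mult; auto. Qed.

Lemma circle_continuous_inv F :
  circle_continuous r F -> (forall z, on_circle r z -> F z <> 0%C) ->
  circle_continuous r (fun z => / F z)%C.
Proof.
  intros HF N z Hz e He.
  destruct (continuous_in_inv _ _ _ (HF z Hz) (N z Hz) e He) as [d [Hd H]].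
  exists d. split; auto.
Qed.

Lemma circle_continuous_const c : circle_continuous r (fun _ => c).
Proof. intros z _. apply continuous_in_const. Qed.

Lemma circle_continuous_id : circle_continuous r (fun z => z).
Proof. intros z _. apply continuous_in_id. Qed.

Lemma circle_continuous_inv_pow n : circle_continuous r (fun z => / z ^ n)%C.
Proof.
  apply circle_continuous_inv.
  - induction n; simpl. apply circle_continuous_const.
    apply circle_continuous_mult; auto. apply circle_continuous_id.
  - intros z Hz. apply Cpow_nz. apply on_circle_neq_0; auto.
Qed.

Lemma circle_continuous_kernel : circle_continuous r (fun z => z * / (z - lam))%C.
Proof.
  apply circle_continuous_mult; [apply circle_continuous_id|].
  apply circle_continuous_inv; [|apply on_circle_sub_neq_0].
  intros z Hz. apply (continuous_in_plus _ (fun z => z) (fun _ => - lam)%C).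
  apply continuous_in_id. apply continuous_in_const.
Qed.

(** One step of the geometric series: [z / (z - lam) = 1 + (lam / z) (z / (z - lam))]. *)
Lemma cauchy_remainder_S F n : circle_continuous r F ->
  cauchy_remainder F n =
  (lam ^ n * circle_mean r (fun z => F z * / z ^ n) + cauchy_remainder F (S n))%C.
Proof.
  intro HF. unfold cauchy_remainder.
  rewrite <- circle_mean_scal, <- circle_mean_plus; auto.
  - apply circle_mean_ext; auto. intros z Hz. simpl. field.
    split; [apply on_circle_sub_neq_0; auto|].
    split; [apply Cpow_nz|]; apply on_circle_neq_0; auto.
  - apply circle_continuous_mult; [apply circle_continuous_const|].
    apply circle_continuous_mult; auto. apply circle_continuous_inv_pow.
  - apply circle_continuous_mult; apply circle_continuous_mult; auto.
    apply circle_continuous_const. apply circle_continuous_inv_pow.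
    apply circle_continuous_kernel.
  - apply circle_continuous_mult; auto. apply circle_continuous_inv_pow.
Qed.

Lemma cauchy_remainder_bound F n M r' :
  circle_continuous r F -> (forall z, on_circle r z -> Cmod (F z) <= M) ->
  Cmod lam <= r' -> r' < r ->
  Cmod (cauchy_remainder F n) <= 2 * ((r' / r) ^ n * (M * (r / (r - r')))).
Proof.
  intros HF HM H1 H2. pose proof (Cmod_ge_0 lam) as Hl.
  apply circle_mean_bound; auto.
  - apply circle_continuous_mult; apply circle_continuous_mult; auto.
    apply circle_continuous_const. apply circle_continuous_inv_pow.
    apply circle_continuous_kernel.
  - intros z Hz. rewrite !Cmod_mult.
    assert (Nz := on_circle_neq_0 z Hz). assert (Nl := on_circle_sub_neq_0 z Hz).
    rewrite !Cmod_inv by (try apply Cpow_nz; auto). rewrite !Cmod_pow, Hz.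
    assert (Pz := proj1 (Cmod_gt_0 _) Nl).
    assert (D : r - r' <= Cmod (z - lam)).
    { pose proof (Cmod_sub_le z lam). rewrite Hz in H. lra. }
    apply Rmult_le_compat.
    + apply Rmult_le_pos; [apply pow_le; auto|]. left. apply Rinv_0_lt_compat, pow_lt; auto.
    + apply Rmult_le_pos; [apply Cmod_ge_0|]. apply Rmult_le_pos; [lra|].
      left; apply Rinv_0_lt_compat; auto.
    + unfold Rdiv. rewrite Rpow_mult_distr, pow_inv. apply Rmult_le_compat_r.
      left. apply Rinv_0_lt_compat, pow_lt; auto. apply pow_incr; lra.
    + apply Rmult_le_compat; [apply Cmod_ge_0| |auto|].
      apply Rmult_le_pos; [lra|]. left; apply Rinv_0_lt_compat; auto.
      apply Rmult_le_compat_l; [lra|]. apply Rinv_le_contravar; lra.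
Qed.

Lemma cauchy_remainder_sum F n : circle_continuous r F ->
  cauchy_remainder F 0 =
  (sum_n (fun k => lam ^ k * circle_mean r (fun z => F z * / z ^ k)) n
   + cauchy_remainder F (S n))%C.
Proof.
  intro HF. induction n.
  - rewrite sum_O. apply cauchy_remainder_S; auto.
  - rewrite sum_Sn, IHn, (cauchy_remainder_S F (S n)) by auto.
    unfold plus; simpl. ring_C.
Qed.

(** In the expansion for the constant 1 only the term [k = 0] has nonzero mean. The remainder is
    kept, so no limit has to be taken. *)
Lemma cauchy_kernel_mean n :
  (RtoC 1 = cauchy_remainder (fun _ => 1) 0 - cauchy_remainder (fun _ => 1) (S n))%C.
Proof.
  rewrite (cauchy_remainder_sum _ n) by apply circle_continuous_const.
  assert (Cancel : forall s t : C, (s + t - t)%C = s) by (intros; ring).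
  rewrite Cancel.
  induction n.
  - rewrite sum_O. simpl. rewrite (circle_mean_ext r r_pos _ (fun _ => RtoC 1)).
    rewrite circle_mean_1 by auto. ring_C. intros z Hz. simpl. field.
  - rewrite sum_Sn, <- IHn.
    rewrite (circle_mean_ext r r_pos _ (fun z => / z ^ S n)%C).
    rewrite circle_mean_inv_pow by auto. unfold plus; simpl. ring_C.
    intros z Hz. apply Cmult_1_l.
Qed.

(** With [f z - f lam = g z (z - lam)], the difference of the two sides is the mean of [g z * z],
    which vanishes. The mean of the kernel itself is left unevaluated. *)
Lemma cauchy_formula f :
  (forall z, in_D z -> C_differentiable f z) ->
  circle_continuous r f ->
  cauchy_remainder f 0 = (f lam * cauchy_remainder (fun _ => 1) 0)%C.
Proof.
  intros Df Cf.
  destruct (C_slope_function f lam Df) as [g [Eg [Cg Dg]]]; [unfold in_D; lra|].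
  assert (Z : circle_mean r (fun z => g z * z)%C = RtoC 0).
  { unfold circle_mean, RtoC.
    rewrite (circle_int_vanish Re g lam r), (circle_int_vanish Im g lam r);
      auto; try (left; reflexivity); try (right; reflexivity).
    f_equal; ring. }
  assert (C1 : circle_continuous r
    (fun z => lam ^ 0 * / z ^ 0 * (RtoC 1 * (z * / (z - lam))))%C).
  { apply circle_continuous_mult; apply circle_continuous_mult;
      try apply circle_continuous_const. apply (circle_continuous_inv_pow 0).
    apply circle_continuous_kernel. }
  assert (C2 : circle_continuous r (fun z => g z * z)%C).
  { apply circle_continuous_mult; [|apply circle_continuous_id].
    intros z Hz e He. destruct (Cg z) with e as [d [Hd H]]; auto.
    unfold in_D. rewrite Hz. lra. exists d; split; auto. }
  unfold cauchy_remainder.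
  rewrite <- circle_mean_scal by auto.
  rewrite <- (Cplus_0_r (circle_mean r (fun z => f lam * _)%C)), <- Z, <- circle_mean_plus; auto.
  - apply circle_mean_ext; auto. intros z Hz. simpl.
    replace (f z) with (g z * (z - lam) + f lam)%C by (rewrite <- Eg; ring).
    field. apply on_circle_sub_neq_0; auto.
  - apply circle_continuous_mult; auto. apply circle_continuous_const.
Qed.
End CauchyExpansion.

(** * Polynomial approximation in the disc algebra *)

Fixpoint peval (l : list C) (z : C) : C :=
  match l with nil => RtoC 0 | a :: l' => (a + z * peval l' z)%C end.

Lemma sum_n_head (c : nat -> C) z n :
  (sum_n (fun k => c k * z ^ k) (S n) = c 0%nat + z * sum_n (fun k => c (S k) * z ^ k) n)%C.
Proof.
  induction n.
  - rewrite sum_Sn, !sum_O. unfold plus; simpl. ring.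
  - rewrite sum_Sn, IHn, (sum_Sn _ n). unfold plus; simpl. ring_C.
Qed.

Lemma peval_of_sum (c : nat -> C) n :
  exists l, forall z, (peval l z = sum_n (fun k => c k * z ^ k) n)%C.
Proof.
  revert c. induction n; intro c.
  - exists [c 0%nat]. intro z. rewrite sum_O. simpl. ring.
  - destruct (IHn (fun k => c (S k))) as [l Hl]. exists (c 0%nat :: l).
    intro z. rewrite sum_n_head, <- Hl. reflexivity.
Qed.

Lemma disc_algebra_peval l : disc_algebra (peval l).
Proof.
  induction l; simpl. apply disc_algebra_const.
  apply disc_algebra_plus; [apply disc_algebra_const|].
  apply disc_algebra_mult; auto. apply disc_algebra_id.
Qed.

(** By uniform continuity [f] is close to its dilate [f (r z)]. The Taylor coefficients of [f] are
    computed on a circle of radius [rho] between [r] and 1, so the Taylor sums of the dilate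
    converge uniformly, at the rate [r / rho]. *)
Lemma disc_algebra_poly_dense f eps : disc_algebra f -> 0 < eps ->
  exists l, forall z, in_cD z -> Cmod (f z - peval l z) < eps.
Proof.
  intros Hf He.
  destruct (disc_algebra_bounded f Hf) as [M [HM BM]].
  destruct (disc_algebra_uniform f (eps / 2) Hf ltac:(lra)) as [d [Hd U]].
  pose proof Hf as Hf'. rewrite disc_algebra_iff in Hf'. destruct Hf' as [Cf Df].
  set (r := 1 - Rmin (1 / 2) (d / 2)).
  assert (Hr : 0 < r < 1 /\ 1 - r < d).
  { unfold r. pose proof (Rmin_l (1 / 2) (d / 2)). pose proof (Rmin_r (1 / 2) (d / 2)).
    assert (0 < Rmin (1 / 2) (d / 2)) by (apply Rmin_pos; lra). lra. }
  set (rho := (1 + r) / 2).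
  assert (Hrho : r < rho < 1) by (unfold rho; lra).
  set (K := rho / (rho - r)).
  assert (HK : 0 < K) by (apply Rdiv_lt_0_compat; lra).
  assert (Hq : 0 < r / rho < 1).
  { split; [apply Rdiv_lt_0_compat; lra|].
    apply Rmult_lt_reg_r with rho; [lra|]. unfold Rdiv. rewrite Rmult_assoc, Rinv_l; lra. }
  (* The two remainders together are at most [4 (r / rho)^(n+1) M K], to be made less than
     [eps / 2]. *)
  destruct (pow_lt_1_zero (r / rho) ltac:(rewrite Rabs_pos_eq; lra) (eps / (8 * M * K)))
    as [n Hn].
  { apply Rdiv_lt_0_compat; auto. apply Rmult_lt_0_compat; lra. }
  specialize (Hn (S n) ltac:(lia)).
  rewrite Rabs_pos_eq in Hn by (apply pow_le; lra).
  assert (Cc : circle_continuous rho f).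
  { intros z Hz e He'. unfold on_circle in Hz.
    destruct (Cf z ltac:(unfold in_cD; lra) e He') as [d' [Hd' H']].
    exists d'; split; auto. intros w Hw. apply H'. unfold on_circle, in_cD in *; lra. }
  set (c := fun k => (circle_mean rho (fun z => f z * / z ^ k))%C).
  destruct (peval_of_sum (fun k => RtoC (r ^ k) * c k)%C n) as [l Hl].
  exists l. intros z Hz.
  set (lam := (RtoC r * z)%C).
  assert (Hlam : Cmod lam <= r).
  { unfold lam. rewrite Cmod_mult, Cmod_R, Rabs_pos_eq by lra. unfold in_cD in Hz.
    pose proof (Cmod_ge_0 z). nra. }
  assert (Hlr : Cmod lam < rho < 1) by lra.
  (* Writes [f lam] as [f lam * 1], replaces 1 by the difference of kernel means, and applies
     Cauchy's formula to the leading one. *)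
  assert (E : (f lam = peval l z + (cauchy_remainder rho lam f (S n)
     - f lam * cauchy_remainder rho lam (fun _ => 1) (S n)))%C).
  { pose proof (cauchy_formula rho lam Hlr f Df Cc) as E0.
    rewrite (cauchy_remainder_sum rho lam Hlr f n Cc) in E0.
    assert (E1 : (peval l z = sum_n (fun k => lam ^ k * c k) n)%C).
    { rewrite Hl. apply sum_n_ext. intro k. unfold lam.
      rewrite Cpow_mult_l, RtoC_pow. ring_C. }
    fold c in E0.
    change (sum_n (fun k => lam ^ k * circle_mean rho (fun z0 => f z0 * / z0 ^ k))%C n)
      with (sum_n (fun k => lam ^ k * c k)%C n) in E0. rewrite <- E1 in E0.
    pose proof (cauchy_kernel_mean rho lam Hlr n) as E2.
    transitivity (f lam * 1)%C; [ring|]. rewrite E2 at 1.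
    transitivity (f lam * cauchy_remainder rho lam (fun _ => 1) 0
       - f lam * cauchy_remainder rho lam (fun _ => 1) (S n))%C; [ring|].
    rewrite <- E0. ring. }
  assert (B1 := cauchy_remainder_bound rho lam Hlr f (S n) M r Cc).
  assert (B2 := cauchy_remainder_bound rho lam Hlr (fun _ => 1) (S n) 1 r
    (circle_continuous_const rho 1)).
  fold K in B1, B2.
  assert (B1' : Cmod (cauchy_remainder rho lam f (S n)) <= 2 * ((r / rho) ^ S n * (M * K))).
  { apply B1; try lra. intros w Hw. apply BM. unfold in_cD, on_circle in *; lra. }
  assert (B2' : Cmod (cauchy_remainder rho lam (fun _ => 1) (S n)) <= 2 * ((r / rho) ^ S n * (1 * K))).
  { apply B2; try lra. intros w Hw. rewrite Cmod_1; lra. }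
  assert (Fl : Cmod (f lam) <= M) by (apply BM; unfold in_cD; lra).
  assert (B3 : Cmod (f lam - peval l z) <= 4 * ((r / rho) ^ S n * (M * K))).
  { rewrite E at 1.
    match goal with |- Cmod (?p + (?x - ?y) - ?p)%C <= _ =>
      replace (p + (x - y) - p)%C with (x + - y)%C by ring end.
    eapply Rle_trans; [apply Cmod_triangle|]. rewrite Cmod_opp, Cmod_mult.
    assert (Cmod (f lam) * Cmod (cauchy_remainder rho lam (fun _ => 1) (S n))
      <= M * (2 * ((r / rho) ^ S n * (1 * K)))).
    { apply Rmult_le_compat; auto; apply Cmod_ge_0. }
    lra. }
  assert (B4 : 4 * ((r / rho) ^ S n * (M * K)) < eps / 2).
  { apply Rmult_lt_compat_r with (r := 4 * M * K) in Hn.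
    - replace (eps / (8 * M * K) * (4 * M * K)) with (eps / 2) in Hn by (field; lra). lra.
    - apply Rmult_lt_0_compat; lra. }
  assert (Zl : Cmod (lam - z) < d).
  { unfold lam. replace (RtoC r * z - z)%C with (RtoC (r - 1) * z)%C by (rewrite RtoC_minus; ring).
    rewrite Cmod_mult, Cmod_R, Rabs_left by lra. unfold in_cD in Hz. pose proof (Cmod_ge_0 z). nra. }
  specialize (U z lam Hz ltac:(unfold in_cD; lra) Zl). rewrite Cmod_sub_sym in U.
  replace (f z - peval l z)%C with ((f z - f lam) + (f lam - peval l z))%C by ring.
  eapply Rle_lt_trans; [apply Cmod_triangle|]. lra.
Qed.

Definition rpeval (l : list R) (z : C) : C := peval (map RtoC l) z.

Lemma real_disc_algebra_rpeval l : real_disc_algebra (rpeval l).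
Proof.
  unfold rpeval. induction l; simpl. apply (real_disc_algebra_const 0).
  apply real_disc_algebra_plus; [apply real_disc_algebra_const|].
  apply real_disc_algebra_mult; auto. apply real_disc_algebra_id.
Qed.

Lemma rpeval_Re_coefs l z :
  (rpeval (map Re l) z = RtoC (/ 2) * (peval l z + Cconj (peval l (Cconj z))))%C.
Proof.
  unfold rpeval. induction l as [|a l IH]; simpl.
  - rewrite Cconj_RtoC. ring.
  - rewrite IH, Cconj_plus, Cconj_mult, Cconj_conj.
    replace (RtoC (Re a)) with (RtoC (/ 2) * (a + Cconj a))%C. ring.
    destruct a; unfold Cconj, Cplus, Cmult, RtoC; simpl. f_equal; field.
Qed.

(** Taking real parts of coefficients averages the polynomial with its reflection; as [f] equals its
    own reflection, the error does not grow. *)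
Lemma real_disc_algebra_poly_dense f eps : real_disc_algebra f -> 0 < eps ->
  exists l, forall z, in_cD z -> Cmod (f z - rpeval l z) < eps.
Proof.
  intros [Hf Sf] He.
  destruct (disc_algebra_poly_dense f eps Hf He) as [l Hl].
  exists (map Re l). intros z Hz. rewrite rpeval_Re_coefs.
  replace (f z - RtoC (/ 2) * (peval l z + Cconj (peval l (Cconj z))))%C
    with (RtoC (/ 2) * ((f z - peval l z) + Cconj (f (Cconj z) - peval l (Cconj z))))%C.
  - rewrite Cmod_mult, Cmod_R, Rabs_pos_eq by lra.
    pose proof (Cmod_triangle (f z - peval l z) (Cconj (f (Cconj z) - peval l (Cconj z)))) as T.
    rewrite Cmod_conj in T. pose proof (Hl z Hz). pose proof (Hl _ (in_cD_conj z Hz)). lra.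
  - rewrite Cconj_minus, <- Sf by auto.
    replace (f z) with (RtoC (/ 2) * (f z + f z))%C at 3. ring.
    rewrite RtoC_inv by lra. field.
Qed.

(** * Bezout identities *)

Lemma Csub_neq_0 (a b : C) : a <> b -> (a - b)%C <> 0%C.
Proof. intros H X. apply H. replace a with (a - b + b)%C by ring. rewrite X. ring. Qed.

(** * Sums over roots of unity *)

Fixpoint csum (f : nat -> C) (n : nat) : C :=
  match n with O => RtoC 0 | S m => (csum f m + f m)%C end.

Lemma csum_ext f g n : (forall k, (k < n)%nat -> f k = g k) -> csum f n = csum g n.
Proof. intro H. induction n; simpl; auto. rewrite IHn, H by auto with arith. auto. Qed.

Lemma csum_plus f g n : csum (fun k => f k + g k)%C n = (csum f n + csum g n)%C.
Proof. induction n; simpl. ring. rewrite IHn. ring. Qed.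

Lemma csum_scal c f n : csum (fun k => c * f k)%C n = (c * csum f n)%C.
Proof. induction n; simpl. ring. rewrite IHn. ring. Qed.

Lemma csum_const c n : csum (fun _ => c) n = (RtoC (INR n) * c)%C.
Proof. induction n; simpl csum. simpl; ring. rewrite IHn, S_INR, RtoC_plus. ring. Qed.

Lemma csum_bound f M n : (forall k, Cmod (f k) <= M) -> Cmod (csum f n) <= INR n * M.
Proof.
  intro H. induction n; simpl csum. rewrite Cmod_0. simpl; lra.
  rewrite S_INR. eapply Rle_trans; [apply Cmod_triangle|]. specialize (H n). lra.
Qed.

Lemma csum_geom y n : ((1 - y) * csum (fun k => y ^ k) n = 1 - y ^ n)%C.
Proof. induction n; simpl. ring. rewrite Cmult_plus_distr_l, IHn. ring. Qed.

Definition unity_root (n j : nat) : C := cis (2 * PI * INR j / INR n).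

(** The symmetry in [j] and [m] turns a sum of [m]-th powers over all roots into a geometric
    series. *)
Lemma unity_root_pow_swap n j m :
  (0 < n)%nat -> (unity_root n j ^ m = unity_root n m ^ j)%C.
Proof.
  intro Hn. unfold unity_root. rewrite !cis_pow. f_equal. field.
  apply not_0_INR. lia.
Qed.

Lemma unity_root_pow n j : (0 < n)%nat -> (unity_root n j ^ n = 1)%C.
Proof.
  intro Hn. rewrite unity_root_pow_swap by auto. unfold unity_root.
  rewrite cis_pow.
  replace (INR j * (2 * PI * INR n / INR n)) with (0 + 2 * INR j * PI)
    by (field; apply not_0_INR; lia).
  unfold cis. rewrite cos_period, sin_period, cos_0, sin_0. reflexivity.
Qed.

Lemma unity_root_sum n m : (0 < m < n)%nat ->
  csum (fun j => unity_root n j ^ m)%C n = 0%C.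
Proof.
  intro Hm. rewrite (csum_ext _ (fun j => unity_root n m ^ j)%C)
    by (intros; apply unity_root_pow_swap; lia).
  pose proof (csum_geom (unity_root n m) n) as G. rewrite unity_root_pow in G by lia.
  replace (1 - 1)%C with (RtoC 0) in G by ring.
  assert (N : (1 - unity_root n m)%C <> 0%C).
  { intro X. assert (Y : Re (unity_root n m) = 1).
    { replace (unity_root n m) with (1 - (1 - unity_root n m))%C by ring. rewrite X.
      simpl. ring. }
    unfold unity_root, cis, Re in Y. simpl in Y.
    assert (Hn : 0 < INR n) by (apply lt_0_INR; lia).
    assert (Hm0 : 0 < INR m) by (apply lt_0_INR; lia).
    assert (Hmn : INR m < INR n) by (apply lt_INR; lia).
    pose proof PI_RGT_0.
    set (x := PI * (INR m / INR n)).
    replace (2 * PI * INR m / INR n) with (2 * x) in Y by (unfold x; field; lra).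
    rewrite cos_2a_sin in Y.
    assert (Q : 0 < INR m / INR n < 1).
    { split; [apply Rdiv_lt_0_compat; auto|]. apply Rmult_lt_reg_r with (INR n); auto.
      unfold Rdiv. rewrite Rmult_assoc, Rinv_l by lra. lra. }
    assert (0 < sin x) by (apply sin_gt_0; unfold x; nra). nra. }
  destruct (classic (csum (fun j => unity_root n m ^ j)%C n = 0%C)) as [E|E]; auto.
  exfalso. apply (Cmult_neq_0 _ _ N E). exact G.
Qed.

(** Only [k = 0] survives the summation over [j]. Up to the factor [1 - zeta^n], this is the partial
    fraction expansion saying that the mean of [1 / (1 - zeta w)] over the [n]-th roots of unity [w]
    is [1 / (1 - zeta^n)]. *)
Lemma unity_root_geom_sum (zeta : C) n : (0 < n)%nat ->
  csum (fun j => csum (fun k => (zeta * unity_root n j) ^ k)%C n) n = RtoC (INR n).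
Proof.
  intro Hn.
  assert (H : forall m, (0 < m <= n)%nat ->
    csum (fun j => csum (fun k => (zeta * unity_root n j) ^ k)%C m) n = RtoC (INR n)).
  { induction m; intro Hm; [lia|]. destruct m.
    - simpl. rewrite csum_const. ring.
    - simpl csum. rewrite csum_plus. simpl csum in IHm. rewrite IHm by lia.
      rewrite (csum_ext _ (fun j => zeta ^ S m * unity_root n j ^ S m)%C)
        by (intros; rewrite <- Cpow_mult_l; reflexivity).
      rewrite csum_scal, unity_root_sum by lia. ring. }
  apply H. lia.
Qed.

Lemma peval_divide l a : exists l', forall z, (peval l z = peval l a + (z - a) * peval l' z)%C.
Proof.
  induction l as [|c l IH].
  - exists nil. intro; simpl. ring.
  - destruct IH as [l' H]. exists (peval l a :: l'). intro z. simpl. rewrite (H z). ring.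
Qed.

Lemma disc_algebra_csum (F : nat -> C -> C) n :
  (forall k, disc_algebra (F k)) -> disc_algebra (fun z => csum (fun k => F k z) n).
Proof.
  intro H. induction n; simpl. apply disc_algebra_const. apply disc_algebra_plus; auto.
Qed.

Lemma one_plus_neq_0 (w : C) c : Cmod w <= c -> c < 1 -> (1 + w)%C <> 0%C.
Proof.
  intros H1 H2 E. pose proof (Cmod_sub_le 1 (1 + w)) as T.
  rewrite E, Cmod_0, Cmod_1 in T. replace (1 - 0)%C with (RtoC 1) in T by ring.
  assert (Cmod w = 1). { replace w with (1 + w - 1)%C by ring. rewrite E.
    replace (0 - 1)%C with (- (1))%C by ring. apply Cmod_m1. }
  lra.
Qed.

Lemma Cmod_one_plus_ge (w : C) c : Cmod w <= c -> 1 - c <= Cmod (1 + w).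
Proof.
  intro H. pose proof (Cmod_sub_le 1 (1 + w)) as T. rewrite Cmod_1 in T.
  replace (1 - (1 + w))%C with (- w)%C in T by ring. rewrite Cmod_opp in T. lra.
Qed.

(** * The quotient by the ideal generated by two functions *)

Section Ideal.
Variables f1 f2 : C -> C.
Hypothesis A1 : disc_algebra f1.
Hypothesis A2 : disc_algebra f2.

Definition in_ideal (x : C -> C) : Prop :=
  exists a b, disc_algebra a /\ disc_algebra b /\
    forall z, in_cD z -> (x z = a z * f1 z + b z * f2 z)%C.

Lemma in_ideal_ext x y :
  (forall z, in_cD z -> x z = y z) -> in_ideal x -> in_ideal y.
Proof.
  intros E [a [b [Ha [Hb H]]]]. exists a, b. repeat split; try apply Ha; try apply Hb.
  intros; rewrite <- E; auto.
Qed.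

Lemma in_ideal_plus x y : in_ideal x -> in_ideal y -> in_ideal (fun z => x z + y z)%C.
Proof.
  intros [a [b [Ha [Hb H]]]] [a' [b' [Ha' [Hb' H']]]].
  exists (fun z => a z + a' z)%C, (fun z => b z + b' z)%C.
  split; [apply disc_algebra_plus; auto|]. split; [apply disc_algebra_plus; auto|].
  intros z Hz. rewrite H, H' by auto. ring.
Qed.

Lemma in_ideal_mult c x : disc_algebra c -> in_ideal x -> in_ideal (fun z => c z * x z)%C.
Proof.
  intros Hc [a [b [Ha [Hb H]]]].
  exists (fun z => c z * a z)%C, (fun z => c z * b z)%C.
  split; [apply disc_algebra_mult; auto|]. split; [apply disc_algebra_mult; auto|].
  intros z Hz. rewrite H by auto. ring.
Qed.

Lemma in_ideal_scal c x : in_ideal x -> in_ideal (fun z => c * x z)%C.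
Proof. intro H. apply (in_ideal_mult (fun _ => c)); auto. apply disc_algebra_const. Qed.

Lemma in_ideal_0 : in_ideal (fun _ => 0%C).
Proof.
  exists (fun _ => 0%C), (fun _ => 0%C).
  split; [apply disc_algebra_const|]. split; [apply disc_algebra_const|]. intros; ring.
Qed.

Lemma in_ideal_mult2 x y : in_ideal x -> in_ideal y -> in_ideal (fun z => x z * y z)%C.
Proof.
  intros [a [b [Ha [Hb H]]]] Hy.
  apply in_ideal_ext with (fun z => (a z * f1 z + b z * f2 z) * y z)%C.
  intros z Hz; rewrite H; auto.
  apply (in_ideal_mult (fun z => a z * f1 z + b z * f2 z)%C); auto.
  apply disc_algebra_plus; apply disc_algebra_mult; auto.
Qed.

Lemma in_ideal_csum (F : nat -> C -> C) n :
  (forall k, in_ideal (F k)) -> in_ideal (fun z => csum (fun k => F k z) n).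
Proof.
  intro H. induction n; simpl. apply in_ideal_0. apply in_ideal_plus; auto.
Qed.

Lemma in_ideal_f1 : in_ideal f1.
Proof.
  exists (fun _ => 1%C), (fun _ => 0%C).
  split; [apply disc_algebra_const|]. split; [apply disc_algebra_const|]. intros; ring.
Qed.

Lemma in_ideal_f2 : in_ideal f2.
Proof.
  exists (fun _ => 0%C), (fun _ => 1%C).
  split; [apply disc_algebra_const|]. split; [apply disc_algebra_const|]. intros; ring.
Qed.

(* The quotient seminorm of [x] modulo the ideal is at most [c]. *)
Definition qnorm_le (x : C -> C) (c : R) : Prop :=
  exists u, disc_algebra u /\ in_ideal (fun z => x z - u z)%C /\
    forall z, in_cD z -> Cmod (u z) <= c.

Lemma qnorm_le_congr x y c : in_ideal (fun z => x z - y z)%C -> qnorm_le y c -> qnorm_le x c.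
Proof.
  intros H [u [Hu [J B]]]. exists u. split; auto. split; auto.
  apply in_ideal_ext with (fun z => (x z - y z) + (y z - u z))%C. intros; ring.
  apply in_ideal_plus; auto.
Qed.

Lemma qnorm_le_ext x y c : (forall z, in_cD z -> x z = y z) -> qnorm_le y c -> qnorm_le x c.
Proof.
  intros E. apply qnorm_le_congr. apply in_ideal_ext with (fun _ => 0%C).
  intros z Hz. rewrite E by auto. ring. apply in_ideal_0.
Qed.

Lemma qnorm_le_weaken x c d : c <= d -> qnorm_le x c -> qnorm_le x d.
Proof.
  intros H [u [Hu [J B]]]. exists u. split; auto. split; auto.
  intros z Hz. specialize (B z Hz). lra.
Qed.

Lemma qnorm_le_bound x c :
  disc_algebra x -> (forall z, in_cD z -> Cmod (x z) <= c) -> qnorm_le x c.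
Proof.
  intros H B. exists x. split; auto. split; auto.
  apply in_ideal_ext with (fun _ => 0%C). intros; ring. apply in_ideal_0.
Qed.

Lemma qnorm_le_plus x y c d :
  qnorm_le x c -> qnorm_le y d -> qnorm_le (fun z => x z + y z)%C (c + d).
Proof.
  intros [u [Hu [J B]]] [v [Hv [J' B']]]. exists (fun z => u z + v z)%C.
  split; [apply disc_algebra_plus; auto|]. split.
  - apply in_ideal_ext with (fun z => (x z - u z) + (y z - v z))%C. intros; ring.
    apply in_ideal_plus; auto.
  - intros z Hz. eapply Rle_trans; [apply Cmod_triangle|]. apply Rplus_le_compat; auto.
Qed.

Lemma qnorm_le_mult x y c d :
  qnorm_le x c -> qnorm_le y d -> qnorm_le (fun z => x z * y z)%C (c * d).
Proof.
  intros [u [Hu [J B]]] [v [Hv [J' B']]]. exists (fun z => u z * v z)%C.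
  split; [apply disc_algebra_mult; auto|]. split.
  - apply in_ideal_ext with (fun z => (x z - u z) * (y z - v z)
      + (v z * (x z - u z) + u z * (y z - v z)))%C. intros; ring.
    apply in_ideal_plus; [|apply in_ideal_plus].
    + apply (in_ideal_mult2 (fun z => x z - u z)%C (fun z => y z - v z)%C); auto.
    + apply (in_ideal_mult v (fun z => x z - u z)%C); auto.
    + apply (in_ideal_mult u (fun z => y z - v z)%C); auto.
  - intros z Hz. rewrite Cmod_mult. apply Rmult_le_compat; auto; apply Cmod_ge_0.
Qed.

Lemma qnorm_le_scal k x c : qnorm_le x c -> qnorm_le (fun z => k * x z)%C (Cmod k * c).
Proof.
  intro H. apply (qnorm_le_mult (fun _ => k)); auto.
  apply qnorm_le_bound; [apply disc_algebra_const|]. intros; lra.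
Qed.

Lemma qnorm_le_csum (F : nat -> C -> C) c n :
  (forall k, qnorm_le (F k) c) -> qnorm_le (fun z => csum (fun k => F k z) n) (INR n * c).
Proof.
  intro H. induction n; simpl csum.
  - apply qnorm_le_bound; [apply disc_algebra_const|]. intros; rewrite Cmod_0; simpl; lra.
  - rewrite S_INR, Rmult_plus_distr_r, Rmult_1_l. apply qnorm_le_plus; auto.
Qed.

(** If 1 is congruent to [u] with [Cmod u <= c < 1], then [1 - u] lies in the ideal and is
    invertible in the disc algebra. *)
Lemma qnorm_lt_1_unit c : c < 1 -> qnorm_le (fun _ => 1%C) c -> in_ideal (fun _ => 1%C).
Proof.
  intros Hc [u [Hu [J B]]].
  assert (N : forall z, in_cD z -> (1 + - u z)%C <> 0%C).
  { intros z Hz. apply one_plus_neq_0 with c; auto. rewrite Cmod_opp; auto. }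
  apply in_ideal_ext with (fun z => / (1 + - u z) * (1 - u z))%C.
  - intros z Hz. apply Cinv_l. apply (N z Hz).
  - apply (in_ideal_mult (fun z => / (1 + - u z))%C); auto.
    apply disc_algebra_inv; auto. apply disc_algebra_plus; [apply disc_algebra_const|].
    apply disc_algebra_opp; auto.
Qed.

Definition resolvent (lam : C) (r : C -> C) : Prop :=
  disc_algebra r /\ in_ideal (fun z => (lam - z) * r z - 1)%C.

(** Let [l] approximate [f] and [q] be its quotient by [z - lam]. Then [v = (f - l) + l(lam)] has no
    zero, as [l(lam)] outweighs the error, and [v] is congruent to [(lam - z) q] because [f] is in
    the ideal. So [q / v] is the inverse sought. *)
Lemma resolvent_of_nonvanishing f lam :
  disc_algebra f -> in_ideal f -> in_cD lam -> f lam <> 0%C -> exists r, resolvent lam r.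
Proof.
  intros Af If Hl Nf. set (c := Cmod (f lam)).
  assert (Hc : 0 < c) by (apply Cmod_gt_0; auto).
  destruct (disc_algebra_poly_dense f (c / 3) Af ltac:(lra)) as [l Bl].
  destruct (peval_divide l lam) as [q Hq].
  set (v := fun z => (f z + (lam + - z) * peval q z)%C).
  assert (Av : disc_algebra v).
  { apply disc_algebra_plus; auto. apply disc_algebra_mult; [|apply disc_algebra_peval].
    apply disc_algebra_plus; [apply disc_algebra_const|].
    apply disc_algebra_opp, disc_algebra_id. }
  assert (Nv : forall z, in_cD z -> v z <> 0%C).
  { intros z Hz X. pose proof (Bl z Hz) as B1. pose proof (Bl lam Hl) as B2.
    assert (E : (peval l lam = - (f z - peval l z))%C).
    { unfold v in X. rewrite (Hq z).
      replace (- (f z - (peval l lam + (z - lam) * peval q z)))%C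
        with (peval l lam - (f z + (lam + - z) * peval q z))%C by ring.
      rewrite X. ring. }
    pose proof (Cmod_sub_le (f lam) (peval l lam)) as T. fold c in T.
    rewrite E in T at 1. rewrite Cmod_opp in T. lra. }
  exists (fun z => / v z * peval q z)%C. split.
  - apply disc_algebra_mult; [apply disc_algebra_inv; auto|apply disc_algebra_peval].
  - apply in_ideal_ext with (fun z => (- / v z) * f z)%C.
    + intros z Hz. replace (f z) with (v z - (lam + - z) * peval q z)%C by (unfold v; ring).
      field. apply Nv; auto.
    + apply (in_ideal_mult (fun z => - / v z)%C); auto.
      apply disc_algebra_opp, disc_algebra_inv; auto.
Qed.

Hypothesis no_common_zero : forall z, in_cD z -> f1 z <> 0%C \/ f2 z <> 0%C.

Lemma resolvent_exists lam : exists r, resolvent lam r.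
Proof.
  destruct (classic (in_cD lam)) as [Hl|Hl].
  - destruct (no_common_zero lam Hl) as [N|N].
    + apply resolvent_of_nonvanishing with f1; auto. apply in_ideal_f1.
    + apply resolvent_of_nonvanishing with f2; auto. apply in_ideal_f2.
  - assert (N : forall z, in_cD z -> (lam + - z)%C <> 0%C).
    { intros z Hz. apply (Csub_neq_0 lam z). intro X. apply Hl. rewrite X. auto. }
    exists (fun z => / (lam + - z))%C. split.
    + apply disc_algebra_inv; auto. apply disc_algebra_plus; [apply disc_algebra_const|].
      apply disc_algebra_opp, disc_algebra_id.
    + apply in_ideal_ext with (fun _ => 0%C); [|apply in_ideal_0].
      intros z Hz. field. apply N; auto.
Qed.

(** Near [u] the function [r / (1 + (lam - u) r)] is again a resolvent. Within [1 / (2 K)] of [u]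
    the denominator has modulus at least [1/2], giving the bound [2 K]: one number serves as radius
    and as inverse bound, and compactness does the rest. *)
Lemma resolvent_bounded M : exists B, 0 < B /\ forall lam, Cmod lam <= M ->
  exists r, resolvent lam r /\ forall z, in_cD z -> Cmod (r z) <= B.
Proof.
  destruct (compact_disc M (fun lam d => exists r, resolvent lam r /\
     forall z, in_cD z -> Cmod (r z) <= / d)) as [d [Hd H]].
  - intros lam d d' [H1 H2] [r [Hr B]]. exists r. split; auto. intros z Hz.
    eapply Rle_trans; [apply B; auto|]. apply Rinv_le_contravar; auto.
  - intro u. destruct (resolvent_exists u) as [r [Ar Jr]].
    destruct (disc_algebra_bounded r Ar) as [K [HK BK]].
    assert (Hd : 0 < / (2 * K)) by (apply Rinv_0_lt_compat; lra).
    exists (/ (2 * K)). split; auto. intros lam Hlam.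
    set (v := fun z => (1 + (lam - u) * r z)%C).
    assert (Bv : forall z, in_cD z -> Cmod ((lam - u) * r z) <= / 2).
    { intros z Hz. rewrite Cmod_mult. replace (/ 2) with (/ (2 * K) * K) by (field; lra).
      apply Rmult_le_compat; try apply Cmod_ge_0; auto. lra. }
    assert (Nv : forall z, in_cD z -> v z <> 0%C).
    { intros z Hz. apply one_plus_neq_0 with (/ 2); auto. lra. }
    assert (Av : disc_algebra v).
    { apply disc_algebra_plus; [apply disc_algebra_const|].
      apply disc_algebra_mult; auto. apply disc_algebra_const. }
    exists (fun z => / v z * r z)%C. split; [split|].
    + apply disc_algebra_mult; auto. apply disc_algebra_inv; auto.
    + apply in_ideal_ext with (fun z => / v z * ((u - z) * r z - 1))%C.
      * intros z Hz. specialize (Nv z Hz). unfold v in *. field. exact Nv.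
      * apply (in_ideal_mult (fun z => / v z)%C); auto. apply disc_algebra_inv; auto.
    + intros z Hz. rewrite Cmod_mult, Cmod_inv by auto.
      rewrite Rinv_inv. pose proof (Cmod_one_plus_ge _ _ (Bv z Hz)) as G.
      fold (v z) in G. change (1 + (lam - u) * r z)%C with (v z) in G.
      apply Rmult_le_compat; [left; apply Rinv_0_lt_compat; lra|apply Cmod_ge_0| |auto].
      replace 2 with (/ (/ 2)) by field. apply Rinv_le_contravar; lra.
  - exists (/ d). split; [apply Rinv_0_lt_compat; auto|]. intros lam Hl. apply H; auto.
Qed.
End Ideal.

(** * Emptiness of the spectrum by averaging resolvents *)

Section Gelfand.
Variables f1 f2 : C -> C.
Hypothesis A1 : disc_algebra f1.
Hypothesis A2 : disc_algebra f2.
Variables (B : R) (Rs : C -> C -> C).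
Hypothesis B_pos : 0 < B.
Hypothesis Rs_resolvent : forall lam, Cmod lam <= 2 -> resolvent f1 f2 lam (Rs lam).
Hypothesis Rs_bound : forall lam, Cmod lam <= 2 -> forall z, in_cD z -> Cmod (Rs lam z) <= B.

Let J := in_ideal f1 f2.
Let Q := qnorm_le f1 f2.

(** The inverse root is used so that [z] divided by the node is [z * unity_root n j / rho], the
    ratio of the geometric sums. *)
Definition node (rho : R) (n j : nat) : C := (RtoC rho * / unity_root n j)%C.

Lemma unity_root_neq_0 n j : unity_root n j <> 0%C.
Proof. apply cis_neq_0. Qed.

Lemma Cmod_node rho n j : 0 <= rho -> Cmod (node rho n j) = rho.
Proof.
  intro H. unfold node. rewrite Cmod_mult, Cmod_inv, Cmod_R, Rabs_pos_eq by
    (auto; apply unity_root_neq_0).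
  unfold unity_root. rewrite Cmod_cis. field.
Qed.

(* Equals [(1 - z^n / rho^n)^-1] modulo the ideal. *)
Definition mean_resolvent (rho : R) (n : nat) (z : C) : C :=
  (/ RtoC (INR n) * csum (fun j => node rho n j * Rs (node rho n j) z) n)%C.

Lemma INR_C_neq_0 n : (0 < n)%nat -> RtoC (INR n) <> 0%C.
Proof. intros Hn X. apply RtoC_inj in X. apply (not_0_INR n); auto. lia. Qed.

(** With [y = z / node], multiply [(node - z) R - 1] by the sum of [y^k] for [k < n]. The factor
    [1 - y^n = 1 - z^n / rho^n] does not depend on the node, and the geometric sums have mean 1 over
    all nodes. *)
Lemma mean_resolvent_inverse rho n : 0 < rho <= 2 -> (0 < n)%nat ->
  J (fun z => (1 - / RtoC (rho ^ n) * z ^ n) * mean_resolvent rho n z - 1)%C.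
Proof.
  intros Hrho Hn.
  assert (Nrho : RtoC rho <> 0%C) by (intro X; apply RtoC_inj in X; lra).
  set (y := fun j z => (/ RtoC rho * z * unity_root n j)%C).
  assert (Jj : forall j, J (fun z => csum (fun k => y j z ^ k)%C n
     * (/ node rho n j * node rho n j * ((node rho n j - z) * Rs (node rho n j) z - 1)))%C).
  { intro j. apply (in_ideal_mult f1 f2 (fun z => csum (fun k => y j z ^ k)%C n)).
    - apply (disc_algebra_csum (fun k z => y j z ^ k)%C). intro k.
      apply (disc_algebra_pow (y j)). apply disc_algebra_mult; [|apply disc_algebra_const].
      apply disc_algebra_mult; [apply disc_algebra_const|apply disc_algebra_id].
    - apply in_ideal_scal, Rs_resolvent. rewrite Cmod_node; lra. }
  pose proof (in_ideal_scal f1 f2 (/ RtoC (INR n)) _ (in_ideal_csum f1 f2 _ n Jj)) as H.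
  eapply in_ideal_ext; [|exact H]. clear H Jj. intros z Hz. cbv beta.
  pose proof (INR_C_neq_0 n Hn) as Nn.
  assert (E : forall j, (csum (fun k => y j z ^ k) n *
    (/ node rho n j * node rho n j * ((node rho n j - z) * Rs (node rho n j) z - 1))
    = (1 - / RtoC (rho ^ n) * z ^ n) * (node rho n j * Rs (node rho n j) z)
      + (-(1)) * csum (fun k => (/ RtoC rho * z * unity_root n j) ^ k) n)%C).
  { intro j. pose proof (csum_geom (y j z) n) as G.
    assert (Yn : (y j z ^ n = / RtoC (rho ^ n) * z ^ n)%C).
    { unfold y. rewrite !Cpow_mult_l, unity_root_pow, Cpow_inv, RtoC_pow by auto. ring. }
    rewrite Yn in G. rewrite <- G. clear G Yn.
    change (csum (fun k => (/ RtoC rho * z * unity_root n j) ^ k)%C n)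
      with (csum (fun k => y j z ^ k)%C n).
    set (s := csum (fun k => y j z ^ k)%C n).
    assert (Ny : (node rho n j - z = (1 - y j z) * node rho n j)%C).
    { unfold node, y. field. split; auto. apply unity_root_neq_0. }
    assert (Nn0 : node rho n j <> 0%C).
    { intro X. pose proof (Cmod_node rho n j ltac:(lra)) as M. rewrite X, Cmod_0 in M. lra. }
    rewrite Ny. field. exact Nn0. }
  rewrite (csum_ext _ _ n (fun k _ => E k)), csum_plus, !csum_scal.
  rewrite unity_root_geom_sum by auto. unfold mean_resolvent. field.
  split; auto. intro X. apply RtoC_inj in X. apply (pow_nonzero rho n); lra.
Qed.

Lemma disc_algebra_mean_resolvent rho n : 0 <= rho <= 2 ->
  disc_algebra (mean_resolvent rho n).
Proof.
  intro H. apply disc_algebra_mult; [apply disc_algebra_const|].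
  apply (disc_algebra_csum (fun j z => node rho n j * Rs (node rho n j) z)%C).
  intro j. apply disc_algebra_mult; [apply disc_algebra_const|].
  apply Rs_resolvent. rewrite Cmod_node; lra.
Qed.

Lemma Cmod_inv_INR n : (0 < n)%nat -> Cmod (/ RtoC (INR n)) = / INR n.
Proof.
  intro Hn. rewrite Cmod_inv by (apply INR_C_neq_0; auto).
  rewrite Cmod_R, Rabs_pos_eq by apply pos_INR. auto.
Qed.

Lemma mean_resolvent_bound rho n z : 0 <= rho <= 2 -> (0 < n)%nat -> in_cD z ->
  Cmod (mean_resolvent rho n z) <= rho * B.
Proof.
  intros H Hn Hz. unfold mean_resolvent. rewrite Cmod_mult, Cmod_inv_INR by auto.
  assert (0 < INR n) by (apply lt_0_INR; auto).
  apply Rmult_le_reg_l with (INR n); auto. rewrite <- Rmult_assoc, Rinv_r, Rmult_1_l by lra.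
  apply csum_bound. intro k. rewrite Cmod_mult, Cmod_node by lra.
  apply Rmult_le_compat_l; [lra|]. apply Rs_bound; auto. rewrite Cmod_node; lra.
Qed.

(* The resolvent identity [l R_l - m R_m = z (m - l) R_l R_m]. *)
Lemma mean_resolvent_lipschitz rho rho' n :
  0 <= rho <= 2 -> 0 <= rho' <= 2 -> (0 < n)%nat ->
  Q (fun z => mean_resolvent rho' n z - mean_resolvent rho n z)%C (Rabs (rho - rho') * B ^ 2).
Proof.
  intros H H' Hn.
  assert (0 < INR n) by (apply lt_0_INR; auto).
  set (F := fun j z => (node rho' n j * Rs (node rho' n j) z
    + - (1) * (node rho n j * Rs (node rho n j) z))%C).
  apply qnorm_le_ext with (fun z => / RtoC (INR n) * csum (fun j => F j z) n)%C.
  { intros z Hz. unfold F. rewrite csum_plus, csum_scal. unfold mean_resolvent. ring. }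
  replace (Rabs (rho - rho') * B ^ 2)
    with (Cmod (/ RtoC (INR n)) * (INR n * (Rabs (rho - rho') * B ^ 2)))
    by (rewrite Cmod_inv_INR by auto; field; lra).
  apply (qnorm_le_scal f1 f2 A1 A2 (/ RtoC (INR n))%C (fun z => csum (fun j => F j z) n)).
  apply qnorm_le_csum. intro j. unfold F.
  set (l := node rho' n j). set (m := node rho n j).
  assert (Hl : Cmod l <= 2) by (unfold l; rewrite Cmod_node; lra).
  assert (Hm : Cmod m <= 2) by (unfold m; rewrite Cmod_node; lra).
  destruct (Rs_resolvent l Hl) as [Al Jl]. destruct (Rs_resolvent m Hm) as [Am Jm].
  apply qnorm_le_congr with (fun z => (m - l) * (z * (Rs l z * Rs m z)))%C.
  - apply in_ideal_ext with
      (fun z => m * (Rs m z * ((l - z) * Rs l z - 1)) + - l * (Rs l z * ((m - z) * Rs m z - 1)))%C.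
    { intros z Hz. ring. }
    apply in_ideal_plus; apply in_ideal_scal.
    + apply (in_ideal_mult f1 f2 (Rs m)); auto.
    + apply (in_ideal_mult f1 f2 (Rs l)); auto.
  - apply qnorm_le_bound.
    + apply disc_algebra_mult; [apply disc_algebra_const|].
      apply disc_algebra_mult; [apply disc_algebra_id|]. apply disc_algebra_mult; auto.
    + intros z Hz. rewrite !Cmod_mult.
      assert (E : Cmod (m - l) = Rabs (rho - rho')).
      { unfold m, l, node.
        replace (RtoC rho * / unity_root n j - RtoC rho' * / unity_root n j)%C
          with (node (rho - rho') n j) by (unfold node; rewrite RtoC_minus; ring).
        unfold node. rewrite Cmod_mult, Cmod_inv, Cmod_R by apply unity_root_neq_0.
        unfold unity_root. rewrite Cmod_cis. field. }
      rewrite E. apply Rmult_le_compat_l; [apply Rabs_pos|].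
      pose proof (Rs_bound l Hl z Hz). pose proof (Rs_bound m Hm z Hz).
      pose proof (Cmod_ge_0 (Rs l z)). pose proof (Cmod_ge_0 (Rs m z)).
      unfold in_cD in Hz. pose proof (Cmod_ge_0 z).
      assert (Cmod (Rs l z) * Cmod (Rs m z) <= B * B) by (apply Rmult_le_compat; auto).
      assert (0 <= Cmod (Rs l z) * Cmod (Rs m z)) by (apply Rmult_le_pos; auto).
      simpl. nra.
Qed.

(* The spectral radius of [z] modulo the ideal is less than [rho]. *)
Definition spectral_lt (rho : R) : Prop :=
  exists n0, forall n, (n0 <= n)%nat -> Q (fun z => z ^ n)%C (rho ^ n / 2).

(** By submultiplicativity each further block of [n0] factors gains another [1/2], so the ratio to
    [rho ^ n] tends to 0. *)
Lemma spectral_lt_geometric rho eps : 0 < rho -> 0 < eps -> spectral_lt rho ->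
  exists n0, forall n, (n0 <= n)%nat -> Q (fun z => z ^ n)%C (eps * rho ^ n).
Proof.
  intros Hrho He [n0 H].
  assert (K : forall k n, (S k * n0 <= n)%nat -> Q (fun z => z ^ n)%C (rho ^ n * (1 / 2) ^ S k)).
  { induction k; intros n Hn.
    - simpl. replace (rho ^ n * (1 / 2 * 1)) with (rho ^ n / 2) by field. apply H. lia.
    - apply qnorm_le_ext with (fun z => z ^ n0 * z ^ (n - n0))%C.
      + intros z _. rewrite <- Cpow_add_r. f_equal. lia.
      + replace (rho ^ n * (1 / 2) ^ S (S k))
          with ((rho ^ n0 / 2) * (rho ^ (n - n0) * (1 / 2) ^ S k)).
        * apply (qnorm_le_mult f1 f2 A1 A2 (fun z => z ^ n0)%C (fun z => z ^ (n - n0))%C);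
            [apply H; lia|apply IHk; lia].
        * replace n with (n0 + (n - n0))%nat at 2 by lia. rewrite pow_add. simpl. field. }
  destruct (pow_lt_1_zero (1 / 2) ltac:(rewrite Rabs_pos_eq; lra) eps He) as [k Hk].
  exists (S k * n0)%nat. intros n Hn.
  apply qnorm_le_weaken with (rho ^ n * (1 / 2) ^ S k); [|apply K; auto].
  specialize (Hk (S k) ltac:(lia)). rewrite Rabs_pos_eq in Hk by (apply pow_le; lra).
  assert (0 < rho ^ n) by (apply pow_lt; auto). nra.
Qed.

(** Modulo the ideal the mean minus 1 is [z^n / rho^n] times the mean. The first factor has seminorm
    at most [1 / (12 B)], the second at most [rho B <= 2 B]; hence [1/6]. *)
Lemma mean_resolvent_near_1 rho : 0 < rho <= 2 -> spectral_lt rho ->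
  exists n0, forall n, (n0 <= n)%nat -> (0 < n)%nat ->
    Q (fun z => mean_resolvent rho n z - 1)%C (1 / 6).
Proof.
  intros Hrho Sp.
  destruct (spectral_lt_geometric rho (/ (12 * B)) ltac:(lra)
    ltac:(apply Rinv_0_lt_compat; lra) Sp) as [n0 H].
  exists n0. intros n Hn Hn0. specialize (H n Hn).
  assert (Prho : 0 < rho ^ n) by (apply pow_lt; lra).
  apply qnorm_le_congr
    with (fun z => (/ RtoC (rho ^ n) * z ^ n) * mean_resolvent rho n z)%C.
  - eapply in_ideal_ext; [|apply (mean_resolvent_inverse rho n); auto].
    intros z Hz. cbv beta. ring.
  - apply qnorm_le_weaken with
      ((Cmod (/ RtoC (rho ^ n)) * (/ (12 * B) * rho ^ n)) * (rho * B)).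
    + rewrite <- RtoC_inv, Cmod_R, Rabs_pos_eq
        by (try (left; apply Rinv_0_lt_compat); lra).
      replace (/ rho ^ n * (/ (12 * B) * rho ^ n) * (rho * B)) with (rho / 12) by (field; lra).
      lra.
    + apply (qnorm_le_mult f1 f2 A1 A2 (fun z => / RtoC (rho ^ n) * z ^ n)%C).
      * apply (qnorm_le_scal f1 f2); auto.
      * apply qnorm_le_bound. apply disc_algebra_mean_resolvent; lra.
        intros z Hz. apply mean_resolvent_bound; auto. lra.
Qed.

(** The mean at [rho'] is within [1/6 + 1/6] of 1, hence congruent to [1 + v] with [Cmod v <= 1/3].
    Inverting, [z^n / rho'^n] is congruent to [v / (1 + v)], of modulus at most
    [(1/3) / (2/3) = 1/2]. The admissible step depends on [B] alone. *)
Lemma spectral_lt_step rho rho' :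
  0 < rho <= 2 -> 0 < rho' <= 2 -> Rabs (rho - rho') * B ^ 2 <= 1 / 6 ->
  spectral_lt rho -> spectral_lt rho'.
Proof.
  intros Hrho Hrho' Hd Sp.
  destruct (mean_resolvent_near_1 rho Hrho Sp) as [n0 H].
  exists (S n0). intros n Hn.
  assert (Prho : 0 < rho' ^ n) by (apply pow_lt; lra).
  assert (Nrho : RtoC (rho' ^ n) <> 0%C) by (intro X; apply RtoC_inj in X; lra).
  assert (K : Q (fun z => mean_resolvent rho' n z - 1)%C (1 / 3)).
  { apply qnorm_le_weaken with (Rabs (rho - rho') * B ^ 2 + 1 / 6); [lra|].
    apply qnorm_le_ext with (fun z => (mean_resolvent rho' n z - mean_resolvent rho n z)
      + (mean_resolvent rho n z - 1))%C. intros; ring.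
    apply (qnorm_le_plus f1 f2
      (fun z => mean_resolvent rho' n z - mean_resolvent rho n z)%C).
    apply mean_resolvent_lipschitz; lra || lia. apply H; lia. }
  destruct K as [v [Av [Jv Bv]]].
  assert (Nv : forall z, in_cD z -> (1 + v z)%C <> 0%C).
  { intros z Hz. apply one_plus_neq_0 with (1 / 3); auto. lra. }
  assert (Ai : disc_algebra (fun z => / (1 + v z))%C).
  { apply disc_algebra_inv; auto. apply disc_algebra_plus; auto. apply disc_algebra_const. }
  apply qnorm_le_ext with (fun z => RtoC (rho' ^ n) * (/ RtoC (rho' ^ n) * z ^ n))%C.
  { intros z _. field. exact Nrho. }
  replace (rho' ^ n / 2) with (Cmod (RtoC (rho' ^ n)) * (1 / 2))
    by (rewrite Cmod_R, Rabs_pos_eq by lra; field).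
  apply (qnorm_le_scal f1 f2 A1 A2 (RtoC (rho' ^ n)) (fun z => / RtoC (rho' ^ n) * z ^ n)%C).
  apply qnorm_le_congr with (fun z => v z * / (1 + v z))%C.
  - apply in_ideal_ext with (fun z => / (1 + v z) *
      (- (1) * ((1 - / RtoC (rho' ^ n) * z ^ n) * mean_resolvent rho' n z - 1)
       + (1 + - / RtoC (rho' ^ n) * z ^ n) * (mean_resolvent rho' n z - 1 - v z)))%C.
    + intros z Hz. field. split; auto.
    + apply (in_ideal_mult f1 f2 (fun z => / (1 + v z))%C); auto.
      apply in_ideal_plus.
      * apply in_ideal_scal. apply mean_resolvent_inverse; auto. lia.
      * apply (in_ideal_mult f1 f2 (fun z => 1 + - / RtoC (rho' ^ n) * z ^ n)%C); auto.
        apply disc_algebra_plus; [apply disc_algebra_const|].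
        apply disc_algebra_mult; [apply disc_algebra_const|].
        apply disc_algebra_pow, disc_algebra_id.
  - apply qnorm_le_bound. apply disc_algebra_mult; auto.
    intros z Hz. rewrite Cmod_mult, Cmod_inv by auto.
    pose proof (Bv z Hz) as B1. pose proof (Cmod_one_plus_ge _ _ B1) as B2.
    replace (1 / 2) with (1 / 3 * / (2 / 3)) by field.
    apply Rmult_le_compat; auto. apply Cmod_ge_0.
    left; apply Rinv_0_lt_compat; lra. apply Rinv_le_contravar; lra.
Qed.

(** Descent from radius 2 reaches a radius [eta] so small that the mean itself has seminorm at most
    [1/6]; being also within [1/6] of 1, it forces the seminorm of 1 below 1. *)
Lemma in_ideal_1_of_resolvents : J (fun _ => 1%C).
Proof.
  (* With [eta = 2 / k], this [k] ensures both [eta B^2 <= 1/6], needed for each step, and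
     [eta B <= 1/6], needed at the end. *)
  destruct (INR_unbounded (12 * (B ^ 2 + B) + 1)) as [k Hk].
  assert (HB2 : 0 <= B ^ 2) by (apply pow_le; lra).
  assert (Hk0 : 0 < INR k) by lra.
  set (eta := 2 / INR k).
  assert (Heta : 0 < eta) by (apply Rdiv_lt_0_compat; lra).
  assert (Ek : eta * INR k = 2) by (unfold eta; field; lra).
  (* On the closed disc [Cmod (z^n) <= 1 <= 2^n / 2] as soon as [n >= 1]. *)
  assert (S2 : spectral_lt 2).
  { exists 1%nat. intros n Hn. apply qnorm_le_bound.
    apply disc_algebra_pow, disc_algebra_id.
    intros z Hz. rewrite Cmod_pow. apply Rle_trans with 1.
    - rewrite <- (pow1 n). apply pow_incr. split; [apply Cmod_ge_0|exact Hz].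
    - destruct n; [lia|]. simpl. pose proof (pow_R1_Rle 2 n ltac:(lra)). lra. }
  assert (Desc : forall j, (j < k)%nat -> spectral_lt (2 - INR j * eta)).
  { induction j; intro Hj.
    - simpl. rewrite Rmult_0_l, Rminus_0_r. exact S2.
    - assert (H1 : INR (S j) + 1 <= INR k).
      { rewrite <- S_INR. apply le_INR. lia. }
      pose proof (pos_INR j). rewrite S_INR in *.
      apply spectral_lt_step with (2 - INR j * eta); [| | |apply IHj; lia].
      + split; nra.
      + split; nra.
      + replace (2 - INR j * eta - (2 - (INR j + 1) * eta)) with eta by ring.
        rewrite Rabs_pos_eq by lra.
        apply Rmult_le_reg_r with (INR k); auto.
        replace (eta * B ^ 2 * INR k) with (eta * INR k * B ^ 2) by ring. rewrite Ek. lra. }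
  destruct k as [|k]; [simpl in Hk0; lra|].
  specialize (Desc k ltac:(lia)).
  replace (2 - INR k * eta) with eta in Desc by (rewrite S_INR in Ek; lra).
  assert (Hk1 : 1 <= INR (S k)) by (rewrite S_INR; pose proof (pos_INR k); lra).
  assert (H2 : eta <= 2) by nra.
  destruct (mean_resolvent_near_1 eta ltac:(lra) Desc) as [n0 H].
  specialize (H (S n0) ltac:(lia) ltac:(lia)).
  apply (qnorm_lt_1_unit f1 f2) with (1 / 3); [lra|].
  apply qnorm_le_ext with (fun z => mean_resolvent eta (S n0) z
    + - (1) * (mean_resolvent eta (S n0) z - 1))%C. intros; ring.
  apply qnorm_le_weaken with (1 / 6 + Cmod (- (1)) * (1 / 6)); [rewrite Cmod_m1; lra|].
  apply (qnorm_le_plus f1 f2).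
  - apply qnorm_le_weaken with (eta * B).
    + apply Rmult_le_reg_r with (INR (S k)); auto.
      replace (eta * B * INR (S k)) with (eta * INR (S k) * B) by ring. rewrite Ek. lra.
    + apply qnorm_le_bound. apply disc_algebra_mean_resolvent; lra.
      intros z Hz. apply mean_resolvent_bound; auto. lra. lia.
  - apply (qnorm_le_scal f1 f2 A1 A2 (- (1))%C (fun z => mean_resolvent eta (S n0) z - 1)%C). exact H.
Qed.
End Gelfand.

Lemma disc_algebra_bezout f1 f2 :
  disc_algebra f1 -> disc_algebra f2 ->
  (forall z, in_cD z -> f1 z <> 0%C \/ f2 z <> 0%C) ->
  exists a b, disc_algebra a /\ disc_algebra b /\
    forall z, in_cD z -> (a z * f1 z + b z * f2 z = 1)%C.
Proof.
  intros A1 A2 N.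
  destruct (resolvent_bounded f1 f2 A1 A2 N 2) as [B [HB H]].
  assert (H' : forall lam, {r | Cmod lam <= 2 ->
    resolvent f1 f2 lam r /\ forall z, in_cD z -> Cmod (r z) <= B}).
  { intro lam. apply constructive_indefinite_description.
    destruct (classic (Cmod lam <= 2)) as [L|L].
    - destruct (H lam L) as [r Hr]. exists r; auto.
    - exists (fun _ => 0%C). intro; contradiction. }
  destruct (in_ideal_1_of_resolvents f1 f2 A1 A2 B (fun lam => proj1_sig (H' lam)) HB)
    as [a [b [Ha [Hb E]]]].
  - intros lam L. destruct (H' lam) as [r Hr]. apply Hr; auto.
  - intros lam L. destruct (H' lam) as [r Hr]. apply Hr; auto.
  - exists a, b. repeat split; try apply Ha; try apply Hb. intros z Hz. rewrite <- E; auto.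
Qed.

Lemma real_disc_algebra_bezout f1 f2 :
  real_disc_algebra f1 -> real_disc_algebra f2 ->
  (forall z, in_cD z -> f1 z <> 0%C \/ f2 z <> 0%C) ->
  exists a b, real_disc_algebra a /\ real_disc_algebra b /\
    forall z, in_cD z -> (a z * f1 z + b z * f2 z = 1)%C.
Proof.
  intros [A1 S1] [A2 S2] N.
  destruct (disc_algebra_bezout f1 f2 A1 A2 N) as [a [b [Ha [Hb E]]]].
  do 2 eexists. split; [apply (real_disc_algebra_sym a Ha)|].
  split; [apply (real_disc_algebra_sym b Hb)|].
  intros z Hz. cbv beta.
  pose proof (E z Hz) as E1. pose proof (f_equal Cconj (E _ (in_cD_conj z Hz))) as E2.
  rewrite Cconj_plus, !Cconj_mult, <- S1, <- S2, Cconj_RtoC in E2 by auto.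
  transitivity (RtoC (/ 2) * ((a z * f1 z + b z * f2 z)
    + (Cconj (a (Cconj z)) * f1 z + Cconj (b (Cconj z)) * f2 z)))%C; [ring|].
  rewrite E1, E2, RtoC_inv by lra. field.
Qed.

(** * Lifting units modulo [f2] *)

Section PolynomialMean.
Variables (n : nat) (u : C) (s : R).
Hypothesis n_pos : (0 < n)%nat.
Let h j := (RtoC s * unity_root n j)%C.

(** The weight is there for the induction: a Horner step multiplies by [u + h j] and so produces
    exponents [m] and [m + 1]. The bound on [m + length l] keeps every exponent strictly between 0
    and [n], where the power sums vanish. *)
Lemma peval_mean_weighted l m : (0 < m)%nat -> (m + length l <= n)%nat ->
  csum (fun j => h j ^ m * peval l (u + h j))%C n = 0%C.
Proof.
  revert m. induction l as [|c l IH]; intros m Hm Hl; simpl in *.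
  - rewrite (csum_ext _ (fun _ => 0%C)) by (intros; ring). rewrite csum_const. ring.
  - rewrite (csum_ext _ (fun j => c * (RtoC s ^ m * unity_root n j ^ m)
       + (u * (h j ^ m * peval l (u + h j)) + h j ^ S m * peval l (u + h j)))%C).
    + rewrite !csum_plus, !csum_scal, !IH, unity_root_sum by lia. ring.
    + intros j _. rewrite <- Cpow_mult_l. fold (h j). simpl. ring.
Qed.

Lemma peval_mean l : (length l <= n)%nat ->
  csum (fun j => peval l (u + h j)) n = (RtoC (INR n) * peval l u)%C.
Proof.
  induction l as [|c l IH]; intro Hl; simpl in *.
  - rewrite csum_const. ring.
  - rewrite (csum_ext _ (fun j => c + (u * peval l (u + h j)
       + h j ^ 1 * peval l (u + h j)))%C) by (intros; simpl; ring).
    rewrite !csum_plus, csum_scal, csum_const, IH, peval_mean_weighted by lia. ring.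
Qed.
End PolynomialMean.

Lemma csum_bound_linear f g K x y n :
  (forall j, Cmod (f j) <= K + x * Re (g j) + y * Im (g j)) ->
  Cmod (csum f n) <= INR n * K + x * Re (csum g n) + y * Im (csum g n).
Proof.
  intro H. induction n; simpl csum.
  - rewrite Cmod_0. simpl. lra.
  - rewrite S_INR. eapply Rle_trans; [apply Cmod_triangle|]. specialize (H n).
    unfold Re, Im in *. simpl. lra.
Qed.

(* [|p| + eps |z|^2] is strictly subharmonic. *)
Lemma peval_sq_no_local_max l u s eps :
  0 < s -> 0 < eps ->
  exists z, Cmod (z - u) = s /\
    Cmod (peval l u) + eps * Cmod u ^ 2 < Cmod (peval l z) + eps * Cmod z ^ 2.
Proof.
  (* Enough points for the exact mean value property of [peval l], and at least two, so that the
     [h j] sum to 0. *)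
  intros Hs He. remember (2 + length l)%nat as n eqn:Hn2.
  assert (Hn : (0 < n)%nat) by lia.
  set (h := fun j => (RtoC s * unity_root n j)%C).
  assert (Mh : forall j, Cmod (h j) = s).
  { intro j. unfold h. rewrite Cmod_mult, Cmod_R, Rabs_pos_eq by lra.
    unfold unity_root. rewrite Cmod_cis. ring. }
  apply NNPP. intro N.
  (* Expanding the square modulus leaves terms linear in [h j], which vanish on summation, and the
     constant [- eps * s ^ 2], which contradicts the mean value property. *)
  assert (H : forall j, Cmod (peval l (u + h j)) <=
    (Cmod (peval l u) - eps * s ^ 2) + (- 2 * eps * Re u) * Re (h j)
      + (- 2 * eps * Im u) * Im (h j)).
  { intro j. destruct (Rle_or_lt (Cmod (peval l (u + h j)) + eps * Cmod (u + h j) ^ 2)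
      (Cmod (peval l u) + eps * Cmod u ^ 2)) as [L|L].
    - assert (E : Cmod (u + h j) ^ 2 = Cmod u ^ 2 + s ^ 2 + 2 * Re u * Re (h j)
        + 2 * Im u * Im (h j)).
      { rewrite <- (Mh j), !Cmod2_alt. unfold Re, Im; simpl. ring. }
      rewrite E in L. lra.
    - exfalso. apply N. exists (u + h j)%C. split; auto.
      replace (u + h j - u)%C with (h j) by ring. apply Mh. }
  apply (csum_bound_linear _ _ _ _ _ n) in H.
  assert (Hh : csum h n = 0%C).
  { unfold h. rewrite csum_scal.
    rewrite (csum_ext _ (fun j => unity_root n j ^ 1)%C) by (intros; simpl; ring).
    rewrite unity_root_sum by lia. ring. }
  unfold h in H at 1. rewrite peval_mean in H by lia.
  rewrite Hh in H. unfold Re, Im in H. simpl in H.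
  rewrite Cmod_mult, Cmod_R, Rabs_pos_eq in H by apply pos_INR.
  assert (0 < INR n) by (apply lt_0_INR; auto).
  assert (0 < eps * s ^ 2) by (apply Rmult_lt_0_compat; [auto|apply pow_lt; auto]).
  simpl in *. nra.
Qed.

(** * Liftable functions and conjugate pairs of roots *)

Section Lift.
Variable f2 : C -> C.
Hypothesis Hf2 : real_disc_algebra f2.

Definition lifts (x : C -> C) : Prop :=
  exists u h, real_disc_algebra u /\ (forall z, in_cD z -> u z <> 0%C) /\
    real_disc_algebra h /\ forall z, in_cD z -> (x z = u z + h z * f2 z)%C.

Lemma lifts_ext x y : (forall z, in_cD z -> x z = y z) -> lifts x -> lifts y.
Proof.
  intros E [u [h [Hu [Nu [Hh H]]]]]. exists u, h.
  split; auto. split; auto. split; auto. intros; rewrite <- E; auto.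
Qed.

Lemma lifts_unit x :
  real_disc_algebra x -> (forall z, in_cD z -> x z <> 0%C) -> lifts x.
Proof.
  intros Hx Nx. exists x, (fun _ => RtoC 0). split; auto. split; auto.
  split; [apply real_disc_algebra_const|]. intros; ring.
Qed.

Lemma lifts_mult x y : lifts x -> lifts y -> lifts (fun z => x z * y z)%C.
Proof.
  intros [u [h [Hu [Nu [Hh H]]]]] [v [k [Hv [Nv [Hk K]]]]].
  exists (fun z => u z * v z)%C, (fun z => u z * k z + h z * (v z + k z * f2 z))%C.
  split; [apply real_disc_algebra_mult; auto|]. split.
  { intros z Hz. apply Cmult_neq_0; auto. }
  split.
  - apply real_disc_algebra_plus; [|apply (real_disc_algebra_mult h (fun z => v z + k z * f2 z)%C); auto;
      apply real_disc_algebra_plus; auto]; apply real_disc_algebra_mult; auto.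
  - intros z Hz. rewrite H, K by auto. ring.
Qed.

Lemma lifts_unit_congr x y e h :
  real_disc_algebra e -> (forall z, in_cD z -> e z <> 0%C) -> real_disc_algebra h ->
  (forall z, in_cD z -> y z = x z * e z + h z * f2 z)%C -> lifts x -> lifts y.
Proof.
  intros He Ne Hh E [u [k [Hu [Nu [Hk H]]]]].
  exists (fun z => u z * e z)%C, (fun z => k z * e z + h z)%C.
  split; [apply real_disc_algebra_mult; auto|]. split.
  { intros z Hz. apply Cmult_neq_0; auto. }
  split.
  - apply real_disc_algebra_plus; auto. apply real_disc_algebra_mult; auto.
  - intros z Hz. rewrite E, H by auto. ring.
Qed.

(** The bound [/ 2] serves twice: it makes [e] a unit, and it makes [Re e] positive, so that [y]
    inherits the sign of [x] at real zeros of [f2]. *)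
Lemma close_unit_congr x : real_disc_algebra x ->
  (forall z, in_cD z -> x z <> 0%C \/ f2 z <> 0%C) ->
  exists eta, 0 < eta /\ forall y, real_disc_algebra y ->
    (forall z, in_cD z -> Cmod (y z - x z) <= eta) ->
    exists e h, real_disc_algebra e /\ (forall z, in_cD z -> Cmod (e z - 1) <= / 2) /\
      real_disc_algebra h /\ (forall z, in_cD z -> y z = x z * e z + h z * f2 z)%C.
Proof.
  intros Hx N. destruct (real_disc_algebra_bezout x f2 Hx Hf2 N) as [a [b [Ha [Hb E]]]].
  destruct (disc_algebra_bounded a (proj1 Ha)) as [M [HM BM]].
  exists (/ (2 * M)). split; [apply Rinv_0_lt_compat; lra|].
  intros y Hy Hd.
  exists (fun z => RtoC 1 + (y z - x z) * a z)%C, (fun z => (y z - x z) * b z)%C.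
  assert (Hyx : real_disc_algebra (fun z => y z - x z)%C)
    by (apply real_disc_algebra_minus; auto).
  split; [|split; [|split]].
  - apply real_disc_algebra_plus; [apply real_disc_algebra_const|].
    apply (real_disc_algebra_mult (fun z => y z - x z)%C); auto.
  - intros z Hz. replace (1 + (y z - x z) * a z - 1)%C with ((y z - x z) * a z)%C by ring.
    rewrite Cmod_mult. replace (/ 2) with (/ (2 * M) * M) by (field; lra).
    apply Rmult_le_compat; auto; apply Cmod_ge_0.
  - apply (real_disc_algebra_mult (fun z => y z - x z)%C); auto.
  - intros z Hz. transitivity (x z + (y z - x z) * (a z * x z + b z * f2 z))%C; [|ring].
    rewrite E by auto. ring.
Qed.

Lemma near_1_neq_0 w : Cmod (w - 1) <= / 2 -> w <> 0%C.
Proof.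
  intros H X. rewrite X in H. replace (0 - 1)%C with (- (1))%C in H by ring.
  rewrite Cmod_m1 in H. lra.
Qed.

Lemma lifts_locally_constant x : real_disc_algebra x ->
  (forall z, in_cD z -> x z <> 0%C \/ f2 z <> 0%C) ->
  exists eta, 0 < eta /\ forall y, real_disc_algebra y ->
    (forall z, in_cD z -> Cmod (y z - x z) <= eta) -> (lifts x <-> lifts y).
Proof.
  intros Hx N. destruct (close_unit_congr x Hx N) as [eta [Heta H]].
  exists eta. split; auto. intros y Hy Hd.
  destruct (H y Hy Hd) as [e [h [He [Be [Hh E]]]]].
  assert (Ne : forall z, in_cD z -> e z <> 0%C) by (intros; apply near_1_neq_0; auto).
  split.
  - apply lifts_unit_congr with e h; auto.
  - apply lifts_unit_congr with (fun z => / e z)%C (fun z => - h z * / e z)%C; auto.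
    + apply real_disc_algebra_inv; auto.
    + intros z Hz X. pose proof (Cinv_r (e z) (Ne z Hz)) as Y.
      rewrite X, Cmult_0_r in Y. apply C1_nz. auto.
    + apply real_disc_algebra_mult; [apply real_disc_algebra_opp; auto|].
      apply real_disc_algebra_inv; auto.
    + intros z Hz. rewrite E by auto. field. auto.
Qed.

(** Real [v] is allowed and gives the square of [z - v], the degenerate pair from which two real
    roots are later separated. *)
Definition quad (v z : C) : C := ((z - v) * (z - Cconj v))%C.

Lemma real_disc_algebra_quad v : real_disc_algebra (quad v).
Proof.
  split.
  - apply disc_algebra_mult; apply disc_algebra_minus;
      (apply disc_algebra_id || apply disc_algebra_const).
  - intros z Hz. unfold quad. rewrite Cconj_mult, !Cconj_minus, !Cconj_conj. ring.
Qed.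

Lemma quad_no_common_zero v : (in_cD v -> f2 v <> 0%C) ->
  forall z, in_cD z -> quad v z <> 0%C \/ f2 z <> 0%C.
Proof.
  intros Hv z Hz. destruct (classic (z = v)) as [-> | N1]; [right; auto|].
  destruct (classic (z = Cconj v)) as [-> | N2].
  - right. intro X. apply Hv. rewrite <- (Cconj_conj v). apply in_cD_conj; auto.
    pose proof (proj2 Hf2 _ Hz) as S. rewrite Cconj_conj, X in S.
    rewrite <- (Cconj_conj (f2 v)), <- S. apply Cconj_RtoC.
  - left. apply Cmult_neq_0; apply Csub_neq_0; auto.
Qed.

Lemma lifts_quad_locally_constant v : (in_cD v -> f2 v <> 0%C) ->
  exists r, 0 < r /\ forall w, Cmod (w - v) < r -> (lifts (quad v) <-> lifts (quad w)).
Proof.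
  intro Hv.
  destruct (lifts_locally_constant (quad v) (real_disc_algebra_quad v)
    (quad_no_common_zero v Hv)) as [eta [Heta H]].
  (* The sum of the bounds [1 + (Cmod v + 1)] and [1 + Cmod v] for the two factors that remain when
     one root at a time is moved. *)
  set (K := 3 + 2 * Cmod v). pose proof (Cmod_ge_0 v) as Hv0.
  assert (HK : 0 < K) by (unfold K; lra).
  exists (Rmin 1 (eta / K)). split.
  { apply Rmin_pos; [lra|]. apply Rdiv_lt_0_compat; auto. }
  intros w Hw. apply H; [apply real_disc_algebra_quad|]. intros z Hz.
  assert (W1 := Rlt_le_trans _ _ _ Hw (Rmin_l _ _)).
  assert (W2 := Rlt_le_trans _ _ _ Hw (Rmin_r _ _)).
  assert (Cw : Cmod w <= Cmod v + 1) by (pose proof (Cmod_sub_le w v); lra).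
  unfold quad.
  replace ((z - w) * (z - Cconj w) - (z - v) * (z - Cconj v))%C
    with ((z - w) * (- Cconj (w - v)) + (- (w - v)) * (z - Cconj v))%C
    by (rewrite Cconj_minus; ring).
  eapply Rle_trans; [apply Cmod_triangle|]. rewrite !Cmod_mult, !Cmod_opp, Cmod_conj.
  unfold in_cD in Hz.
  assert (B1 : Cmod (z - w) <= 1 + (Cmod v + 1)).
  { unfold Cminus. eapply Rle_trans; [apply Cmod_triangle|]. rewrite Cmod_opp. lra. }
  assert (B2 : Cmod (z - Cconj v) <= 1 + Cmod v).
  { unfold Cminus. eapply Rle_trans; [apply Cmod_triangle|]. rewrite Cmod_opp, Cmod_conj. lra. }
  pose proof (Cmod_ge_0 (w - v)) as Pw.
  assert (eta / K * K = eta) by (field; lra).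
  apply Rle_trans with (Cmod (w - v) * K); [unfold K; nra|nra].
Qed.

Lemma lifts_quad_outside v : ~ in_cD v -> lifts (quad v).
Proof.
  intro N. apply lifts_unit; [apply real_disc_algebra_quad|]. intros z Hz.
  apply Cmult_neq_0; apply Csub_neq_0.
  - intros ->; auto.
  - intros ->. apply N. rewrite <- (Cconj_conj v). apply in_cD_conj; auto.
Qed.

(* The set of [v] outside the zeros of [f2] for which [quad v] does not lift is open, and its
   boundary consists of zeros of [f2]; the maximum principle shows that it is empty. *)
Lemma lifts_quad a : in_cD a -> f2 a <> 0%C -> lifts (quad a).
Proof.
  intros Ha Na. apply NNPP. intro La.
  set (Bad := fun v => in_cD v /\ f2 v <> 0%C /\ ~ lifts (quad v)).
  (* At [a] the function [F] below exceeds [4 eps]; at zeros of [f2] it is at most [2 eps], hence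
     less than [3 eps] nearby. The supremum over bad points thus stays away from the zeros of
     [f2]. *)
  set (eps := Cmod (f2 a) / 5).
  assert (Heps : 0 < eps) by (pose proof (proj1 (Cmod_gt_0 _) Na); unfold eps; lra).
  destruct (disc_algebra_poly_dense f2 eps (proj1 Hf2) Heps) as [l Hl].
  set (F := fun z => Cmod (peval l z) + eps * Cmod z ^ 2).
  assert (Fcont : forall u, in_cD u -> forall e, 0 < e -> exists d, 0 < d /\
    forall z, in_cD z -> Cmod (z - u) < d -> F z < F u + e).
  { intros u Hu e He.
    pose proof (proj1 (disc_algebra_iff _) (disc_algebra_peval l)) as [Cl _].
    destruct (Cl u Hu (e / 2) ltac:(lra)) as [d [Hd H]].
    assert (Hd' : 0 < e / (4 * eps)) by (apply Rdiv_lt_0_compat; lra).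
    exists (Rmin d (e / (4 * eps))). split; [apply Rmin_pos; auto|].
    intros z Hz Hzu. specialize (H z Hz (Rlt_le_trans _ _ _ Hzu (Rmin_l _ _))).
    assert (W2 := Rlt_le_trans _ _ _ Hzu (Rmin_r _ _)).
    pose proof (Cmod_sub_le (peval l z) (peval l u)).
    pose proof (Cmod_sub_le z u). pose proof (Cmod_ge_0 z). pose proof (Cmod_ge_0 u).
    unfold in_cD in *. unfold F.
    assert (eps * (Cmod z ^ 2 - Cmod u ^ 2) < e / 2).
    { replace (Cmod z ^ 2 - Cmod u ^ 2) with ((Cmod z - Cmod u) * (Cmod z + Cmod u)) by ring.
      assert (e / (4 * eps) * eps = e / 4) by (field; lra).
      assert ((Cmod z - Cmod u) * (Cmod z + Cmod u) <= Cmod (z - u) * 2).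
      { pose proof (Cmod_ge_0 (z - u)). destruct (Rle_or_lt (Cmod z) (Cmod u)); nra. }
      nra. }
    lra. }
  destruct (disc_algebra_bounded _ (disc_algebra_peval l)) as [K [HK BK]].
  destruct (completeness (fun y => exists v, Bad v /\ y = F v)) as [M [M1 M2]].
  { exists (K + eps). intros y [v [[Hv _] ->]]. unfold F. unfold in_cD in Hv.
    pose proof (BK v Hv). pose proof (Cmod_ge_0 v).
    assert (Cmod v ^ 2 <= 1) by nra. nra. }
  { exists (F a), a. unfold Bad; auto. }
  assert (Fa : 4 * eps < M).
  { apply Rlt_le_trans with (F a); [|apply M1; exists a; unfold Bad; auto].
    pose proof (Hl a Ha). pose proof (Cmod_sub_le (f2 a) (peval l a)).
    pose proof (pow2_ge_0 (Cmod a)). unfold F. unfold eps in *. nra. }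
  (* Around every point of the disc [F] stays below its supremum [M] over the bad set by a fixed gap
     on bad points. Compactness makes the gap uniform, which contradicts the definition of [M]. *)
  destruct (compact_disc 1 (fun z d => Bad z -> F z <= M - d)) as [d [Hd H]].
  - intros z d d' Hd H Hz. specialize (H Hz). lra.
  - intro u. destruct (classic (in_cD u)) as [Hu|Hu].
    2: { destruct (outside_cD u Hu) as [d [Hd H]]. exists d. split; auto.
         intros z Hz [Sz _]. exfalso; apply (H z Hz Sz). }
    destruct (classic (f2 u = 0%C)) as [Zu|Nu].
    + destruct (Fcont u Hu eps Heps) as [d [Hd H]].
      exists (Rmin d eps). split; [apply Rmin_pos; auto|]. intros z Hz [Sz _].
      specialize (H z Sz (Rlt_le_trans _ _ _ Hz (Rmin_l _ _))).
      pose proof (Rmin_r d eps).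
      assert (F u <= 2 * eps).
      { unfold F. pose proof (Hl u Hu) as E. rewrite Zu in E.
        replace (0 - peval l u)%C with (- peval l u)%C in E by ring. rewrite Cmod_opp in E.
        unfold in_cD in Hu. pose proof (Cmod_ge_0 u).
        assert (Cmod u ^ 2 <= 1) by nra. nra. }
      lra.
    + destruct (lifts_quad_locally_constant u (fun _ => Nu)) as [r [Hr LC]].
      destruct (classic (lifts (quad u))) as [Lu|Lu].
      * exists r. split; auto. intros z Hz [_ [_ Lz]]. exfalso. apply Lz. apply LC; auto.
      (* At a bad point [u], some [w] on a small circle has a larger [F], and [w] is bad too. The
         circle may leave the disc, but [w] cannot, since [quad w] lifts outside. Hence [F u < M]
         strictly. *)
      * pose proof (proj1 (disc_algebra_iff _) (proj1 Hf2)) as [Cf2 _].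
        destruct (Cf2 u Hu (Cmod (f2 u)) (proj1 (Cmod_gt_0 _) Nu)) as [d1 [Hd1 N1]].
        set (s := Rmin r d1 / 2).
        assert (Hs : 0 < s /\ s < r /\ s < d1).
        { pose proof (Rmin_pos r d1 Hr Hd1). pose proof (Rmin_l r d1). pose proof (Rmin_r r d1).
          unfold s. lra. }
        destruct (peval_sq_no_local_max l u s eps) as [w [Ew Fw]]; try lra.
        assert (Bw : Bad w).
        { assert (Lw : ~ lifts (quad w)).
          { intro X. apply Lu. apply (LC w); auto. lra. }
          assert (Sw : in_cD w).
          { apply NNPP. intro X. apply Lw, lifts_quad_outside; auto. }
          split; auto. split; auto. intro X. specialize (N1 w Sw ltac:(lra)).
          rewrite X in N1. replace (0 - f2 u)%C with (- f2 u)%C in N1 by ring.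
          rewrite Cmod_opp in N1. lra. }
        assert (FuM : F u < M).
        { apply Rlt_le_trans with (F w); [exact Fw|]. apply M1. exists w; auto. }
        destruct (Fcont u Hu ((M - F u) / 2) ltac:(lra)) as [d [Hd H]].
        exists (Rmin d ((M - F u) / 2)). split; [apply Rmin_pos; lra|]. intros z Hz [Sz _].
        specialize (H z Sz (Rlt_le_trans _ _ _ Hz (Rmin_l _ _))).
        pose proof (Rmin_r d ((M - F u) / 2)). lra.
  - assert (M <= M - d); [|lra]. apply M2. intros y [v [Bv ->]]. apply H; auto. apply Bv.
Qed.
End Lift.

(** * Real zeros *)

(** Connectedness of the segment, through the supremum of the points at which [P] agrees with
    [P a]. *)
Lemma locally_constant_on_segment (P : R -> Prop) a b : a <= b ->
  (forall t, a <= t <= b -> exists r, 0 < r /\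
     forall t', a <= t' <= b -> Rabs (t' - t) < r -> (P t <-> P t')) ->
  (P a <-> P b).
Proof.
  intros Hab L.
  destruct (completeness (fun t => a <= t <= b /\ (P a <-> P t))) as [c [C1 C2]].
  { exists b. intros t [Ht _]; lra. }
  { exists a. split; [lra|tauto]. }
  assert (Hc : a <= c <= b).
  { split; [apply C1; split; [lra|tauto]|]. apply C2. intros t [Ht _]; lra. }
  destruct (L c Hc) as [r [Hr H]].
  assert (Pc : P a <-> P c).
  { apply NNPP. intro N. assert (c <= c - r); [|lra]. apply C2. intros t [Ht Pt].
    apply Rnot_lt_le. intro Lt. apply N. rewrite Pt.
    assert (t <= c) by (apply C1; auto).
    symmetry. apply H; auto. rewrite Rabs_left1; lra. }
  destruct (Req_dec c b) as [-> | Nb]; auto.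
  exfalso. set (t := Rmin b (c + r / 2)).
  assert (Ht : c < t /\ t <= b /\ t <= c + r / 2).
  { split; [apply Rmin_glb_lt; lra|]. split; [apply Rmin_l|apply Rmin_r]. }
  assert (t <= c); [|lra]. apply C1. split; [lra|]. rewrite Pc. apply H; [lra|].
  rewrite Rabs_pos_eq; lra.
Qed.

Lemma closed_set_max_below (Z : R -> Prop) t0 a :
  (forall s, ~ Z s -> exists d, 0 < d /\ forall t, Rabs (t - s) < d -> ~ Z t) ->
  t0 <= a -> Z t0 -> exists s, s <= a /\ Z s /\ forall t, s < t <= a -> ~ Z t.
Proof.
  intros Cl H0 Z0.
  destruct (completeness (fun t => t <= a /\ Z t)) as [s [S1 S2]].
  { exists a. intros t [Ht _]; auto. }
  { exists t0; auto. }
  exists s. split; [apply S2; intros t [Ht _]; auto|]. split.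
  - apply NNPP. intro N. destruct (Cl s N) as [d [Hd H]].
    assert (s <= s - d); [|lra]. apply S2. intros t [Ht Zt].
    apply Rnot_lt_le. intro Lt. apply (H t); auto.
    assert (t <= s) by (apply S1; auto). rewrite Rabs_left1; lra.
  - intros t Ht Zt. assert (t <= s); [apply S1; split; auto|]; lra.
Qed.

Lemma closed_set_min_above (Z : R -> Prop) t0 a :
  (forall s, ~ Z s -> exists d, 0 < d /\ forall t, Rabs (t - s) < d -> ~ Z t) ->
  a <= t0 -> Z t0 -> exists s, a <= s /\ Z s /\ forall t, a <= t < s -> ~ Z t.
Proof.
  intros Cl H0 Z0.
  destruct (closed_set_max_below (fun t => Z (- t)) (- t0) (- a)) as [s [S1 [S2 S3]]].
  - intros s N. destruct (Cl (- s) N) as [d [Hd H]]. exists d. split; auto.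
    intros t Ht. apply H. rewrite <- Rabs_Ropp.
    replace (- (- t - - s)) with (t - s) by ring. auto.
  - lra.
  - rewrite Ropp_involutive; auto.
  - exists (- s). split; [lra|]. split; auto. intros t Ht Zt.
    apply (S3 (- t)); [lra|]. rewrite Ropp_involutive; auto.
Qed.

Lemma in_cD_RtoC t : in_cD (RtoC t) <-> -1 <= t <= 1.
Proof.
  unfold in_cD. rewrite Cmod_R. split; intro H.
  - apply Rabs_le_between in H. lra.
  - apply Rabs_le. lra.
Qed.

Lemma rpeval_Im l t : Im (rpeval l (RtoC t)) = 0.
Proof.
  unfold rpeval. induction l as [|c l IH]; simpl; auto.
  unfold Im in *. simpl. rewrite IH. ring.
Qed.

Lemma rpeval_continuous l : continuity (fun t => Re (rpeval l (RtoC t))).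
Proof.
  unfold rpeval. induction l as [|c l IH].
  - simpl. apply continuity_const. intros x y; reflexivity.
  - intro x. apply continuity_pt_ext with (fun t => c + t * Re (peval (map RtoC l) (RtoC t))).
    + intro t. unfold Re. simpl. ring.
    + apply continuity_pt_plus; [apply continuity_pt_const; intros u v; reflexivity|].
      apply continuity_pt_mult; [apply derivable_continuous_pt, derivable_pt_id|apply IH].
Qed.

(** Synthetic division. The length of the list, rather than the degree, is controlled, so vanishing
    leading coefficients need no special treatment. *)
Lemma rpeval_divide_linear l a : exists l' r, (length l' <= pred (length l))%nat /\
  forall z, (rpeval l z = RtoC r + (z - RtoC a) * rpeval l' z)%C.
Proof.
  unfold rpeval. induction l as [|c l IH].
  - exists nil, 0. split; auto. intro; simpl. ring.
  - destruct l as [|d l].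
    + exists nil, c. split; auto. intro; simpl. ring.
    + destruct IH as [l' [r [Hl H]]]. exists (r :: l'), (c + a * r).
      split; [simpl in *; lia|]. intro z.
      change (peval (map RtoC (c :: d :: l)) z)
        with (RtoC c + z * peval (map RtoC (d :: l)) z)%C.
      rewrite H. simpl. rewrite RtoC_plus, RtoC_mult. ring.
Qed.

Lemma rpeval_divide_quadratic l t s : exists l' p q, (length l' <= pred (length l))%nat /\
  forall z, (rpeval l z = RtoC p * z + RtoC q + (z * z - RtoC t * z + RtoC s) * rpeval l' z)%C.
Proof.
  unfold rpeval. induction l as [|c l IH].
  - exists nil, 0, 0. split; auto. intro; simpl. ring.
  - destruct l as [|d l].
    + exists nil, 0, c. split; auto. intro; simpl. ring.
    + destruct IH as [l' [p [q [Hl H]]]]. exists (p :: l'), (q + p * t), (c - p * s).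
      split; [simpl in *; lia|]. intro z.
      change (peval (map RtoC (c :: d :: l)) z)
        with (RtoC c + z * peval (map RtoC (d :: l)) z)%C.
      rewrite H. simpl. rewrite RtoC_plus, RtoC_minus, !RtoC_mult. ring.
Qed.

Lemma Re_RtoC_mult x w : Re (RtoC x * w) = x * Re w.
Proof. unfold Re; simpl; ring. Qed.

Section RealZeros.
Variable f2 : C -> C.
Hypothesis Hf2 : real_disc_algebra f2.

Lemma real_zeros_closed s : ~ real_zero f2 s ->
  exists d, 0 < d /\ forall t, Rabs (t - s) < d -> ~ real_zero f2 t.
Proof.
  intro N. destruct (classic (in_cD (RtoC s))) as [Hs|Hs].
  - pose proof (proj1 (disc_algebra_iff _) (proj1 Hf2)) as [C2 _].
    assert (Ns : f2 (RtoC s) <> 0%C) by (intro X; apply N; split; auto; apply in_cD_RtoC; auto).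
    destruct (C2 _ Hs _ (proj1 (Cmod_gt_0 _) Ns)) as [d [Hd H]].
    exists d. split; auto. intros t Ht [Bt Zt]. apply in_cD_RtoC in Bt.
    specialize (H _ Bt). rewrite <- RtoC_minus, Cmod_R in H. specialize (H Ht).
    rewrite Zt in H. replace (0 - f2 (RtoC s))%C with (- f2 (RtoC s))%C in H by ring.
    rewrite Cmod_opp in H. lra.
  - destruct (outside_cD _ Hs) as [d [Hd H]]. exists d. split; auto.
    intros t Ht [Bt _]. apply (H (RtoC t)). rewrite <- RtoC_minus, Cmod_R; auto.
    apply in_cD_RtoC; auto.
Qed.

Lemma real_disc_algebra_linear t : real_disc_algebra (fun z => z - RtoC t)%C.
Proof.
  apply real_disc_algebra_minus; [apply real_disc_algebra_id|apply real_disc_algebra_const].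
Qed.

Lemma linear_no_common_zero t : ~ real_zero f2 t ->
  forall z, in_cD z -> (z - RtoC t)%C <> 0%C \/ f2 z <> 0%C.
Proof.
  intros N z Hz. destruct (classic (z = RtoC t)) as [-> | Nz].
  - right. intro X. apply N. split; auto. apply in_cD_RtoC; auto.
  - left. apply Csub_neq_0; auto.
Qed.

(** No common zero with [f2] arises while the root travels, so liftability is locally constant along
    the way. The factor [m] is what lets one root move while another stays fixed. *)
Lemma lifts_move_root m p q : real_disc_algebra m ->
  (forall z, in_cD z -> m z <> 0%C \/ f2 z <> 0%C) -> p <= q ->
  (forall t, p <= t <= q -> ~ real_zero f2 t) ->
  (lifts f2 (fun z => m z * (z - RtoC p))%C <-> lifts f2 (fun z => m z * (z - RtoC q))%C).
Proof.
  intros Hm Nm Hpq N.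
  assert (Hmt : forall t, real_disc_algebra (fun z => m z * (z - RtoC t))%C).
  { intro t. apply real_disc_algebra_mult; auto. apply real_disc_algebra_linear. }
  apply (locally_constant_on_segment (fun t => lifts f2 (fun z => m z * (z - RtoC t))%C)); auto.
  intros t Ht.
  destruct (lifts_locally_constant f2 Hf2 _ (Hmt t)) as [eta [Heta H]].
  { intros z Hz. destruct (Nm z Hz) as [N1|N1]; auto.
    destruct (linear_no_common_zero t (N t Ht) z Hz) as [N2|N2]; auto.
    left. apply Cmult_neq_0; auto. }
  destruct (disc_algebra_bounded m (proj1 Hm)) as [M [HM BM]].
  exists (eta / M). split; [apply Rdiv_lt_0_compat; auto|].
  intros t' _ Ht'. apply H; auto. intros z Hz.
  replace (m z * (z - RtoC t') - m z * (z - RtoC t))%C with (m z * RtoC (t - t'))%C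
    by (rewrite RtoC_minus; ring).
  rewrite Cmod_mult, Cmod_R, Rabs_minus_sym.
  replace eta with (M * (eta / M)) by (field; lra).
  apply Rmult_le_compat; auto; [apply Cmod_ge_0|apply Rabs_pos|lra].
Qed.

Lemma linear_outside_neq_0 t z : ~ (-1 <= t <= 1) -> in_cD z -> (z - RtoC t)%C <> 0%C.
Proof.
  intros N Hz. apply Csub_neq_0. intros ->. apply N, in_cD_RtoC; auto.
Qed.

Lemma lifts_linear_move p q : p <= q -> (forall t, p <= t <= q -> ~ real_zero f2 t) ->
  (lifts f2 (fun z => z - RtoC p)%C <-> lifts f2 (fun z => z - RtoC q)%C).
Proof.
  intros Hpq N.
  assert (E : forall t, lifts f2 (fun z => z - RtoC t)%C
     <-> lifts f2 (fun z => RtoC 1 * (z - RtoC t))%C).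
  { intro t. split; apply lifts_ext; intros; ring. }
  rewrite !E. apply (lifts_move_root (fun _ => RtoC 1)); auto.
  apply real_disc_algebra_const. intros; left; apply C1_nz.
Qed.

(** The root is pushed left to at most [-2], outside the disc, where the linear factor is a unit;
    [Rmin] covers the case of a root already beyond [-2]. *)
Lemma lifts_linear_below a : (forall t, t <= a -> ~ real_zero f2 t) ->
  lifts f2 (fun z => z - RtoC a)%C.
Proof.
  intro N. pose proof (Rmin_l (-2) a). pose proof (Rmin_r (-2) a).
  apply (lifts_linear_move (Rmin (-2) a) a); auto. intros; apply N; lra.
  apply lifts_unit; [apply real_disc_algebra_linear|].
  intros z Hz. apply linear_outside_neq_0; auto. lra.
Qed.

Lemma lifts_linear_above a : (forall t, a <= t -> ~ real_zero f2 t) ->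
  lifts f2 (fun z => z - RtoC a)%C.
Proof.
  intro N. pose proof (Rmax_l 2 a). pose proof (Rmax_r 2 a).
  apply (lifts_linear_move a (Rmax 2 a)); auto. intros; apply N; lra.
  apply lifts_unit; [apply real_disc_algebra_linear|].
  intros z Hz. apply linear_outside_neq_0; auto. lra.
Qed.

(** Starting from the double root at [a], which lifts as [quad] of a real point, one of the two
    roots is moved to [b]. *)
Lemma lifts_linear_pair a b : -1 <= a <= 1 ->
  (forall t, Rmin a b <= t <= Rmax a b -> ~ real_zero f2 t) ->
  lifts f2 (fun z => (z - RtoC a) * (z - RtoC b))%C.
Proof.
  intros Ha N.
  assert (Na : ~ real_zero f2 a) by (apply N; split; [apply Rmin_l|apply Rmax_l]).
  assert (Laa : lifts f2 (fun z => (z - RtoC a) * (z - RtoC a))%C).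
  { apply lifts_ext with (quad (RtoC a)).
    - intros z _. unfold quad. rewrite Cconj_RtoC. reflexivity.
    - apply lifts_quad; auto. apply in_cD_RtoC; auto. intro X. apply Na. split; auto. }
  pose proof (lifts_move_root (fun z => z - RtoC a)%C (Rmin a b) (Rmax a b)
    (real_disc_algebra_linear a) (linear_no_common_zero a Na)
    (Rle_trans _ _ _ (Rmin_l a b) (Rmax_l a b)) N) as H.
  destruct (Rle_or_lt a b) as [L|L].
  - rewrite Rmin_left, Rmax_right in H by lra. apply H; auto.
  - rewrite Rmin_right, Rmax_left in H by lra. apply H; auto.
Qed.

(** Convertible to [POZ p f2]; with [f2] fixed it is the property passed from a polynomial to its
    quotients. *)
Definition same_sign (p : C -> C) : Prop :=
  (forall t, real_zero f2 t -> 0 < Re (p (RtoC t))) \/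
  (forall t, real_zero f2 t -> Re (p (RtoC t)) < 0).

Lemma same_sign_factor (k : R -> R) p p' :
  (forall t, real_zero f2 t -> Re (p (RtoC t)) = k t * Re (p' (RtoC t))) ->
  (forall t, real_zero f2 t -> 0 < k t) \/ (forall t, real_zero f2 t -> k t < 0) ->
  same_sign p -> same_sign p'.
Proof.
  intros E [K|K] [S|S]; [left|right|right|left]; intros t Ht;
    specialize (K t Ht); specialize (S t Ht); rewrite (E t Ht) in S; nra.
Qed.

(** Induction on the length of [l]: every factor divided out lifts and has constant sign at the real
    zeros of [f2], so that the quotient satisfies the same hypotheses. *)
Lemma lifts_rpeval l :
  (forall z, in_cD z -> f2 z = 0%C -> rpeval l z <> 0%C) -> same_sign (rpeval l) ->
  lifts f2 (rpeval l).
Proof.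
  assert (G : forall n l, (length l <= n)%nat ->
    (forall z, in_cD z -> f2 z = 0%C -> rpeval l z <> 0%C) -> same_sign (rpeval l) ->
    lifts f2 (rpeval l)); [|apply (G (length l) l); auto].
  clear l. induction n as [|n IH]; intros l Hl N S.
  (* The zero polynomial: by hypothesis [f2] has no zero in the disc, and [0 = f2 - f2] is a lift to
     the unit [f2]. *)
  - destruct l; [|simpl in Hl; lia].
    exists f2, (fun _ => RtoC (-1)). split; auto. split.
    { intros z Hz X. apply (N z Hz X). reflexivity. }
    split; [apply real_disc_algebra_const|]. intros z _.
    change (RtoC (-1)) with (RtoC (- (1))). rewrite RtoC_opp. unfold rpeval; simpl. ring.
  - destruct (classic (exists z, in_cD z /\ rpeval l z = 0%C)) as [[a0 [Ha0 Za0]]|Nz].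
    2: { apply lifts_unit; [apply real_disc_algebra_rpeval|].
         intros z Hz X. apply Nz. exists z; auto. }
    assert (Na0 : f2 a0 <> 0%C) by (intro X; apply (N a0 Ha0 X Za0)).
    destruct (Req_dec (Im a0) 0) as [Ia|Ia].
    + assert (Ea : a0 = RtoC (Re a0)).
      { destruct a0 as [x y]; unfold Im, RtoC in *; simpl in *. rewrite Ia; reflexivity. }
      set (a := Re a0) in *. clearbody a. subst a0. apply in_cD_RtoC in Ha0.
      assert (Ra : ~ real_zero f2 a) by (intros [_ X]; auto).
      destruct (rpeval_divide_linear l a) as [l1 [r [Hl1 E]]].
      assert (Er : RtoC r = 0%C).
      { rewrite E in Za0. rewrite <- Za0. ring. }
      assert (E' : forall z, (rpeval l z = (z - RtoC a) * rpeval l1 z)%C)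
        by (intro z; rewrite E, Er; ring).
      assert (N1 : forall z, in_cD z -> f2 z = 0%C -> rpeval l1 z <> 0%C).
      { intros z Hz X Y. apply (N z Hz X). rewrite E', Y. ring. }
      assert (R1 : forall t, Re (rpeval l (RtoC t)) = (t - a) * Re (rpeval l1 (RtoC t))).
      { intro t. rewrite E', <- RtoC_minus. apply Re_RtoC_mult. }
      assert (Ne : forall t, real_zero f2 t -> t <> a) by (intros t Ht ->; auto).
      (* If all real zeros of [f2] lie on one side of [a], then [t - a] has one sign at them and the
         quotient keeps a constant sign. *)
      destruct (classic (exists t, real_zero f2 t /\ t <= a)) as [[t0 [Z0 H0]]|Nbelow].
      2: { eapply lifts_ext; [intros z _; symmetry; apply E'|].
           apply (lifts_mult f2 Hf2).
           - apply lifts_linear_below. intros t Ht Zt. apply Nbelow. exists t; auto.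
           - apply IH; auto; [lia|]. apply (same_sign_factor (fun t => t - a)) with (rpeval l); auto.
             left. intros t Zt. destruct (Rle_or_lt t a); [|lra].
             exfalso. apply Nbelow. exists t; auto. }
      destruct (classic (exists t, real_zero f2 t /\ a <= t)) as [[t1 [Z1 H1]]|Nabove].
      2: { eapply lifts_ext; [intros z _; symmetry; apply E'|].
           apply (lifts_mult f2 Hf2).
           - apply lifts_linear_above. intros t Ht Zt. apply Nabove. exists t; auto.
           - apply IH; auto; [lia|]. apply (same_sign_factor (fun t => t - a)) with (rpeval l); auto.
             right. intros t Zt. destruct (Rle_or_lt a t); [|lra].
             exfalso. apply Nabove. exists t; auto. }
      destruct (closed_set_max_below _ t0 a real_zeros_closed H0 Z0) as [x [Hx [Zx Gx]]].
      destruct (closed_set_min_above _ t1 a real_zeros_closed H1 Z1) as [y [Hy [Zy Gy]]].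
      assert (Hxa : x < a) by (pose proof (Ne x Zx); lra).
      assert (Hay : a < y) by (pose proof (Ne y Zy); lra).
      (* Between the neighbouring zeros [x < a < y] the factor [t - a] changes sign while [rpeval l]
         does not, so the quotient changes sign and has a root [b] in the same gap. *)
      assert (Sxy : Re (rpeval l1 (RtoC x)) * Re (rpeval l1 (RtoC y)) < 0).
      { pose proof (R1 x) as Ex. pose proof (R1 y) as Ey.
        destruct S as [S|S]; pose proof (S x Zx) as Sx; pose proof (S y Zy) as Sy;
          rewrite Ex in Sx; rewrite Ey in Sy.
        - assert (Re (rpeval l1 (RtoC x)) < 0) by nra.
          assert (0 < Re (rpeval l1 (RtoC y))) by nra. nra.
        - assert (0 < Re (rpeval l1 (RtoC x))) by nra.
          assert (Re (rpeval l1 (RtoC y)) < 0) by nra. nra. }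
      destruct (IVT_cor (fun t => Re (rpeval l1 (RtoC t))) x y (rpeval_continuous l1)
        ltac:(lra) ltac:(lra)) as [b [Hb Zb]].
      assert (Zb' : rpeval l1 (RtoC b) = 0%C).
      { pose proof (rpeval_Im l1 b) as Ib. destruct (rpeval l1 (RtoC b)) as [u v].
        unfold Re, Im in *; simpl in *. subst. reflexivity. }
      assert (Hb' : x < b < y).
      { split; apply Rnot_le_lt; intro X.
        - replace b with x in Zb by lra. rewrite Zb in Sxy. lra.
        - replace b with y in Zb by lra. rewrite Zb in Sxy. lra. }
      destruct (rpeval_divide_linear l1 b) as [l2 [r2 [Hl2 E2]]].
      assert (Er2 : RtoC r2 = 0%C).
      { rewrite E2 in Zb'. rewrite <- Zb'. ring. }
      assert (E2' : forall z, (rpeval l1 z = (z - RtoC b) * rpeval l2 z)%C)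
        by (intro z; rewrite E2, Er2; ring).
      apply lifts_ext with (fun z => ((z - RtoC a) * (z - RtoC b)) * rpeval l2 z)%C.
      { intros z _. rewrite E', E2'. ring. }
      apply (lifts_mult f2 Hf2 (fun z => (z - RtoC a) * (z - RtoC b))%C).
      * apply lifts_linear_pair; auto. intros t Ht.
        assert (x < t < y).
        { destruct Ht. split; [apply Rlt_le_trans with (Rmin a b); auto; apply Rmin_glb_lt; lra|].
          apply Rle_lt_trans with (Rmax a b); auto. apply Rmax_lub_lt; lra. }
        destruct (Rle_or_lt t a); [apply Gx; lra|apply Gy; lra].
      * apply IH; [lia| |].
        { intros z Hz X Y. apply (N1 z Hz X). rewrite E2', Y. ring. }
        apply (same_sign_factor (fun t => (t - a) * (t - b))) with (rpeval l); auto.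
        { intros t _. rewrite R1, E2', <- RtoC_minus, Re_RtoC_mult. ring. }
        left. intros t Zt.
        (* A real zero of [f2] outside the gap lies on the same side of [a] and [b], so
           [(t - a) (t - b)] is positive there. *)
        assert (t <= x \/ y <= t).
        { destruct (Rle_or_lt t x); auto. destruct (Rle_or_lt y t); auto. exfalso.
          destruct (Rle_or_lt t a); [apply (Gx t)|apply (Gy t)]; auto; lra. }
        nra.
    + destruct (rpeval_divide_quadratic l (2 * Re a0) (Cmod a0 ^ 2)) as [l1 [p [q [Hl1 E]]]].
      assert (Q : forall z, (z * z - RtoC (2 * Re a0) * z + RtoC (Cmod a0 ^ 2) = quad a0 z)%C).
      { intro z. unfold quad. rewrite Cmod2_alt. destruct a0 as [u v]. destruct z as [x y].
        unfold Re, Im, RtoC, Cconj, Cminus, Cplus, Cmult, Copp; simpl. f_equal; ring. }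
      assert (Q0 : quad a0 a0 = 0%C) by (unfold quad; ring).
      assert (Z : (RtoC p * a0 + RtoC q = 0)%C).
      { rewrite <- Za0, E, Q, Q0. ring. }
      (* A real linear remainder that vanishes at a nonreal point is zero. *)
      assert (Hp : p = 0).
      { apply (f_equal Im) in Z. unfold Im in *. simpl in Z.
        apply Rmult_eq_reg_r with (snd a0); auto. lra. }
      assert (Hq : q = 0).
      { apply (f_equal Re) in Z. unfold Re in *. simpl in Z. rewrite Hp in Z. lra. }
      assert (E' : forall z, (rpeval l z = quad a0 z * rpeval l1 z)%C)
        by (intro z; rewrite E, Q, Hp, Hq; ring).
      eapply lifts_ext; [intros z _; symmetry; apply E'|].
      apply (lifts_mult f2 Hf2); [apply lifts_quad; auto|].
      apply IH; [lia| |].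
      * intros z Hz X Y. apply (N z Hz X). rewrite E', Y. ring.
      (* At real [t] a conjugate pair contributes the square of the distance from [t] to [a0],
         positive since [a0] is not real. *)
      * apply (same_sign_factor (fun t => Cmod (RtoC t - a0) ^ 2)) with (rpeval l); auto.
        { intros t _. rewrite E'. rewrite <- Re_RtoC_mult. f_equal. f_equal.
          unfold quad. rewrite Cmod2_conj, Cconj_minus, Cconj_RtoC. reflexivity. }
        left. intros t _. apply pow_lt, Cmod_gt_0, Csub_neq_0. intro X. apply Ia.
        rewrite <- X. reflexivity.
Qed.

(** The approximating polynomial must satisfy two closeness conditions: [e1] makes it congruent to
    [f1 e] modulo [f2], which transfers the nonvanishing and sign conditions; [e2] makes its
    liftability equivalent to that of [f1]. *)
Lemma lifts_of_same_sign f1 : real_disc_algebra f1 ->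
  (forall z, in_cD z -> f1 z <> 0%C \/ f2 z <> 0%C) -> same_sign f1 -> lifts f2 f1.
Proof.
  intros Hf1 N S.
  destruct (close_unit_congr f2 Hf2 f1 Hf1 N) as [e1 [He1 H1]].
  destruct (lifts_locally_constant f2 Hf2 f1 Hf1 N) as [e2 [He2 H2]].
  destruct (real_disc_algebra_poly_dense f1 (Rmin e1 e2) Hf1) as [l Hl];
    [apply Rmin_pos; auto|].
  assert (D : forall z, in_cD z -> Cmod (rpeval l z - f1 z) <= Rmin e1 e2)
    by (intros z Hz; rewrite Cmod_sub_sym; left; auto).
  pose proof (real_disc_algebra_rpeval l) as Hp.
  apply (H2 (rpeval l) Hp).
  { intros z Hz. eapply Rle_trans; [apply D; auto|apply Rmin_r]. }
  destruct (H1 (rpeval l) Hp) as [e [h [He [Be [Hh E]]]]].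
  { intros z Hz. eapply Rle_trans; [apply D; auto|apply Rmin_l]. }
  assert (E0 : forall z, in_cD z -> f2 z = 0%C -> (rpeval l z = f1 z * e z)%C).
  { intros z Hz X. rewrite E, X by auto. ring. }
  apply lifts_rpeval.
  - intros z Hz X. rewrite E0 by auto. apply Cmult_neq_0.
    + destruct (N z Hz); auto.
    + apply near_1_neq_0; auto.
  (* At a real zero of [f2] the value of [f1] is real, so the real part of [f1 e] is [f1] times
     [Re e], with [Re e >= 1/2]. *)
  - apply (same_sign_factor (fun t => / Re (e (RtoC t)))) with f1; auto.
    + intros t [Bt Zt]. pose proof (proj2 (in_cD_RtoC t) Bt) as Ht.
      rewrite E0 by auto. pose proof (Be _ Ht) as B.
      assert (If : Im (f1 (RtoC t)) = 0).
      { pose proof (proj2 Hf1 _ Ht) as Sy. rewrite Cconj_RtoC in Sy.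
        apply (f_equal Im) in Sy. unfold Im in *. simpl in Sy. lra. }
      pose proof (Rle_trans _ _ _ (re_le_Cmod _) B) as B'.
      apply Rabs_le_between in B'. unfold Re, Im in *. simpl in *. rewrite If.
      field. lra.
    + left. intros t [Bt Zt]. pose proof (proj2 (in_cD_RtoC t) Bt) as Ht.
      apply Rinv_0_lt_compat.
      pose proof (Rle_trans _ _ _ (re_le_Cmod _) (Be _ Ht)) as B'.
      apply Rabs_le_between in B'. unfold Re in *. simpl in *. lra.
Qed.
End RealZeros.

Theorem theorem1p2 (f1 f2 : C -> C) (delta : R)
  (hf1 : real_disc_algebra f1) (hf2 : real_disc_algebra f2)
  (hn1 : sup_norm_le1 f1) (hn2 : sup_norm_le1 f2)
  (hpoz : POZ f1 f2)
  (hlb : forall z, in_cD z -> delta <= Cmod (f1 z) + Cmod (f2 z))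
  (hglb : forall e, (forall z, in_cD z -> e <= Cmod (f1 z) + Cmod (f2 z)) -> e <= delta)
  (hdelta : 0 < delta) :
  exists g1 g2 : C -> C,
    real_disc_algebra g1 /\ real_disc_algebra g2 /\
    (forall z, in_cD z -> g1 z <> 0%C) /\
    real_disc_algebra (fun z => Cinv (g1 z)) /\
    (forall z, in_cD z -> (f1 z * g1 z + f2 z * g2 z)%C = 1%C).
Proof.
  destruct (lifts_of_same_sign f2 hf2 f1 hf1) as [u [h [Hu [Nu [Hh E]]]]].
  - intros z Hz. specialize (hlb z Hz).
    destruct (classic (f1 z = 0%C)) as [Z1|]; auto.
    right. intro Z2. rewrite Z1, Z2, Cmod_0 in hlb. lra.
  - exact hpoz.
  - assert (Hi : real_disc_algebra (fun z => / u z)%C)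
      by (apply real_disc_algebra_inv; auto).
    assert (Ni : forall z, in_cD z -> (/ u z)%C <> 0%C).
    { intros z Hz X. pose proof (Cinv_r (u z) (Nu z Hz)) as Y.
      rewrite X, Cmult_0_r in Y. apply C1_nz. auto. }
    (* Dividing [f1 = u + h f2] by [u] gives [f1 / u - (h / u) f2 = 1]. *)
    exists (fun z => / u z)%C, (fun z => - h z * / u z)%C.
    split; auto. split.
    { apply real_disc_algebra_mult; auto. apply real_disc_algebra_opp; auto. }
    split; auto. split; [apply real_disc_algebra_inv; auto|].
    intros z Hz. rewrite E by auto. field. auto.
Qed.
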